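(* Let $\bar\nu_\varepsilon$ be the multimarginal Schrödinger barycenter and $\hat\nu^N_\varepsilon$ the empirical multimarginal Schrödinger barycenter. There exists a constant $C:=C(m,\varepsilon)>0$ such that for any $h\in L^\infty(\bar\nu_\varepsilon)$ and all $t>0$, with probability at least $1-(2m^2-2m+2)e^{-t}$, $$|(\bar\nu_\varepsilon-\hat\nu_\varepsilon^N)(h)|\le C\|h\|_\infty\sqrt{\frac tN}.$$
   Context: Fix integers $m\ge2$, $d\ge1$, $\varepsilon>0$ and weights $\alpha=(\alpha_1,\dots,\alpha_m)$ with $\alpha_j\ge0$, $\sum_j\alpha_j=1$. For $j\in[m]:=\{1,\dots,m\}$, $\mathcal X_j\subset[-1,1]^d$ is compact with non-empty interior and $\nu_j$ is a Borel probability measure on $\mathcal X_j$; $\mathcal X=\prod_j\mathcal X_j$. Let $c_\alpha(x_1,\dots,x_m)=\sum_{1\le i<j\le m}|\alpha_ix_i-\alpha_jx_j|^2$, $T_\alpha(x_1,\dots,x_m)=\sum_{j=1}^m\alpha_jx_j$, and, with $\Pi(\mu_1,\dots,\mu_m)$ the set of couplings and $\mathrm{KL}$ relative entropy, $$S_{\alpha,\varepsilon}(\mu_1,\dots,\mu_m)=\inf_{\pi\in\Pi(\mu_1,\dots,\mu_m)}\int_{\mathcal X}c_\alpha\,d\pi+\varepsilon\,\mathrm{KL}(\pi\|\otimes_k\mu_k).$$ The multimarginal Schrödinger barycenter (MSB) is $\bar\nu_\varepsilon=(T_\alpha)_\sharp\pi^*_\varepsilon$ (pushforward), where $\pi_\varepsilon^*$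 is the unique minimizer of $S_{\alpha,\varepsilon}(\nu_1,\dots,\nu_m)$. For each $j$ let $X^{(j)}_1,\dots,X^{(j)}_N$ be i.i.d. from $\nu_j$, the $m$ samples being independent, and $\hat\nu_j^N=\frac1N\sum_k\delta_{X^{(j)}_k}$. The empirical MSB is $\hat\nu^N_\varepsilon=(T_\alpha)_\sharp\hat\pi^N_\varepsilon$, with $\hat\pi^N_\varepsilon$ the unique minimizer of $S_{\alpha,\varepsilon}(\hat\nu^N_1,\dots,\hat\nu^N_m)$. For a (signed) measure $\mu$, $\mu(h)=\int h\,d\mu$. The cost (hence $\alpha$ and $d$) is regarded as fixed. *)

(* Defs.v *)
From HB Require Import structures.
From mathcomp Require Import all_boot all_order all_algebra.
From mathcomp Require Import all_classical all_reals all_analysis.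
From mathcomp Require Import measurable_realfun.

Set Implicit Arguments.
Unset Strict Implicit.
Unset Printing Implicit Defensive.
Import Order.TTheory GRing.Theory Num.Theory.
Import numFieldNormedType.Exports.

Local Open Scope classical_set_scope.
Local Open Scope charge_scope.
Local Open Scope ring_scope.

(* R^d with its Borel sigma-algebra. Points of (R^d)^m are m-tuples, with the
   product sigma-algebra that the library puts on tuples. *)
Notation borel_rV R d := (g_sigma_algebraType (@open 'rV[R]_d)).

(* The library norm on 'rV[R]_d is the sup norm, not the Euclidean one. *)
Definition sqnorm (R : realType) (d : nat) (v : 'rV[R]_d) : R :=
  \sum_(k < d) v 0 k ^+ 2.

Definition cost (R : realType) (m d : nat) (alpha : 'I_m -> R)
    (x : m.-tuple (borel_rV R d)) : R :=
  \sum_(i < m) \sum_(j < m | (i < j)%N)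
    sqnorm (alpha i *: (tnth x i : 'rV[R]_d)
            - alpha j *: (tnth x j : 'rV[R]_d)).

Definition wmean (R : realType) (m d : nat) (alpha : 'I_m -> R)
    (x : m.-tuple (borel_rV R d)) : borel_rV R d :=
  \sum_(j < m) alpha j *: (tnth x j : 'rV[R]_d).

Section wmean_measurable.
Context {R : realType} {d : nat}.

Lemma measurable_coord (k : 'I_d) :
  measurable_fun [set: borel_rV R d]
    (fun v : borel_rV R d => (v : 'rV[R]_d) 0 k).
Proof.
apply: (measurability _ (RGenOpens.measurableE R)).
move=> _ [_ [a [b ->] <-]]; rewrite setTI; apply: sub_sigma_algebra.
have /continuousP := @coord_continuous R 1 d 0 k.
by apply; exact: interval_open.
Qed.

Lemma measurable_fun_rV (d' : measure_display) (T : measurableType d')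
    (f : T -> borel_rV R d) :
  (forall k, measurable_fun [set: T] (fun x => (f x : 'rV[R]_d) 0 k)) ->
  measurable_fun [set: T] f.
Proof.
move=> mf; apply: (@measurability _ _ _ (borel_rV R d) setT f open) => //.
move=> _ [U oU <-]; rewrite setTI.
pose box (p : 'rV[rat]_d * nat) : set 'rV[R]_d :=
  [set v | forall k, `|v 0 k - ratr (p.1 0 k)| < p.2.+1%:R^-1].
rewrite (_ : _ @^-1` _ = \bigcup_p
    (if `[< box p `<=` U >] then f @^-1` box p else set0)); last first.
  apply/seteqP; split => [x /= Ufx|x [p _]]; last first.
    by case: ifPn => // /asboolP sU ?; exact: sU.
  have /nbhs_ballP[e /= e0 eU] : nbhs (f x : 'rV[R]_d) U.
    by apply: open_nbhs_nbhs.
  have [n ne] : exists n, (2 * n.+1%:R^-1 : R) < e.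
    have e20 : 0 < e / 2 by rewrite divr_gt0.
    have /cvgrPdist_lt /(_ _ e20)[n _ /(_ n (leqnn _))] := @cvg_harmonic R.
    rewrite sub0r normrN ger0_norm ?invr_ge0 //= => h; exists n.
    by rewrite mulrC -ltr_pdivlMr.
  have n0 : 0 < (n.+1%:R^-1 : R) by rewrite invr_gt0 ltr0n.
  have /choice[q qP] : forall k : 'I_d, exists q : rat,
      `|(f x : 'rV[R]_d) 0 k - ratr q| < n.+1%:R^-1.
    move=> k; have := @dense_rat R (ball ((f x : 'rV[R]_d) 0 k) n.+1%:R^-1).
    case; first by exists ((f x : 'rV[R]_d) 0 k); exact: ballxx.
      exact: ball_open.
    by move=> t [/= h [q _ qt]]; exists q; rewrite qt.
  exists (\row_k q k, n) => //; rewrite asboolT /=.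
    by move=> k; rewrite mxE.
  move=> v vb; apply: eU; split => // i k; rewrite (ord1 i).
  apply: lt_trans ne; rewrite /ball/= mulr_natl mulr2n.
  apply: le_lt_trans (ler_distD (ratr (q k)) _ _) _.
  by apply: ltrD => //; have := vb k; rewrite mxE distrC.
apply: countable_bigcupT_measurable => [|p]; first exact: countableP.
case: ifPn => // _.
rewrite (_ : _ @^-1` _ = \bigcap_(k in [set: 'I_d])
   ((fun x => (f x : 'rV[R]_d) 0 k) @^-1`
     ball (ratr (p.1 0 k) : R) p.2.+1%:R^-1)).
  apply: fin_bigcap_measurable ; first exact: finite_finset.
  move=> k _; rewrite -[X in measurable X]setTI; apply: mf => //.
  exact: measurable_ball.
by apply/seteqP; split => x /= + k => /(_ k); rewrite /ball/= distrC// => /(_ I).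
Qed.

Lemma measurable_wmean (m : nat) (alpha : 'I_m -> R) :
  measurable_fun [set: m.-tuple (borel_rV R d)] (@wmean R m d alpha).
Proof.
apply: measurable_fun_rV => k.
rewrite (_ : (fun _ => _) =
  (fun x => \sum_(j < m) alpha j * (tnth x j : 'rV[R]_d) 0 k)).
  apply: measurable_sum => j; apply: measurable_funM => //.
  apply: (measurableT_comp (measurable_coord k)).
  exact: measurable_tnth.
by apply/funext => x; rewrite /wmean summxE; apply: eq_bigr => j _; rewrite mxE.
Qed.

End wmean_measurable.

HB.instance Definition _ (R : realType) (m d : nat) (alpha : 'I_m -> R) :=
  isMeasurableFun.Build _ _ _ _ (@wmean R m d alpha) (measurable_wmean alpha).

Section product.
Context {dT : measure_display} {T : measurableType dT} {R : realType}.

Definition cons_pair (n : nat) (p : T * n.-tuple T) : n.+1.-tuple T :=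
  [tuple of p.1 :: p.2].

Lemma measurable_cons_pair n : measurable_fun setT (@cons_pair n).
Proof. exact: measurable_cons. Qed.

HB.instance Definition _ n :=
  isMeasurableFun.Build _ _ _ _ (@cons_pair n) (@measurable_cons_pair n).

(* The product measure of m probability measures; see [prod_probE]. *)
Fixpoint prod_prob (m : nat) :
    ('I_m -> probability T R) -> probability (m.-tuple T) R :=
  match m with
  | 0 => fun _ => \d_([tuple] : 0.-tuple T)
  | n.+1 => fun mu => distribution
      (mu ord0 \x prod_prob (fun j => mu (lift ord0 j)))%E (@cons_pair n)
  end.

Lemma prod_probE (m : nat) (mu : 'I_m -> probability T R) (A : 'I_m -> set T) :
  (forall j, measurable (A j)) ->
  prod_prob mu [set x | forall j, A j (tnth x j)] =
  (\prod_(j < m) mu j (A j))%E.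
Proof.
elim: m mu A => [|m IH] mu A mA /=.
  by rewrite big_ord0 diracE mem_set // => -[].
rewrite /distribution /pushforward.
rewrite (_ : _ @^-1` _ = A ord0 `*`
    [set x : m.-tuple T | forall j, A (lift ord0 j) (tnth x j)]).
  rewrite product_measure1E //; last first.
    rewrite (_ : [set _ | _] =
      \bigcap_(j in setT) ((@tnth _ T ^~ j) @^-1` A (lift ord0 j))).
      apply: fin_bigcap_measurable ; first exact: finite_finset.
      move=> j _; rewrite -[X in measurable X]setTI.
      exact: measurable_tnth.
    by apply/seteqP; split => x /= h j; [move=> _; exact: h|exact: h].
  rewrite big_ord_recl; congr (_ * _)%E.
  exact: (IH (fun j => mu (lift ord0 j)) (fun j => A (lift ord0 j))).
apply/seteqP; split => -[x t] /=.
  by move=> h; split; [exact: (h ord0)|move=> j; have := h (lift ord0 j); rewrite tnthS].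
case=> h0 h j; case: (unliftP ord0 j) => [k ->|->//].
by rewrite tnthS.
Qed.

Definition coupling (m : nat) (mu : 'I_m -> probability T R)
    (pi : probability (m.-tuple T) R) : Prop :=
  forall j (A : set T), measurable A ->
    pushforward pi (fun x => tnth x j) A = mu j A.

End product.

(* The library density is finite everywhere and positive nu-almost everywhere,
   so the junk values of [fine] and [ln] do not matter. *)
Definition KL (dT : measure_display) (T : measurableType dT) (R : realType)
    (nu mu : probability T R) : \bar R :=
  if `[< nu `<< mu >] then
    (\int[nu]_x (ln (fine (('d (charge_of_finite_measure nu) '/d mu) x)))%:E)%E
  else +oo%E.

Section schrodinger.
Context {R : realType} {m d : nat}.
Variables (alpha : 'I_m -> R) (eps : R).
Implicit Types (mu : 'I_m -> probability (borel_rV R d) R)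
               (pi : probability (m.-tuple (borel_rV R d)) R).

Definition objective mu pi : \bar R :=
  (\int[pi]_x (cost alpha x)%:E + eps%:E * KL pi (prod_prob mu))%E.

Definition schrodinger_value mu : \bar R :=
  ereal_inf [set objective mu pi | pi in coupling mu].

Definition schrodinger_minimizer mu pi : Prop :=
  coupling mu pi /\ objective mu pi = schrodinger_value mu.

Definition barycenter pi : probability (borel_rV R d) R :=
  distribution pi (@wmean R m d alpha).

End schrodinger.

Section empirical.
Context {dT : measure_display} {T : measurableType dT} {R : realType}.
Context {N : nat}.
Variables (N0 : (0 < N)%N) (x : 'I_N -> T).

(* [N0] makes this a probability measure. *)
Definition empirical of (0 < N)%N := fun A : set T =>
  ((N%:R^-1)%:E * \sum_(k < N) (\d_(x k) A : \bar R))%E.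

Let emp := empirical N0.

Let emp0 : emp set0 = 0%E.
Proof. by rewrite /emp /empirical big1 ?mule0. Qed.

Let emp_ge0 A : (0 <= emp A)%E.
Proof.
by apply: mule_ge0; [rewrite lee_fin invr_ge0|apply: sume_ge0].
Qed.

Let emp_sigma_additive : semi_sigma_additive emp.
Proof.
have r0 : (0 : R) <= N%:R^-1 by rewrite invr_ge0.
have -> : emp = mscale (NngNum r0)
    (msum (fun k => \d_(x (insubd (Ordinal N0) k))) N).
  apply/funext => A; congr (_ * _)%E; apply: eq_bigr => k _.
  rewrite (_ : insubd _ _ = k) //.
  by apply: val_inj; rewrite val_insubd ltn_ord.
exact: measure_semi_sigma_additive.
Qed.

HB.instance Definition _ :=
  isMeasure.Build _ _ _ emp emp0 emp_ge0 emp_sigma_additive.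

Let emp_setT : emp setT = 1%E.
Proof.
rewrite /emp /empirical (eq_bigr (fun=> 1%E)); last by move=> k _; rewrite diracT.
rewrite sumEFin sumr_const card_ord -EFinM mulVf // pnatr_eq0.
by rewrite -lt0n.
Qed.

HB.instance Definition _ := Measure_isProbability.Build _ _ _ emp emp_setT.

End empirical.

Section independence.
Context {dO dT : measure_display} {Omega : measurableType dO}
  {T : measurableType dT} {R : realType} (P : probability Omega R).

Definition mutually_independent (I : finType) (X : I -> {RV P >-> T}) : Prop :=
  forall (J : {set I}) (B : I -> set T), (forall i, measurable (B i)) ->
    P (\bigcap_(i in [set i | i \in J]) (X i @^-1` B i)) =
    (\prod_(i in J) P (X i @^-1` B i))%E.

(* m independent samples of size N, the j-th one being i.i.d. with law nu j. *)
Definition iid_samples (m N : nat) (nu : 'I_m -> probability T R)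
    (X : 'I_m -> 'I_N -> {RV P >-> T}) : Prop :=
  (forall j k (A : set T), measurable A -> distribution P (X j k) A = nu j A) /\
  mutually_independent (fun jk : 'I_m * 'I_N => X jk.1 jk.2).

(* Inner probability at least p; for a measurable [Q] this is p <= P Q. *)
Definition with_probability_at_least (p : R) (Q : set Omega) : Prop :=
  exists E : set Omega, [/\ measurable E, E `<=` Q & (p%:E <= P E)%E].

End independence.

(* Main.v *)
Require Import Defs.
From HB Require Import structures.
From mathcomp Require Import all_boot all_order all_algebra.
From mathcomp Require Import all_classical all_reals all_analysis.
From mathcomp Require Import measurable_realfun ess_sup_inf ring lra.

(** The proof works with densities relative to product measures.

    Let [p] be the density of the optimal coupling with respect to the product
    [mu] of the [nu j]. Testing its optimality against variations that keep the
    marginals shows that [p] lies between two positive constants that depend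
    only on [m], [eps] and a bound of the cost ([optimal_density_le],
    [optimal_density_ge]), and then that it has the Gibbs form
    [c + eps ln p = sum_j phi_j(x_j) + kappa] almost everywhere
    ([optimal_density_sum]).

    Let [muhat] be the product of the empirical measures and [q] the density of
    the empirical optimizer with respect to [muhat]. Because of the Gibbs form,
    [q] minimizes the entropy relative to [p muhat] among the densities of
    couplings of the empirical measures. The density [p] is almost one of them:
    its marginals under [muhat] differ from 1 by averages of [N] observations.
    Adding one-variable functions to [p] corrects these marginals, and the
    corrected density is a competitor whose relative entropy is at most a
    constant times the mean square of the marginal errors. A form of Pinsker's
    inequality turns this into a bound for the integral of [|q - p|] under
    [muhat] ([stability]).

    The difference of the two barycenters at [h] is therefore bounded, up to the
    norm of [h], by the marginal errors of [p] and by the fluctuation of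
    [muhat(h p)], where [h] is read as a function of tuples
    ([comparison_main]). Both are V-statistics of independent observations with
    bounded kernels, so the method of bounded differences makes them
    sub-Gaussian with variance of order [1 / N] ([vstat_subgaussian]; for the
    marginal errors one conditions on the observation at which they are
    evaluated, [marginal_error_subgaussian]). The mean square of the marginal
    errors has the tail of a single one of them ([subgaussian_qmean_tail]).
    Their uniform smallness, which keeps the competitor nonnegative, comes from
    a union bound over the observations and holds with probability
    [1 - exp (- t)] as long as [t <= c N] for a small constant [c]
    ([linear_union_tail]).

    Outside of the range [1 <= t <= c N] the theorem is elementary: for [t < 1]
    the asserted probability is at most 0, and for [t > c N] the error is at
    most twice the norm of [h], which the bound exceeds. *)

Set Implicit Arguments.
Unset Strict Implicit.
Unset Printing Implicit Defensive.
Import Order.TTheory GRing.Theory Num.Theory.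
Import numFieldNormedType.Exports.

Local Open Scope classical_set_scope.
Local Open Scope ring_scope.

(** * Bounded measurable functions and real integrals *)

Section bounded_measurable.
Context {dT : measure_display} {T : measurableType dT} {R : realType}.
Implicit Types f g : T -> R.

Definition bmfun f := measurable_fun setT f /\ exists B, forall x, `|f x| <= B.

Lemma measurable_gt_cst (r : R) f : measurable_fun setT f ->
  measurable [set x | r < f x].
Proof.
move=> mf; have := measurable_fun_ltr (@measurable_cst _ _ _ _ setT r) mf.
by move=> /(_ measurableT [set true] I); rewrite setTI.
Qed.

Lemma measurable_lt_cst (r : R) f : measurable_fun setT f ->
  measurable [set x | f x < r].
Proof.
move=> mf; have := measurable_fun_ltr mf (@measurable_cst _ _ _ _ setT r).
by move=> /(_ measurableT [set true] I); rewrite setTI.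
Qed.

Lemma measurable_norm_le_cst (r : R) f : measurable_fun setT f ->
  measurable [set x | `|f x| <= r].
Proof.
move=> mf; have := measurable_fun_ler
  (measurableT_comp (@normr_measurable R setT) mf) (@measurable_cst _ _ _ _ setT r).
by move=> /(_ measurableT [set true] I); rewrite setTI.
Qed.

Lemma bmfun_measurable f : bmfun f -> measurable_fun setT f.
Proof. by case. Qed.

Lemma bmfunW f a b : measurable_fun setT f ->
  (forall x, a <= f x <= b) -> bmfun f.
Proof.
move=> mf ab; split => //; exists (`|a| + `|b|) => x.
have /andP[afx fxb] := ab x; rewrite ler_norml; apply/andP; split.
  rewrite lerNl (le_trans (_ : _ <= - a)) ?lerN2//.
  by rewrite (le_trans (ler_norm _))// normrN lerDl.
by rewrite (le_trans fxb)// (le_trans (ler_norm _))// lerDr.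
Qed.

Lemma bmfun_cst r : bmfun (fun=> r).
Proof. by split; [exact: measurable_cst|exists `|r|]. Qed.

Lemma bmfunD f g : bmfun f -> bmfun g -> bmfun (fun x => f x + g x).
Proof.
move=> [mf [B fB]] [mg [B' gB]]; split; first exact: measurable_funD.
by exists (B + B') => x; rewrite (le_trans (ler_normD _ _))// lerD.
Qed.

Lemma bmfunN f : bmfun f -> bmfun (fun x => - f x).
Proof.
move=> [mf [B fB]]; split; first exact: measurableT_comp.
by exists B => x; rewrite normrN.
Qed.

Lemma bmfunB f g : bmfun f -> bmfun g -> bmfun (fun x => f x - g x).
Proof. by move=> bf bg; apply: bmfunD => //; exact: bmfunN. Qed.

Lemma bmfunM f g : bmfun f -> bmfun g -> bmfun (fun x => f x * g x).
Proof.
move=> [mf [B fB]] [mg [B' gB]]; split; first exact: measurable_funM.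
by exists (B * B') => x; rewrite normrM ler_pM.
Qed.

Lemma bmfunX f n : bmfun f -> bmfun (fun x => f x ^+ n).
Proof.
move=> [mf [B fB]]; split; first exact: measurable_funX.
by exists (B ^+ n) => x; rewrite normrX lerXn2r ?nnegrE// (le_trans _ (fB x)).
Qed.

Lemma bmfun_sum (I : Type) (s : seq I) (Q : pred I) (F : I -> T -> R) :
  (forall i, bmfun (F i)) -> bmfun (fun x => \sum_(i <- s | Q i) F i x).
Proof.
move=> bF; elim: s => [|i s IH].
  rewrite (_ : (fun _ => _) = cst 0); first exact: bmfun_cst.
  by apply/funext => x; rewrite big_nil.
case Qi: (Q i); last by under eq_fun do rewrite big_cons Qi.
by under eq_fun do rewrite big_cons Qi; apply: bmfunD.
Qed.

Lemma bmfun_indic (A : set T) : measurable A -> bmfun (\1_A : T -> R).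
Proof.
move=> mA; split; first exact: measurable_indic.
by exists 1 => x; rewrite indicE; case: (_ \in _); rewrite ?normr1// normr0.
Qed.

Lemma bmfun_expR f : bmfun f -> bmfun (fun x => expR (f x)).
Proof.
move=> [mf [B fB]]; split.
  by apply: measurableT_comp => //; exact: measurable_expR.
exists (expR B) => x; rewrite ger0_norm ?expR_ge0// ler_expR.
exact: le_trans (ler_norm _) (fB x).
Qed.

Lemma bmfun_max f g : bmfun f -> bmfun g -> bmfun (fun x => Num.max (f x) (g x)).
Proof.
move=> [mf [B fB]] [mg [B' gB]]; split; first exact: measurable_maxr.
exists (Num.max B B') => x; rewrite le_max.
by rewrite /Num.max; case: ltP; rewrite ?fB ?gB ?orbT.
Qed.

Lemma bmfun_norm f : bmfun f -> bmfun (fun x => `|f x|).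
Proof.
move=> [mf [B fB]]; split; first exact: measurableT_comp.
by exists B => x; rewrite normr_id.
Qed.

Lemma bmfun_ln f a : 0 < a -> (forall x, a <= f x) -> bmfun f ->
  bmfun (fun x => ln (f x)).
Proof.
move=> a0 af [mf [B fB]]; apply: (@bmfunW _ (ln a) (ln B)).
  exact: measurableT_comp (@measurable_ln R) mf.
move=> x; have fx0 : 0 < f x by exact: lt_le_trans (af x).
have fxB : f x <= B by exact: le_trans (ler_norm _) (fB x).
by rewrite !ler_ln ?posrE ?af ?fxB// (lt_le_trans fx0).
Qed.

Lemma bmfun_inv f a : 0 < a -> (forall x, a <= f x) -> bmfun f ->
  bmfun (fun x => (f x)^-1).
Proof.
move=> a0 af bf; have fx0 x : 0 < f x by exact: lt_le_trans (af x).
have -> : (fun x => (f x)^-1) = (fun x => expR (- ln (f x))).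
  by apply/funext => x; rewrite expRN lnK// posrE.
by apply: bmfun_expR; apply: bmfunN; exact: bmfun_ln af bf.
Qed.

End bounded_measurable.

Lemma bmfun_comp {dS dT : measure_display}
    {S : measurableType dS} {T : measurableType dT} {R : realType}
    (h : S -> T) (f : T -> R) : measurable_fun setT h -> bmfun f -> bmfun (fun x => f (h x)).
Proof.
by move=> mh [mf [B fB]]; split; [exact: measurableT_comp|exists B => x; exact: fB].
Qed.

Section real_integral.
Context {dT : measure_display} {T : measurableType dT} {R : realType}.
Variable mu : probability T R.
Implicit Types f g : T -> R.

Definition integ f := mu.-integrable setT (EFin \o f).

Lemma integ_measurable f : integ f -> measurable_fun setT f.
Proof. by move=> /measurable_int/measurable_EFinP. Qed.

Lemma bmfun_integ f : bmfun f -> integ f.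
Proof.
move=> [mf [B fB]]; apply: measurable_bounded_integrable => //.
  by rewrite (le_lt_trans (probability_le1 mu measurableT))// ltry.
by exists B; split; [exact: num_real|move=> r Br x _; apply: le_trans (ltW Br)].
Qed.

Lemma integD f g : integ f -> integ g -> integ (fun x => f x + g x).
Proof. by move=> If Ig; exact: (integrableD measurableT If Ig). Qed.

Lemma integN f : integ f -> integ (fun x => - f x).
Proof. by move=> If; exact: (integrableN If). Qed.

Lemma integB f g : integ f -> integ g -> integ (fun x => f x - g x).
Proof. by move=> If Ig; exact: (integrableB measurableT If Ig). Qed.

Lemma integ_bmfunMl f g : bmfun f -> integ g -> integ (fun x => f x * g x).
Proof.
move=> [mf [B fB]] Ig; have := @integrableMr _ _ _ mu setT measurableT f (EFin \o g) mf; apply => //.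
by exists B; split; [exact: num_real|move=> r Br x _; apply: le_trans (ltW Br)].
Qed.

Lemma integ_bmfunMr f g : integ f -> bmfun g -> integ (fun x => f x * g x).
Proof.
by move=> If bg; under eq_fun do rewrite mulrC; exact: integ_bmfunMl.
Qed.

Lemma integZ r f : integ f -> integ (fun x => r * f x).
Proof. by move=> If; apply: integ_bmfunMl => //; exact: bmfun_cst. Qed.

Lemma integ_norm f : integ f -> integ (fun x => `|f x|).
Proof. by move=> If; exact: (integrable_norm If). Qed.

Lemma integ_le f g : measurable_fun setT f -> (forall x, `|f x| <= g x) ->
  integ g -> integ f.
Proof.
move=> mf fg Ig; apply: le_integrable Ig => //; first exact/measurable_EFinP.
by move=> x _ /=; rewrite lee_fin (le_trans (fg x))// ler_norm.
Qed.

Lemma integ_sum (I : Type) (s : seq I) (Q : pred I) (F : I -> T -> R) :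
  (forall i, integ (F i)) -> integ (fun x => \sum_(i <- s | Q i) F i x).
Proof.
move=> bF; elim: s => [|i s IH].
  rewrite (_ : (fun _ => _) = cst 0); first exact/bmfun_integ/bmfun_cst.
  by apply/funext => x; rewrite big_nil.
case Qi: (Q i); last by under eq_fun do rewrite big_cons Qi.
by under eq_fun do rewrite big_cons Qi; apply: integD.
Qed.

Lemma intD f g : integ f -> integ g ->
  \int[mu]_x (f x + g x) = \int[mu]_x f x + \int[mu]_x g x.
Proof. by move=> If Ig; rewrite RintegralD. Qed.

Lemma intB f g : integ f -> integ g ->
  \int[mu]_x (f x - g x) = \int[mu]_x f x - \int[mu]_x g x.
Proof. by move=> If Ig; rewrite RintegralB. Qed.

Lemma intZ r f : integ f -> \int[mu]_x (r * f x) = r * \int[mu]_x f x.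
Proof. by move=> If; rewrite RintegralZl. Qed.

Lemma intN f : integ f -> \int[mu]_x (- f x) = - \int[mu]_x f x.
Proof.
move=> If; rewrite -mulN1r -intZ//.
by apply: eq_Rintegral => x _; rewrite mulN1r.
Qed.

Lemma int_cst r : \int[mu]_x r = r.
Proof.
have mu1 : mu setT = 1%E by exact: probability_setT.
by rewrite Rintegral_cst// (congr1 fine mu1 : fine _ = 1) mulr1.
Qed.

Lemma int_sum (I : Type) (s : seq I) (Q : pred I) (F : I -> T -> R) :
  (forall i, integ (F i)) ->
  \int[mu]_x (\sum_(i <- s | Q i) F i x) = \sum_(i <- s | Q i) \int[mu]_x F i x.
Proof.
move=> bF; elim: s => [|i s IH].
  by rewrite big_nil; under eq_Rintegral do rewrite big_nil; rewrite int_cst.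
rewrite big_cons; under eq_Rintegral do rewrite big_cons.
by case: (Q i) => //; rewrite intD ?IH//; exact: integ_sum.
Qed.

Lemma int_le f g : integ f -> integ g -> (forall x, f x <= g x) ->
  \int[mu]_x f x <= \int[mu]_x g x.
Proof. by move=> If Ig fg; apply: le_Rintegral. Qed.

Lemma int_ge0 f : (forall x, 0 <= f x) -> 0 <= \int[mu]_x f x.
Proof. by move=> f0; apply: Rintegral_ge0. Qed.

Lemma EFin_int f : integ f -> (\int[mu]_x f x)%:E = (\int[mu]_x (f x)%:E)%E.
Proof. by move=> If; rewrite /Rintegral fineK//; exact: integrable_fin_num. Qed.

Lemma int_indic (A : set T) : measurable A ->
  \int[mu]_x (\1_A x : R) = fine (mu A).
Proof. by move=> mA; rewrite /Rintegral integral_indic// setIT. Qed.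

Lemma int_ae f g : integ f -> integ g ->
  {ae mu, forall x, f x = g x} -> \int[mu]_x f x = \int[mu]_x g x.
Proof.
move=> If Ig fg; congr fine; apply: ae_eq_integral => //.
- exact: measurable_int If.
- exact: measurable_int Ig.
- by apply: filterS fg => x /= -> _.
Qed.

Lemma integ_ae f g : measurable_fun setT g -> integ f ->
  {ae mu, forall x, f x = g x} -> integ g.
Proof.
move=> mg If fg; have mf := integ_measurable If.
move/integrableP : If => [mf' fy]; apply/integrableP; split.
  exact/measurable_EFinP.
rewrite (_ : (\int[mu]_x _)%E = \int[mu]_x `|(EFin \o f) x|)%E//.
apply: ae_eq_integral => //; do 1? by apply: measurableT_comp => //; exact/measurable_EFinP.
by apply: filterS fg => x /= -> _.
Qed.

Lemma int_le_ae f g : integ f -> integ g ->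
  {ae mu, forall x, f x <= g x} -> \int[mu]_x f x <= \int[mu]_x g x.
Proof.
move=> If Ig fg; have mf := integ_measurable If; have mg := integ_measurable Ig.
have Im : integ (fun x => Num.max (f x) (g x)).
  apply: (@integ_le _ (fun x => `|f x| + `|g x|)).
  - exact: measurable_maxr.
  - by move=> x; rewrite /Num.max; case: ifP => _; rewrite ?lerDl ?lerDr.
  - by apply: integD; exact: integ_norm.
rewrite (@int_ae g (fun x => Num.max (f x) (g x)))//; last first.
  by apply: filterS fg => x /= fg; rewrite max_r.
by apply: int_le => // x; rewrite le_max lexx.
Qed.

Lemma int_eq0_ae f : integ f -> (forall x, 0 <= f x) -> \int[mu]_x f x <= 0 ->
  {ae mu, forall x, f x = 0}.
Proof.
move=> If f0 fle.
have /(ae_eq_integral_abs mu measurableT (measurable_int _ If)) : (\int[mu]_(x in setT) `|(EFin \o f) x| = 0)%E.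
  rewrite (_ : integral _ _ _ = \int[mu]_x (f x)%:E)%E; last first.
    by apply: eq_integral => x _ /=; rewrite ger0_norm.
  rewrite -EFin_int//; congr EFin; apply/eqP; rewrite eq_le fle/=.
  exact: int_ge0.
by apply: filterS => x /= /(_ I) [].
Qed.

Lemma norm_int_le f B : bmfun f -> (forall x, `|f x| <= B) ->
  `|\int[mu]_x f x| <= B.
Proof.
move=> bf fB; have If := bmfun_integ bf.
have Ic r : integ (fun=> r) by apply: bmfun_integ; exact: bmfun_cst.
rewrite ler_norml; apply/andP; split.
  rewrite -[leLHS]int_cst; apply: int_le => // x.
  by have := fB x; rewrite ler_norml => /andP[].
rewrite -[leRHS]int_cst; apply: int_le => // x.
by have := fB x; rewrite ler_norml => /andP[].
Qed.

End real_integral.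

(** * Densities and relative entropy *)

Section log_inequalities.
Context {R : realType}.
Implicit Types x y : R.

Lemma ln_le_sub1 x : 0 < x -> ln x <= x - 1.
Proof.
by move=> x0; rewrite lerBrDl (le_trans (expR_ge1Dx _))// lnK// posrE.
Qed.

Lemma ge_sub1_xlnx x : 0 <= x -> x - 1 <= x * ln x.
Proof.
rewrite le_eqVlt => /predU1P[<-|x0]; first by rewrite mul0r sub0r lerN10.
have := @ln_le_sub1 x^-1; rewrite invr_gt0 => /(_ x0).
rewrite lnV ?posrE// => h.
have : x * - ln x <= x * (x^-1 - 1) by rewrite ler_pM2l.
by rewrite mulrBr mulfV ?gt_eqF// mulrN mulr1; lra.
Qed.

End log_inequalities.

Section density.
Context {dT : measure_display} {T : measurableType dT} {R : realType}.
Implicit Types (mu pi : probability T R) (q : T -> R).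

Definition density mu q pi := [/\ measurable_fun setT q, forall x, 0 <= q x &
  forall A, measurable A -> pi A = (\int[mu]_(x in A) (q x)%:E)%E].

Lemma density_exists mu q : measurable_fun setT q -> (forall x, 0 <= q x) ->
  integ mu q -> \int[mu]_x q x = 1 -> exists pi, density mu q pi.
Proof.
move=> mq q0 Iq q1.
pose nu := fun A : set T => (\int[mu]_(x in A) (q x)%:E)%E.
have nu0 : nu set0 = 0%E by rewrite /nu integral_set0.
have nuge0 A : (0 <= nu A)%E by apply: integral_ge0 => x _; rewrite lee_fin.
have nus : semi_sigma_additive nu.
  apply: semi_sigma_additive_nng_induced; first exact/measurable_EFinP.
  by move=> x; rewrite lee_fin.
pose nuM : {measure set T -> \bar R} :=
  HB.pack nu (isMeasure.Build _ _ _ nu nu0 nuge0 nus).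
have nuT : nuM setT = 1%E.
  by transitivity (\int[mu]_x q x)%:E; [rewrite EFin_int|rewrite q1].
pose nuP : probability T R := HB.pack nu nuM
  (Measure_isProbability.Build _ _ _ nuM nuT).
by exists nuP; split.
Qed.

Section density_theory.
Variables (mu pi : probability T R) (q : T -> R).
Hypothesis qpi : density mu q pi.

Let mq : measurable_fun setT q. Proof. by case: qpi. Qed.
Let q0 x : 0 <= q x. Proof. by case: qpi. Qed.

Lemma density_dominates : pi `<< mu.
Proof.
apply/null_content_dominatesP => A mA muA; case: qpi => _ _ ->//.
apply: null_set_integral => //.
by apply/measurable_funTS/measurable_EFinP.
Qed.

Lemma density_ge_null (delta : R) (A : set T) : 0 < delta ->
  (forall x, delta <= q x) -> measurable A -> pi A = 0%E -> mu A = 0%E.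
Proof.
move=> delta0 dq mA piA; have [_ _ qE] := qpi.
have : (delta%:E * mu A <= 0)%E.
  rewrite -piA qE// -integral_cst//; apply: ge0_le_integral => //.
  - by move=> x _; rewrite lee_fin ltW.
  - by apply/measurable_funTS/measurable_EFinP.
  - by move=> x _; rewrite lee_fin.
rewrite pmule_rle0 ?lte_fin// => muA.
by apply/eqP; rewrite eq_le muA measure_ge0.
Qed.

Lemma density_ae_eq_RN : ae_eq mu setT (Radon_Nikodym_SigmaFinite.f pi mu)
  (EFin \o q).
Proof.
apply: integral_ae_eq => //.
- exact: Radon_Nikodym_SigmaFinite.f_integrable density_dominates.
- exact/measurable_EFinP.
- move=> A _ mA.
  case: qpi => _ _ <- //; rewrite -Radon_Nikodym_SigmaFinite.f_integral //.
  exact: density_dominates.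
Qed.

Lemma density_ae_eq_RN_charge :
  ae_eq mu setT (Radon_Nikodym (charge_of_finite_measure pi) mu) (EFin \o q).
Proof.
apply: ae_eq_trans density_ae_eq_RN; apply: ae_eq_sym.
exact: (ae_eq_Radon_Nikodym_SigmaFinite density_dominates).
Qed.

Lemma ge0_integral_density (f : T -> \bar R) : (forall x, 0 <= f x)%E ->
  measurable_fun setT f ->
  (\int[pi]_x f x = \int[mu]_x (f x * (q x)%:E))%E.
Proof.
move=> f0 mf.
rewrite -(Radon_Nikodym_SigmaFinite.change_of_variables density_dominates)//.
apply: ae_eq_integral => //.
- apply: emeasurable_funM => //; apply: measurable_int.
  exact: Radon_Nikodym_SigmaFinite.f_integrable density_dominates.
- by apply: emeasurable_funM => //; exact/measurable_EFinP.
- by apply: ae_eqe_mul2l; exact: density_ae_eq_RN.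
Qed.

Lemma integ_density (f : T -> R) : measurable_fun setT f ->
  integ pi f <-> integ mu (fun x => f x * q x).
Proof.
move=> mf; have e : (\int[pi]_x `|(f x)%:E| = \int[mu]_x `|(f x * q x)%:E|)%E.
  rewrite ge0_integral_density//; last first.
    by apply: measurableT_comp => //; exact/measurable_EFinP.
  by apply: eq_integral => x _; rewrite EFinM abseM [X in _ = (_ * X)%E]gee0_abs ?lee_fin.
split=> /integrableP[_ fy]; apply/integrableP; split.
- by apply/measurable_EFinP; exact: measurable_funM.
- by rewrite -e.
- exact/measurable_EFinP.
- by rewrite e.
Qed.

Lemma int_density (f : T -> R) : measurable_fun setT f ->
  integ mu (fun x => f x * q x) -> \int[pi]_x f x = \int[mu]_x (f x * q x).
Proof.
move=> mf /(integ_density mf) If; congr fine.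
rewrite -(Radon_Nikodym_change_of_variables density_dominates measurableT If).
apply: ae_eq_integral => //.
- apply: emeasurable_funM; first exact/measurable_EFinP.
  by apply: measurable_int (Radon_Nikodym_integrable _); exact: density_dominates.
- by apply/measurable_EFinP; exact: measurable_funM.
- have /(ae_eqe_mul2l (EFin \o f)) := density_ae_eq_RN_charge.
  by apply: filterS => x /= h /h ->; rewrite EFinM.
Qed.

Lemma density_integ : integ mu q.
Proof.
have -> : q = (fun x => cst 1 x * q x) by apply/funext => x; rewrite mul1r.
by apply/(@integ_density (cst 1)) => //; exact/bmfun_integ/bmfun_cst.
Qed.

Lemma density_int1 : \int[mu]_x q x = 1.
Proof.
rewrite -[RHS](int_cst pi) (int_density (f := cst 1))//.
  by apply: eq_Rintegral => x _; rewrite mul1r.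
have -> : (fun x => cst 1 x * q x) = q by apply/funext => x; rewrite mul1r.
exact: density_integ.
Qed.

Lemma KL_density : integ mu (fun x => q x * ln (q x)) ->
  KL pi mu = (\int[mu]_x (q x * ln (q x)))%:E.
Proof.
move=> Iq; rewrite /KL asboolT; last exact: density_dominates.
have mlnq : measurable_fun setT (fun x => ln (q x)).
  exact: measurableT_comp (@measurable_ln R) mq.
have Iq' : integ mu (fun x => ln (q x) * q x) by under eq_fun do rewrite mulrC.
transitivity (\int[pi]_x ln (q x))%:E; last first.
  by rewrite int_density//; congr EFin; apply: eq_Rintegral => x _; rewrite mulrC.
rewrite EFin_int; last exact/integ_density.
apply: ae_eq_integral => //.
- apply/measurable_EFinP; apply: measurableT_comp (@measurable_ln R) _.
  apply: measurableT_comp => //.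
  by apply: measurable_int (Radon_Nikodym_integrable _); exact: density_dominates.
- exact/measurable_EFinP.
- apply: (null_dominates_ae_eq _ density_dominates) => //.
  by apply: filterS density_ae_eq_RN_charge => x /= h /h ->.
Qed.

End density_theory.

(** Finite relative entropy provides a density with integrable [q ln q]: the
    negative part of [q ln q] is bounded by 1, so that the extended integral
    defining the entropy cannot be finite by a cancellation of infinities. *)
Lemma KL_lty_density mu pi : (KL pi mu < +oo)%E ->
  exists q, density mu q pi /\ integ mu (fun x => q x * ln (q x)).
Proof.
rewrite /KL; case: asboolP => // dom KLy.
pose q x := fine (Radon_Nikodym_SigmaFinite.f pi mu x).
have mf := Radon_Nikodym_SigmaFinite.f_integrable dom.
have qE x : (q x)%:E = Radon_Nikodym_SigmaFinite.f pi mu x.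
  by rewrite fineK// Radon_Nikodym_SigmaFinite.f_fin_num.
have qpi : density mu q pi.
  split.
  - by apply: measurableT_comp => //; exact: measurable_int mf.
  - by move=> x; rewrite -lee_fin qE Radon_Nikodym_SigmaFinite.f_ge0.
  - move=> A mA; rewrite (Radon_Nikodym_SigmaFinite.f_integral dom)//.
    by apply: eq_integral => x _; rewrite qE.
have [mq q0 _] := qpi.
exists q; split => //.
have mlnq : measurable_fun setT (fun x => ln (q x)).
  exact: measurableT_comp (@measurable_ln R) mq.
suff Iln : integ pi (fun x => ln (q x)).
  by under eq_fun do rewrite mulrC; apply/(integ_density qpi).
have {}KLy : (\int[pi]_x (ln (q x))%:E < +oo)%E.
  apply: le_lt_trans KLy; rewrite le_eqVlt; apply/orP; left; apply/eqP.
  apply: ae_eq_integral => //.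
  - exact/measurable_EFinP.
  - apply/measurable_EFinP; apply: measurableT_comp (@measurable_ln R) _.
    apply: measurableT_comp => //.
  - apply: (null_dominates_ae_eq _ dom) => //; apply: ae_eq_sym.
    by apply: filterS (density_ae_eq_RN_charge qpi) => x /= h /h ->.
have negy : (\int[pi]_x ((EFin \o (fun x => ln (q x)))^\- x) < +oo)%E.
  rewrite (ge0_integral_density qpi)//; last first.
    by apply: measurable_funeneg; exact/measurable_EFinP.
  apply: (@le_lt_trans _ _ (\int[mu]_x 1)%E); last first.
    rewrite integral_cst// mul1e.
    by rewrite (le_lt_trans (probability_le1 mu measurableT))// ltry.
  apply: ge0_le_integral => //.
  - by move=> x _; rewrite mule_ge0 ?lee_fin.
  - apply: emeasurable_funM; last exact/measurable_EFinP.
    by apply: measurable_funeneg; exact/measurable_EFinP.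
  - move=> x _; rewrite funenegE /= -EFin_max -EFinM lee_fin.
    have := ge_sub1_xlnx (q0 x); have := q0 x; rewrite /Num.max.
    by case: ifP => _; nra.
have posy : (\int[pi]_x ((EFin \o (fun x => ln (q x)))^\+ x) < +oo)%E.
  move: KLy; rewrite integralE.
  have := @integral_ge0 _ _ _ pi setT ((EFin \o (fun x => ln (q x)))^\- )%E.
  move=> /(_ (fun x _ => funeneg_ge0 _ _)); move: negy.
  case: (integral pi setT _^\-)%E => [r| |]//.
  by case: (integral pi setT _)%E => [s| |]// *; rewrite ltry.
apply/integrableP; split; first exact/measurable_EFinP.
have -> : (fun x => `|(EFin \o (fun x => ln (q x))) x|)%E =
  ((EFin \o (fun x => ln (q x)))^\+ \+ (EFin \o (fun x => ln (q x)))^\-)%E.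
  exact: (fune_abse (EFin \o (fun x => ln (q x)))).
rewrite ge0_integralD//; first exact: lte_add_pinfty.
- by apply: measurable_funepos; exact/measurable_EFinP.
- by apply: measurable_funeneg; exact/measurable_EFinP.
Qed.

End density.

(** * Product measures and independence of coordinates *)

Section fubini_bounded.
Context {d1 d2 : measure_display} {T1 : measurableType d1}
  {T2 : measurableType d2} {R : realType}.
Variables (P1 : probability T1 R) (P2 : probability T2 R).
Implicit Types f : T1 * T2 -> R.

Let prodP : probability (T1 * T2)%type R := (P1 \x P2)%E.

Lemma bmfun_pair1 f x : bmfun f -> bmfun (fun y => f (x, y)).
Proof. by apply: bmfun_comp; exact: pair1_measurable. Qed.

Lemma bmfun_pair2 f y : bmfun f -> bmfun (fun x => f (x, y)).
Proof. by apply: (bmfun_comp (h := fun x => (x, y))); exact: pair2_measurable. Qed.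

Lemma bmfun_int1 f : bmfun f -> bmfun (fun x => \int[P2]_y f (x, y)).
Proof.
move=> bf; have If := bmfun_integ prodP bf.
split; last by case: (bf) => _ [B fB]; exists B => x; apply: norm_int_le => //;
  exact: bmfun_pair1.
apply: (measurableT_comp (@fine_measurable R setT measurableT)).
exact: measurable_fubini_F If.
Qed.

Lemma bmfun_int2 f : bmfun f -> bmfun (fun y => \int[P1]_x f (x, y)).
Proof.
move=> bf; have If := bmfun_integ prodP bf.
split; last by case: (bf) => _ [B fB]; exists B => x; apply: norm_int_le => //;
  exact: bmfun_pair2.
apply: (measurableT_comp (@fine_measurable R setT measurableT)).
exact: measurable_fubini_G If.
Qed.

Lemma fubini12 f : bmfun f ->
  \int[prodP]_z f z = \int[P1]_x \int[P2]_y f (x, y).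
Proof.
move=> bf; have If := bmfun_integ prodP bf.
congr fine; rewrite -(integral12_prod_meas1 If).
apply: eq_integral => x _; rewrite EFin_int//.
by apply: bmfun_integ; exact: bmfun_pair1.
Qed.

Lemma fubini21 f : bmfun f ->
  \int[prodP]_z f z = \int[P2]_y \int[P1]_x f (x, y).
Proof.
move=> bf; have If := bmfun_integ prodP bf.
congr fine; rewrite -(integral21_prod_meas1 If).
apply: eq_integral => x _; rewrite EFin_int//.
by apply: bmfun_integ; exact: bmfun_pair2.
Qed.

End fubini_bounded.

Section product_measure.
Context {dT : measure_display} {T : measurableType dT} {R : realType}.

Definition rect n (A : 'I_n -> set T) : set (n.-tuple T) :=
  [set x | forall j, A j (tnth x j)].

Lemma measurable_rect n (A : 'I_n -> set T) : (forall j, measurable (A j)) ->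
  measurable (rect A).
Proof.
move=> mA; rewrite (_ : rect A =
   \bigcap_(j in setT) ((@tnth _ T ^~ j) @^-1` A j)).
  apply: fin_bigcap_measurable; first exact: finite_finset.
  by move=> j _; rewrite -[X in measurable X]setTI; exact: measurable_tnth.
by apply/seteqP; split => x /= h j; [move=> _; exact: h|exact: h].
Qed.

Lemma measurable_tuple_rect n :
  @measurable _ (n.-tuple T) =
  <<s [set rect A | A in [set A : 'I_n -> set T | forall j, measurable (A j)] ]>>.
Proof.
apply/seteqP; split; last first.
  apply: smallest_sub; first exact: sigma_algebra_measurable.
  by move=> _ [A mA <-]; exact: measurable_rect.
set G := [set rect A | A in _] => B mB.
have mid : measurable_fun [set: g_sigma_algebraType G]
    (fun x : g_sigma_algebraType G => x : n.-tuple T).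
  apply/measurable_fun_tnthP => i _ A mA; rewrite setTI.
  apply: sub_sigma_algebra; exists (fun j => if j == i then A else setT).
    by move=> j /=; case: ifP.
  apply/seteqP; split => x /= h; first by have := h i; rewrite eqxx.
  by move=> j; case: ifP => // /eqP ->.
by have := mid measurableT B mB; rewrite setTI.
Qed.

Lemma eq_prod_prob n (nu : 'I_n -> probability T R)
    (P : probability (n.-tuple T) R) :
  (forall A, (forall j, measurable (A j)) ->
    P (rect A) = (\prod_(j < n) nu j (A j))%E) ->
  forall B, measurable B -> P B = prod_prob nu B.
Proof.
move=> PE B mB.
pose G := [set rect A | A in [set A : 'I_n -> set T | forall j, measurable (A j)] ].
apply: (measure_unique G (fun=> setT)) => //.
- exact: measurable_tuple_rect.
- move=> _ _ [A mA <-] [A' mA' <-]; exists (fun j => A j `&` A' j).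
    by move=> j; exact: measurableI.
  apply/seteqP; split => x /= h; first by split=> j; have [] := h j.
  by move=> j; case: h => h1 h2; split; [exact: h1|exact: h2].
- by move=> _; exists (fun=> setT) => //; apply/seteqP; split.
- by apply/seteqP; split => // x _; exists 0%N.
- by move=> _ [A mA <-]; exact: etrans (PE _ mA) (esym (prod_probE _ mA)).
- move=> k; have P1 : P setT = 1%E by exact: probability_setT.
  by apply: (le_lt_trans (_ : _ <= 1)%E (ltry 1)); rewrite le_eqVlt; apply/orP; left; apply/eqP; exact: P1.
Qed.

Section law.
Context {dO : measure_display} {Omega : measurableType dO}.
Variables (P : probability Omega R) (n : nat) (nu : 'I_n -> probability T R).
Variable F : Omega -> n.-tuple T.
Hypothesis mF : measurable_fun setT F.
Hypothesis PF : forall A, (forall j, measurable (A j)) ->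
  P (F @^-1` rect A) = (\prod_(j < n) nu j (A j))%E.

Let F' : {RV P >-> n.-tuple T} :=
  HB.pack F (isMeasurableFun.Build _ _ _ _ F mF).

Lemma prod_prob_preimage B : measurable B -> P (F @^-1` B) = prod_prob nu B.
Proof. by move=> mB; apply: (eq_prod_prob (P := distribution P F')). Qed.

Lemma prod_prob_int f : bmfun f ->
  \int[prod_prob nu]_x f x = \int[P]_w f (F w).
Proof.
move=> bf; congr fine.
transitivity (\int[distribution P F']_x (f x)%:E)%E.
  apply: eq_measure_integral => A mA _; apply/esym.
  exact: (eq_prod_prob (P := distribution P F')).
rewrite integral_distribution//.
  by apply/measurable_EFinP; case: bf.
by apply: bmfun_integ; exact: bmfun_comp.
Qed.

End law.

Definition upd n (i : 'I_n) (y : T) (x : n.-tuple T) : n.-tuple T :=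
  [tuple if l == i then y else tnth x l | l < n].

Lemma tnth_upd n (i j : 'I_n) y x :
  tnth (upd i y x) j = if j == i then y else tnth x j.
Proof. by rewrite tnth_mktuple. Qed.

Lemma tnth_upd_id n (i : 'I_n) y x : tnth (upd i y x) i = y.
Proof. by rewrite tnth_upd eqxx. Qed.

Lemma tnth_upd_neq n (i j : 'I_n) y x : j != i ->
  tnth (upd i y x) j = tnth x j.
Proof. by rewrite tnth_upd => /negbTE ->. Qed.

Lemma measurable_upd n (i : 'I_n) :
  measurable_fun setT (fun p : T * n.-tuple T => upd i p.1 p.2).
Proof.
apply/measurable_fun_tnthP => j.
have -> : (tnth (T:=T))^~ j \o (fun p => upd i p.1 p.2) =
    fun p : T * n.-tuple T => if j == i then p.1 else tnth p.2 j.
  by apply/funext => p /=; rewrite tnth_upd.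
case: eqP => _; first exact: measurable_fst.
apply: (@measurableT_comp _ _ _ _ _ _ (fun x : n.-tuple T => tnth x j)).
  exact: measurable_tnth.
exact: measurable_snd.
Qed.

Lemma bmfun_upd n (i : 'I_n) (f : n.-tuple T -> R) : bmfun f ->
  bmfun (fun p : T * n.-tuple T => f (upd i p.1 p.2)).
Proof. by apply: bmfun_comp; exact: measurable_upd. Qed.

Lemma bmfun_updr n (i : 'I_n) (f : n.-tuple T -> R) y : bmfun f ->
  bmfun (fun x => f (upd i y x)).
Proof. by move/(bmfun_upd i)/(bmfun_pair1 y). Qed.

Lemma bmfun_tnth n (i : 'I_n) (f : T -> R) : bmfun f ->
  bmfun (fun x : n.-tuple T => f (tnth x i)).
Proof. by apply: bmfun_comp; exact: measurable_tnth. Qed.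

Section resample.
Variables (n : nat) (nu : 'I_n -> probability T R).
Local Notation mu := (prod_prob nu).

(** All the independence of the proof enters in this form: both sides
    integrate [f] against laws that agree on rectangles. *)
Lemma resample (i : 'I_n) (f : n.-tuple T -> R) : bmfun f ->
  \int[mu]_x f x = \int[nu i]_y \int[mu]_x f (upd i y x).
Proof.
move=> bf.
rewrite -(@fubini12 _ _ _ _ _ (nu i) mu _ (bmfun_upd i bf)).
apply: (prod_prob_int _ _ bf); first exact: measurable_upd.
move=> A mA.
rewrite (_ : _ @^-1` _ = A i `*` rect (fun j => if j == i then setT else A j)).
  apply: etrans (product_measure1E _ _ _ _) _ => //.
    by apply: measurable_rect => j; case: ifP.
  rewrite (bigD1 i)//=; congr (_ * _)%E.
  rewrite prod_probE; last by move=> j; case: ifP.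
  rewrite (bigD1 i)//= eqxx probability_setT mul1e.
  by apply: eq_bigr => j /negbTE ->.
apply/seteqP; split => [[y x] /= h|[y x] /= [h1 h2] j].
  split; first by have := h i; rewrite tnth_upd_id.
  by move=> j; case: ifPn => // ji; have := h j; rewrite tnth_upd_neq.
by rewrite tnth_upd; case: ifPn => [/eqP ->//|ji]; have := h2 j; rewrite (negbTE ji).
Qed.

Lemma int_tnth (i : 'I_n) (f : T -> R) : bmfun f ->
  \int[mu]_x f (tnth x i) = \int[nu i]_y f y.
Proof.
move=> bf; rewrite (resample i (bmfun_tnth i bf)).
apply: eq_Rintegral => y _; rewrite -[RHS](int_cst mu).
by apply: eq_Rintegral => x _; rewrite tnth_upd_id.
Qed.

Lemma int_tnth_cond (i : 'I_n) (f : T -> R) (g : n.-tuple T -> R) :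
  bmfun f -> bmfun g ->
  \int[mu]_x (f (tnth x i) * g x) =
  \int[nu i]_y (f y * \int[mu]_x g (upd i y x)).
Proof.
move=> bf bg; rewrite (resample i); last by apply: bmfunM => //; exact: bmfun_tnth.
apply: eq_Rintegral => y _; rewrite -intZ; last first.
  by apply: bmfun_integ; exact: bmfun_updr.
by apply: eq_Rintegral => x _; rewrite tnth_upd_id.
Qed.

Lemma int_tnth2 (i j : 'I_n) (f g : T -> R) : i != j -> bmfun f -> bmfun g ->
  \int[mu]_x (f (tnth x i) * g (tnth x j)) =
  \int[nu i]_y f y * \int[nu j]_y g y.
Proof.
move=> ij bf bg; rewrite int_tnth_cond//; last exact: bmfun_tnth.
rewrite -RintegralZr//; last exact: bmfun_integ.
apply: eq_Rintegral => y _; congr (_ * _); rewrite -int_tnth//.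
by apply: eq_Rintegral => x _; rewrite tnth_upd_neq// eq_sym.
Qed.

(** The conditional expectation given the [i]-th coordinate, in the version
    defined at every point [y]. *)
Definition condexp (i : 'I_n) (g : n.-tuple T -> R) (y : T) :=
  \int[mu]_x g (upd i y x).

Lemma bmfun_condexp i g : bmfun g -> bmfun (condexp i g).
Proof. by move=> bg; exact: bmfun_int1 (nu i) mu _ (bmfun_upd i bg). Qed.

End resample.

Lemma prod_prob_cons n (nu : 'I_n.+1 -> probability T R)
    (f : n.+1.-tuple T -> R) : bmfun f ->
  \int[prod_prob nu]_x f x =
  \int[prod_prob (fun j => nu (lift ord0 j))]_x
     \int[nu ord0]_y f [tuple of y :: x].
Proof.
move=> bf.
have bf' : bmfun (fun p : T * n.-tuple T => f (cons_pair p)).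
  exact: bmfun_comp (@measurable_cons_pair _ _ n) bf.
rewrite -(@fubini21 _ _ _ _ _ _ _ _ bf'); congr fine.
rewrite integral_distribution//; first by apply/measurable_EFinP; case: bf.
exact: (bmfun_integ _ bf').
Qed.

(** Gives the law of the tuple formed with one observation of each sample,
    since the selected observations are distinct. *)
Lemma prod_prob_sub n m (nu : 'I_n -> probability T R) (s : 'I_m -> 'I_n)
    (f : m.-tuple T -> R) : injective s -> bmfun f ->
  \int[prod_prob nu]_x f [tuple tnth x (s i) | i < m] =
  \int[prod_prob (fun i => nu (s i))]_x f x.
Proof.
move=> sI bf; apply/esym.
apply: (prod_prob_int _ _ bf) => [|A mA].
  apply/measurable_fun_tnthP => i.
  have -> : (tnth (T:=T))^~ i \o (fun x : n.-tuple T => [tuple tnth x (s i) | i < m]) =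
    (fun x : n.-tuple T => tnth x (s i)).
    by apply/funext => x /=; rewrite tnth_mktuple.
  exact: measurable_tnth.
pose B l := if [pick i | s i == l] is Some i then A i else setT.
have Bs i : B (s i) = A i.
  rewrite /B; case: pickP => [j /eqP /sI ->//|/(_ i)].
  by rewrite eqxx.
rewrite (_ : _ @^-1` _ = rect B).
  rewrite prod_probE; last by move=> l; rewrite /B; case: pickP.
  rewrite (bigID (fun l => l \in codom s))/= [X in (_ * X)%E]big1 ?mule1.
    rewrite (reindex_omap s (fun l => [pick i | s i == l])); last first.
      move=> l /codomP[i ->] /=; case: pickP => [j /eqP/sI ->//|/(_ i)].
      by rewrite eqxx.
    rewrite [RHS](eq_bigr (fun i => nu (s i) (B (s i)))); last first.
      by move=> i _; rewrite Bs.
    apply: eq_bigl => i; rewrite codom_f/=.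
    case: pickP => [j /eqP/sI ->|/(_ i)]; first by rewrite eqxx.
    by rewrite eqxx.
  move=> l sl; rewrite /B; case: pickP => [i /eqP il|_].
    by rewrite -il codom_f in sl.
  exact: probability_setT.
apply/seteqP; split => x /= h => [l|j].
  rewrite /B; case: pickP => // i /eqP <-.
  by have := h i; rewrite tnth_mktuple.
by rewrite tnth_mktuple -Bs; exact: h.
Qed.

End product_measure.

(** * Optimality conditions for the Schrodinger problem *)

Ltac bmfun_tac := repeat (first [ assumption
  | match goal with H : forall _, bmfun _ |- _ => apply: H end
  | match goal with H : forall _ _, bmfun _ |- _ => apply: H end | apply: bmfun_cst | apply: bmfunB
  | apply: bmfunD | apply: bmfunN | apply: bmfunM | apply: bmfunX
  | (apply: bmfun_sum => ?) | apply: bmfun_tnth | apply: bmfun_norm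
  | (apply: bmfun_indic; assumption) ]).

Ltac integ_tac := repeat (first [ assumption | (apply: bmfun_integ; solve [bmfun_tac])
  | apply: integB | apply: integD | apply: integN | (apply: integ_sum => ?)
  | (apply: integ_bmfunMl; [solve [bmfun_tac]|])
  | (apply: integ_bmfunMr; [|solve [bmfun_tac]]) | apply: integ_norm ]).

Section entropy_perturbation.
Context {R : realType}.
Implicit Types p y f g a xi t L : R.

Lemma ln_tangent y xi : 0 < y -> 0 < xi -> ln y <= ln xi + (y - xi) / xi.
Proof.
move=> y0 xi0; have := @ln_le_sub1 _ (y / xi) (divr_gt0 y0 xi0).
rewrite ln_div ?posrE// mulrBl mulfV ?gt_eqF//; lra.
Qed.

Lemma xlnx_tangent y p : 0 < y -> 0 <= p ->
  y * ln y - p * ln p <= (y - p) * (1 + ln y).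
Proof.
move=> y0; rewrite le_eqVlt => /predU1P[<-|p0]; first by rewrite mul0r; nra.
have := ln_tangent y0 p0; rewrite -(ler_pM2l p0) mulrDr.
have -> : p * ((y - p) / p) = y - p by field; rewrite gt_eqF.
by lra.
Qed.

(** The hypothesis [a <= L p] keeps [y] nonnegative. Convexity bounds the
    increment of [y ln y] by its slope at [y], and [ln y] is then compared with
    its tangent at [xi] on [f], with its tangent at 1 on [g], and with [ln p]
    on [a], where [y >= (1 - t L) p]. No term is singular at [p = 0]. *)
Lemma xlnx_perturb p f g a xi L t : 0 <= p -> 0 <= f -> 0 <= g -> 0 <= a ->
  0 < xi -> 0 < L -> a <= L * p -> 0 < t -> t * L <= 2^-1 ->
  let y := p + t * (f + g - a) in
  0 <= y /\
  y * ln y <= p * ln p + t * (f + g - a + f * (ln xi + (p - xi) / xi)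
    + g * (p - 1) - a * ln p
    + t * (f * (f + g) / xi + g * (f + g) + 2 * L * a)).
Proof.
move=> p0 f0 g0 a0 xi0 L0 aLp t0 tL y.
have y_ge : (1 - t * L) * p + t * (f + g) <= y.
  have : t * a <= t * (L * p) by rewrite ler_pM2l.
  by rewrite /y; nra.
have tfg0 : 0 <= t * (f + g) by rewrite mulr_ge0 ?addr_ge0// ltW.
have y0 : 0 <= y by nra.
split => //; case: (ltrgtP y 0) y0 => // [y0 _|y0 _]; last first.
  have pz : p = 0 by nra.
  have az : a = 0 by nra.
  have fgz : f + g = 0.
    have : t * (f + g) = 0 by nra.
    by move/eqP; rewrite mulf_eq0 gt_eqF//= => /eqP.
  have fz : f = 0 by lra.
  have gz : g = 0 by lra.
  by rewrite y0 pz az fz gz !(mul0r, mulr0, addr0, subr0).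
have ylefg : y <= p + t * (f + g) by rewrite /y; nra.
have flny : f * ln y <= f * (ln xi + (p - xi) / xi) + t * (f * (f + g) / xi).
  have -> : f * (ln xi + (p - xi) / xi) + t * (f * (f + g) / xi) =
      f * (ln xi + (p + t * (f + g) - xi) / xi) by field; rewrite gt_eqF.
  apply: ler_wpM2l => //; apply: le_trans (ln_tangent y0 xi0) _.
  by rewrite lerD2l ler_pM2r ?invr_gt0// lerB.
have glny : g * ln y <= g * (p - 1) + t * (g * (f + g)).
  have -> : g * (p - 1) + t * (g * (f + g)) = g * (p + t * (f + g) - 1) by ring.
  by apply: ler_wpM2l => //; apply: le_trans (ln_le_sub1 y0) _; rewrite lerB.
have alny : a * ln p - t * (2 * L * a) <= a * ln y.
  move: a0; rewrite le_eqVlt => /predU1P[<-|a0]; first by rewrite !(mul0r, mulr0) subr0.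
  have {}p0 : 0 < p by nra.
  have tL1 : 0 < 1 - t * L by lra.
  have : ln ((1 - t * L) * p) <= ln y.
    by rewrite ler_ln ?posrE ?mulr_gt0//; nra.
  rewrite lnM ?posrE// => h.
  have := @ln_le_sub1 _ (1 - t * L)^-1; rewrite invr_gt0 => /(_ tL1).
  rewrite lnV ?posrE// => h'.
  have : (1 - t * L)^-1 - 1 <= 2 * (t * L).
    rewrite -(ler_pM2l tL1) mulrBr mulfV ?gt_eqF//.
    have : 0 < t * L by rewrite mulr_gt0.
    by nra.
  nra.
have := xlnx_tangent y0 p0.
rewrite (_ : y - p = t * (f + g - a)); last by rewrite /y; ring.
have : t * (f * ln y + g * ln y - a * ln y) <=
  t * (f * (ln xi + (p - xi) / xi) + t * (f * (f + g) / xi) +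
   (g * (p - 1) + t * (g * (f + g))) - (a * ln p - t * (2 * L * a))).
  by rewrite ler_pM2l//; lra.
by set F := f * (ln xi + _); lra.
Qed.

Lemma ge0_linear_near0 (A B t0 : R) : 0 < t0 ->
  (forall t, 0 < t -> t <= t0 -> 0 <= A + t * B) -> 0 <= A.
Proof.
move=> t00 h; rewrite leNgt; apply/negP => A0.
have B1 : 0 < `|B| + 1 by rewrite ltr_wpDl.
pose t := Num.min t0 (- A / (2 * (`|B| + 1))).
have tp : 0 < t by rewrite lt_min t00/= divr_gt0 ?oppr_gt0// mulr_gt0.
have : t <= t0 by rewrite ge_min lexx.
move=> /(h t tp); apply/negP; rewrite -ltNge.
have : t * B <= - A / 2.
  apply: (@le_trans _ _ (t * (`|B| + 1))).
    by rewrite ler_pM2l// (le_trans (ler_norm _))// lerDl.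
  apply: (@le_trans _ _ (- A / (2 * (`|B| + 1)) * (`|B| + 1))).
    by rewrite ler_pM2r// ge_min lexx orbT.
  by rewrite invfM mulrA -mulrA mulVf ?mulr1// gt_eqF.
lra.
Qed.

End entropy_perturbation.

Section schrodinger_problem.
Context {dT : measure_display} {T : measurableType dT} {R : realType}.
Variables (m : nat) (nu : 'I_m -> probability T R).
Local Notation mu := (prod_prob nu).
Implicit Types (p q b f g : m.-tuple T -> R) (beta : T -> R).

(** [beta] is the [i]-th marginal, relative to [nu i], of the signed measure
    with density [b] relative to the product measure. *)
Definition marginal i b beta := forall phi : T -> R, bmfun phi ->
  \int[mu]_x (phi (tnth x i) * b x) = \int[nu i]_y (phi y * beta y).

Definition coupling_density q := [/\ measurable_fun setT q, forall x, 0 <= q x,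
  integ mu q & forall i, marginal i q (fun=> 1)].

Definition entropic_cost (c : m.-tuple T -> R) (eps : R) q :=
  \int[mu]_x (c x * q x) + eps * \int[mu]_x (q x * ln (q x)).

Definition optimal_density c eps p := [/\ coupling_density p,
  integ mu (fun x => p x * ln (p x)) &
  forall q, coupling_density q -> integ mu (fun x => q x * ln (q x)) ->
    entropic_cost c eps p <= entropic_cost c eps q].

Lemma marginal_int i b beta : marginal i b beta ->
  \int[mu]_x b x = \int[nu i]_y beta y.
Proof.
move=> /(_ (cst 1) (bmfun_cst 1)) e.
transitivity (\int[mu]_x (cst 1 (tnth x i) * b x)).
  by apply: eq_Rintegral => x _; rewrite mul1r.
by rewrite e; apply: eq_Rintegral => x _; rewrite mul1r.
Qed.

Lemma marginalD i b b' beta beta' : integ mu b -> integ mu b' ->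
  bmfun beta -> bmfun beta' -> marginal i b beta -> marginal i b' beta' ->
  marginal i (fun x => b x + b' x) (fun y => beta y + beta' y).
Proof.
move=> Ib Ib' be be' h h' phi bphi; under eq_Rintegral do rewrite mulrDr.
under [RHS]eq_Rintegral do rewrite mulrDr.
by rewrite !intD ?h ?h'//; integ_tac.
Qed.

Lemma marginalZ i r b beta : integ mu b -> bmfun beta -> marginal i b beta ->
  marginal i (fun x => r * b x) (fun y => r * beta y).
Proof.
move=> Ib be h phi bphi; under eq_Rintegral do rewrite mulrCA.
under [RHS]eq_Rintegral do rewrite mulrCA.
by rewrite !intZ ?h//; integ_tac.
Qed.

Lemma marginal_sum i (b : 'I_m -> m.-tuple T -> R) (beta : 'I_m -> T -> R) :
  (forall j, integ mu (b j)) -> (forall j, bmfun (beta j)) ->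
  (forall j, marginal i (b j) (beta j)) ->
  marginal i (fun x => \sum_j b j x) (fun y => \sum_j beta j y).
Proof.
move=> Ib bb bmarg phi bphi; under eq_Rintegral do rewrite mulr_sumr.
under [RHS]eq_Rintegral do rewrite mulr_sumr.
rewrite !int_sum.
- by apply: eq_bigr => j _; rewrite bmarg.
- by move=> j; integ_tac.
- by move=> j; integ_tac.
Qed.

Lemma marginal_condexp i b : bmfun b -> marginal i b (condexp nu i b).
Proof. by move=> bb phi bphi; rewrite int_tnth_cond. Qed.

Lemma marginal_sum_tnth i (beta : 'I_m -> T -> R) (kappa : R) :
  (forall j, bmfun (beta j)) -> (forall j, \int[nu j]_y beta j y = kappa) ->
  marginal i (fun x => \sum_j beta j (tnth x j))
    (fun y => beta i y + (m%:R - 1) * kappa).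
Proof.
move=> bb kE phi bphi; under eq_Rintegral do rewrite mulr_sumr.
rewrite int_sum; last by move=> j; integ_tac.
rewrite (bigD1 i)//= (int_tnth nu i (f := fun y => phi y * beta i y)); last by bmfun_tac.
under [RHS]eq_Rintegral do rewrite mulrDr.
rewrite intD; [|integ_tac|integ_tac]; congr (_ + _).
rewrite (eq_bigr (fun=> \int[nu i]_y phi y * kappa)); last first.
  by move=> j ji; rewrite (int_tnth2 nu _ bphi (bb j)) 1?eq_sym// kE.
rewrite RintegralZr//; last by integ_tac.
have m_gt0 : (0 < m)%N by exact: leq_ltn_trans (ltn_ord i).
rewrite (_ : m%:R - 1 = m.-1%:R :> R); last by rewrite -subn1 natrB.
by rewrite big_const cardC1 card_ord iter_addr_0 mulr_natl mulrnAr.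
Qed.

(** Subtracting the one-coordinate marginals removes all marginals of a
    density, at the price of a multiple of any coupling density [q], which
    restores the total mass. *)
Lemma marginal_correction b q (beta : 'I_m -> T -> R) : integ mu b ->
  (forall j, bmfun (beta j)) -> coupling_density q ->
  (forall j, marginal j b (beta j)) ->
  forall i, marginal i (fun x => b x - \sum_j beta j (tnth x j)
    + (m%:R - 1) * \int[mu]_z b z * q x) (fun=> 0).
Proof.
move=> Ib bb [mq q0 Iq qmarg] bmarg i phi bphi.
have := marginal_sum_tnth i bb (fun j => esym (marginal_int (bmarg j))).
move=> /(_ phi bphi) sE.
under eq_Rintegral do rewrite mulrDr mulrBr mulrCA.
rewrite intD; [|integ_tac|integ_tac]; rewrite intB; [|integ_tac|integ_tac]; rewrite intZ; last by integ_tac.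
rewrite sE bmarg// qmarg//.
under [X in _ - X]eq_Rintegral do rewrite mulrDr.
rewrite intD; [|integ_tac|integ_tac].
rewrite RintegralZr//; last by integ_tac.
under [RHS]eq_Rintegral do rewrite mulr0.
under [X in _ + _ * X]eq_Rintegral do rewrite mulr1.
by rewrite int_cst; ring.
Qed.

Lemma coupling_density1 : coupling_density (fun=> 1).
Proof.
split => //; first by integ_tac.
move=> i phi bphi; under eq_Rintegral do rewrite mulr1.
by under [RHS]eq_Rintegral do rewrite mulr1; rewrite int_tnth.
Qed.

Lemma coupling_density_int q : coupling_density q -> (0 < m)%N ->
  \int[mu]_x q x = 1.
Proof.
by move=> [_ _ _ h] m0; rewrite (marginal_int (h (Ordinal m0))) int_cst.
Qed.

Lemma coupling_density_int_sum q (beta : 'I_m -> T -> R) : coupling_density q ->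
  (forall j, bmfun (beta j)) ->
  \int[mu]_x ((\sum_j beta j (tnth x j)) * q x) = \sum_j \int[nu j]_y beta j y.
Proof.
move=> [_ _ Iq qmarg] bb; under eq_Rintegral do rewrite mulr_suml.
rewrite int_sum; last by move=> j; integ_tac.
apply: eq_bigr => j _; rewrite qmarg//.
by apply: eq_Rintegral => y _; rewrite mulr1.
Qed.

Section optimality.
Variables (c : m.-tuple T -> R) (eps : R).
Hypothesis bc : bmfun c.
Hypothesis eps0 : 0 < eps.
Hypothesis m0 : (0 < m)%N.

(** One-sided derivative of the objective at the optimum, in the direction
    [f + g - a]. The logarithm, which is concave, is replaced by its tangent at
    [xi] on the part [f] of the added mass and by its tangent at 1 on the part
    [g], because [p] may vanish there. *)
Lemma optimality p f g (a xi : m.-tuple T -> R) (delta L : R) : optimal_density c eps p ->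
  bmfun f -> bmfun g -> bmfun xi -> measurable_fun setT a ->
  (forall x, 0 <= f x) -> (forall x, 0 <= g x) -> (forall x, 0 <= a x) ->
  0 < delta -> (forall x, delta <= xi x) -> 0 < L ->
  (forall x, a x <= L * p x) ->
  (forall i, marginal i (fun x => f x + g x - a x) (fun=> 0)) ->
  eps * \int[mu]_x (a x * ln (p x)) <=
  \int[mu]_x (c x * (f x + g x - a x)) +
  eps * (\int[mu]_x (f x * (ln (xi x) + (p x - xi x) / xi x)) +
         \int[mu]_x (g x * (p x - 1))).
Proof.
move=> [pd Ip popt] bf bg bxi ma f0 g0 a0 delta0 dxi L0 aLp amarg.
have [mp p0 Ipp pmarg] := pd.
have Ia : integ mu a.
  apply: (integ_le (g := fun x => L * p x)) => //; last by integ_tac.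
  by move=> x; rewrite (ger0_norm (a0 x)).
have Ialn : integ mu (fun x => a x * ln (p x)).
  apply: (integ_le (g := fun x => L * `|p x * ln (p x)|)); last by integ_tac.
    by apply: measurable_funM => //; exact: measurableT_comp (@measurable_ln R) mp.
  move=> x; rewrite !normrM mulrA ler_wpM2r//.
  by rewrite (ger0_norm (p0 x)) (ger0_norm (a0 x)).
have bxiV : bmfun (fun x => (xi x)^-1) by exact: bmfun_inv delta0 dxi bxi.
have blnxi : bmfun (fun x => ln (xi x)) by exact: bmfun_ln delta0 dxi bxi.
have If' : integ mu (fun x => f x * (ln (xi x) + (p x - xi x) / xi x)) by integ_tac.
have Ig' : integ mu (fun x => g x * (p x - 1)) by integ_tac.
pose rem x := f x * (f x + g x) / xi x + g x * (f x + g x) + 2 * L * a x.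
have Irem : integ mu rem by rewrite /rem; integ_tac.
pose h x := f x + g x - a x.
have Ih : integ mu h by rewrite /h; integ_tac.
have h_int0 : \int[mu]_x h x = 0.
  by rewrite (marginal_int (amarg (Ordinal m0))) int_cst.
pose D x := h x + f x * (ln (xi x) + (p x - xi x) / xi x) + g x * (p x - 1)
  - a x * ln (p x).
have ID : integ mu D by rewrite /D; integ_tac.
suff H : forall t, 0 < t -> t <= (2 * L)^-1 ->
    0 <= (\int[mu]_x (c x * h x) + eps * \int[mu]_x D x) +
         t * (eps * \int[mu]_x rem x).
  have := ge0_linear_near0 _ H; rewrite invr_gt0 mulr_gt0// => /(_ isT).
  have -> : \int[mu]_x D x = \int[mu]_x h x +
     \int[mu]_x (f x * (ln (xi x) + (p x - xi x) / xi x)) +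
     \int[mu]_x (g x * (p x - 1)) - \int[mu]_x (a x * ln (p x)).
    by rewrite intB; [|integ_tac|integ_tac]; rewrite intD; [|integ_tac|integ_tac]; rewrite intD; [|integ_tac|integ_tac].
  by rewrite h_int0 add0r; rewrite /h; lra.
move=> t t0 tL.
have {}tL : t * L <= 2^-1.
  by rewrite -ler_pdivlMr// -invfM.
pose y x := p x + t * h x.
have yP x := xlnx_perturb (p0 x) (f0 x) (g0 x) (a0 x)
  (lt_le_trans delta0 (dxi x)) L0 (aLp x) t0 tL.
have mh : measurable_fun setT h by exact: integ_measurable Ih.
have my : measurable_fun setT y.
  by apply: measurable_funD => //; exact: measurable_funM.
have yd : coupling_density y.
  split => //; first by move=> x; have [] := yP x.
    by rewrite /y; integ_tac.
  move=> i; have := marginalD (i := i) Ipp (_ : integ mu (fun x => t * h x))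
    (bmfun_cst 1) (bmfunM (bmfun_cst t) (bmfun_cst 0)) (pmarg i).
  move=> /(_ ltac:(by integ_tac) (marginalZ t Ih (bmfun_cst 0) (amarg i))).
  by move=> H phi /H ->; apply: eq_Rintegral => z _; rewrite mulr0 addr0.
have Iup : integ mu (fun x => p x * ln (p x) + t * (D x + t * rem x)) by integ_tac.
have yup x : y x * ln (y x) <= p x * ln (p x) + t * (D x + t * rem x).
  by have [] := yP x.
have Iylny : integ mu (fun x => y x * ln (y x)).
  apply: (integ_le (g := fun x => 1 + `|p x * ln (p x) + t * (D x + t * rem x)|)).
  - by apply: measurable_funM => //; exact: measurableT_comp (@measurable_ln R) my.
  - move=> x; have y0 : 0 <= y x by have [] := yP x.
    have := ge_sub1_xlnx y0; have := yup x; have := ler_norm (p x * ln (p x) + t * (D x + t * rem x)).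
    have := normr_ge0 (p x * ln (p x) + t * (D x + t * rem x)).
    set U := _ + t * _; rewrite ler_norml => U0 UU h1 h2.
    by apply/andP; split; lra.
  - by integ_tac.
have := popt y yd Iylny; rewrite /entropic_cost.
have -> : \int[mu]_x (c x * y x) = \int[mu]_x (c x * p x) + t * \int[mu]_x (c x * h x).
  rewrite -intZ; last by integ_tac.
  rewrite -intD; [|integ_tac|integ_tac].
  by apply: eq_Rintegral => x _; rewrite /y; ring.
have /(ler_wpM2l (ltW eps0)) := int_le Iylny Iup yup.
rewrite intD; [|integ_tac|integ_tac]; rewrite intZ; last by integ_tac.
rewrite intD; [|integ_tac|integ_tac]; rewrite intZ; last by integ_tac.
move=> h1 h2; rewrite -(pmulr_rge0 _ t0).
move: h1 h2; set A1 := \int[mu]_x (p x * ln _); set A2 := \int[mu]_x (y x * ln _).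
by lra.
Qed.

End optimality.

End schrodinger_problem.

(** * Upper bound on the optimal density *)

Section optimal_density_bounds.
Context {dT : measure_display} {T : measurableType dT} {R : realType}.
Variables (m : nat) (nu : 'I_m -> probability T R).
Local Notation mu := (prod_prob nu).
Variables (c : m.-tuple T -> R) (M eps : R).
Hypothesis bc : bmfun c.
Hypothesis c0 : forall x, 0 <= c x.
Hypothesis cM : forall x, c x <= M.
Hypothesis eps0 : 0 < eps.
Hypothesis M0 : 0 <= M.
Hypothesis m0 : (0 < m)%N.
Implicit Types p : m.-tuple T -> R.

Let m1_ge0 : 0 <= m%:R - 1 :> R.
Proof. by rewrite subr_ge0 ler1n. Qed.

Lemma optimal_density_ae p p' : measurable_fun setT p' ->
  (forall x, 0 <= p' x) -> {ae mu, forall x, p x = p' x} ->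
  optimal_density nu c eps p -> optimal_density nu c eps p'.
Proof.
move=> mp' p'0 pp' [[mp p0 Ip pmarg] Ipln popt].
have Ip' : integ mu p' by exact: integ_ae Ip pp'.
have Ipln' : integ mu (fun x => p' x * ln (p' x)).
  apply: integ_ae Ipln _.
    by apply: measurable_funM => //; exact: measurableT_comp (@measurable_ln R) mp'.
  by apply: filterS pp' => x /= ->.
split => //; first split => //.
- move=> i phi bphi; rewrite -pmarg//.
  by apply: int_ae; [integ_tac|integ_tac|apply: filterS pp' => x /= ->].
- move=> q qd Iq; apply: le_trans (popt q qd Iq).
  rewrite le_eqVlt; apply/orP; left; apply/eqP; congr (_ + eps * _).
    by apply: int_ae; [integ_tac|integ_tac|apply: filterS pp' => x /= ->].
  by apply: int_ae; [integ_tac|integ_tac|apply: filterS pp' => x /= ->].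
Qed.

Lemma coupling_density_int_subr1 p (beta : 'I_m -> T -> R) :
  coupling_density nu p -> (forall j, bmfun (beta j)) ->
  \int[mu]_x ((\sum_j beta j (tnth x j)) * (p x - 1)) = 0.
Proof.
move=> pd bb; under eq_Rintegral do rewrite mulrBr.
have [_ _ Ip _] := pd.
rewrite intB; [|integ_tac|integ_tac]; rewrite (coupling_density_int_sum pd bb).
by rewrite (coupling_density_int_sum (coupling_density1 nu) bb) subrr.
Qed.

Lemma coupling_density_entropy_ge0 p : coupling_density nu p ->
  integ mu (fun x => p x * ln (p x)) -> 0 <= \int[mu]_x (p x * ln (p x)).
Proof.
move=> pd Ip; have [mp p0 Ipp _] := pd.
apply: (@le_trans _ _ (\int[mu]_x (p x - 1))).
  by rewrite intB; [|integ_tac|integ_tac]; rewrite (coupling_density_int pd)// int_cst subrr.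
by apply: int_le => //; [integ_tac|move=> x; exact: ge_sub1_xlnx].
Qed.

Lemma int_indic01 (A : set (m.-tuple T)) : measurable A ->
  0 <= \int[mu]_x (\1_A x : R) <= 1.
Proof.
move=> mA; rewrite int_ge0/=; last by move=> x; rewrite indicE.
rewrite -[leRHS](int_cst mu); apply: int_le; [integ_tac|integ_tac|move=> x].
by rewrite indicE; case: (_ \in _).
Qed.

Lemma condexp_ge0 i g : (forall x, 0 <= g x) -> forall y, 0 <= condexp nu i g y.
Proof. by move=> g0 y; exact: int_ge0. Qed.

Lemma condexp_le1 i g : bmfun g -> (forall x, g x <= 1) ->
  forall y, condexp nu i g y <= 1.
Proof.
move=> bg g1 y; rewrite -[leRHS](int_cst mu); apply: int_le => //.
  by apply: bmfun_integ; exact: bmfun_updr.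
by integ_tac.
Qed.

(** The function [u] is subtracted where [p] is large, and its mass [eta] is
    spread over the densities [E(u | x_j)], one for each coordinate; subtracting
    also [(m - 1) eta p] keeps the marginals. The spreading costs nothing in
    entropy because [ln p <= p - 1] and [p] has the right marginals, so [ln p]
    has to stay below the cost of the moved mass divided by [eps]. *)
Lemma optimal_density_le p : optimal_density nu c eps p ->
  {ae mu, forall x, p x <= expR (m%:R * M / eps)}.
Proof.
move=> popt; have [pd Ipln _] := popt; have [mp p0 Ip pmarg] := pd.
set K := m%:R * M / eps.
have K0 : 0 <= K by rewrite divr_ge0 ?mulr_ge0// ltW.
pose S := [set x | expR K < p x].
have mS : measurable S by exact: measurable_gt_cst.
pose u : m.-tuple T -> R := \1_S.
have bu : bmfun u by exact: bmfun_indic.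
have u0 x : 0 <= u x by rewrite /u indicE.
have up x : u x <= p x.
  rewrite /u indicE; case: (boolP (x \in S)) => [|_]; last exact: p0.
  rewrite inE /S/= => /ltW; apply: le_trans.
  by rewrite -[leLHS]expR0 ler_expR.
set eta := \int[mu]_x u x.
have /andP[eta0 eta1] : 0 <= eta <= 1 by exact: int_indic01.
pose beta j := condexp nu j u.
have bbeta j : bmfun (beta j) by exact: bmfun_condexp.
have beta0 j y : 0 <= beta j y by exact: condexp_ge0.
have beta_int j : \int[nu j]_y beta j y = eta.
  by rewrite -(marginal_int (marginal_condexp nu j bu)).
pose g x := \sum_j beta j (tnth x j).
have bg : bmfun g by rewrite /g; bmfun_tac.
have g_int : \int[mu]_x g x = m%:R * eta.
  have := coupling_density_int_sum (coupling_density1 nu) bbeta.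
  rewrite (eq_bigr (fun=> eta))//; rewrite big_const card_ord iter_addr_0 mulr_natl.
  by move=> <-; apply: eq_Rintegral => x _; rewrite mulr1.
pose a x := u x + (m%:R - 1) * eta * p x.
have Ia : integ mu a by rewrite /a; integ_tac.
have ma : measurable_fun setT a by exact: integ_measurable Ia.
have g0 x : 0 <= g x by apply: sumr_ge0.
have a0 x : 0 <= a x by rewrite addr_ge0// mulr_ge0// mulr_ge0.
have aLp x : a x <= m%:R * p x.
  rewrite /a; have : (m%:R - 1) * eta * p x <= (m%:R - 1) * p x.
    by rewrite -mulrA ler_wpM2l// ler_piMl.
  by have := up x; lra.
have amarg i : marginal nu i (fun x => 0 + g x - a x) (fun=> 0).
  have -> : (fun x => 0 + g x - a x) = (fun x => (-1) * u x
      - \sum_j (-1) * beta j (tnth x j) + (m%:R - 1) * (\int[mu]_z ((-1) * u z)) * p x).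
    apply/funext => x; rewrite intZ; last by integ_tac.
    by rewrite -mulr_sumr /a /g -/eta; ring.
  have bNbeta j : bmfun (fun y => (-1) * beta j y) by bmfun_tac.
  apply: (marginal_correction _ bNbeta pd) => [|j]; first by integ_tac.
  exact: (marginalZ _ (bmfun_integ _ bu) (bbeta j) (marginal_condexp nu j bu)).
have := optimality bc eps0 m0 popt (bmfun_cst 0) bg (bmfun_cst 1) ma
  (fun=> lexx 0) g0 a0 ltr01 (fun=> lexx 1) (_ : 0 < m%:R) aLp amarg.
rewrite ltr0n => /(_ m0).
rewrite coupling_density_int_subr1// addr0.
have -> : \int[mu]_x (0 * (ln 1 + (p x - 1) / 1)) = 0.
  by rewrite -[RHS](int_cst mu); apply: eq_Rintegral => x _; rewrite mul0r.
rewrite mulr0 addr0.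
have Iulnp : integ mu (fun x => u x * ln (p x)).
  apply: (integ_le (g := fun x => `|p x * ln (p x)|)); last by integ_tac.
    apply: measurable_funM; first by case: bu.
    exact: measurableT_comp (@measurable_ln R) mp.
  by move=> x; rewrite !normrM ler_wpM2r// (ger0_norm (u0 x)) ger0_norm.
have -> : \int[mu]_x (a x * ln (p x)) = \int[mu]_x (u x * ln (p x)) +
    (m%:R - 1) * eta * \int[mu]_x (p x * ln (p x)).
  rewrite -intZ//; rewrite -intD//; last by integ_tac.
  by apply: eq_Rintegral => x _; rewrite /a; ring.
move=> opt.
have cle : \int[mu]_x (c x * (0 + g x - a x)) <= M * (m%:R * eta).
  rewrite -g_int -intZ; last by integ_tac.
  apply: int_le; [integ_tac|integ_tac|move=> x].
  have := ler_wpM2r (g0 x) (cM x); have := mulr_ge0 (c0 x) (a0 x).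
  by rewrite add0r mulrBr; lra.
have ulnp : \int[mu]_x (u x * ln (p x)) <= K * eta.
  rewrite -(ler_pM2l eps0) (_ : eps * (K * eta) = M * (m%:R * eta)); last first.
    by rewrite /K; field; rewrite gt_eqF.
  apply: le_trans cle; apply: le_trans opt; rewrite ler_pM2l// lerDl.
  by rewrite mulr_ge0 ?coupling_density_entropy_ge0// mulr_ge0.
have : {ae mu, forall x, u x * (ln (p x) - K) = 0}.
  apply: int_eq0_ae.
  - by under eq_fun do rewrite mulrBr; integ_tac.
  - move=> x; rewrite /u indicE; case: (boolP (x \in S)) => [|_]; last by rewrite mul0r.
    rewrite inE /S/= mul1r subr_ge0 => h.
    by rewrite -ler_expR lnK ?ltW// posrE (lt_trans _ h)// expR_gt0.
  - under eq_Rintegral do rewrite mulrBr; rewrite intB; [|integ_tac|integ_tac].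
    by rewrite RintegralZr//; [rewrite -/eta; lra|integ_tac].
apply: filterS => x /=; rewrite /u indicE leNgt; case: (boolP (x \in S)).
  rewrite inE /S/= mul1r => h /subr0_eq e.
  have px0 : 0 < p x by exact: lt_trans (expR_gt0 K) h.
  by rewrite -e lnK ?posrE// ltxx.
by move=> /negP xS _; apply/negP => h; apply: xS; rewrite inE.
Qed.

End optimal_density_bounds.

(** * Lower bound and Gibbs form of the optimal density *)

Section optimal_density_structure.
Context {dT : measure_display} {T : measurableType dT} {R : realType}.
Variables (m : nat) (nu : 'I_m -> probability T R).
Local Notation mu := (prod_prob nu).
Variables (c : m.-tuple T -> R) (M eps : R).
Hypothesis bc : bmfun c.
Hypothesis c0 : forall x, 0 <= c x.
Hypothesis cM : forall x, c x <= M.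
Hypothesis eps0 : 0 < eps.
Hypothesis m0 : (0 < m)%N.
Implicit Types p : m.-tuple T -> R.

(** The function [f] is added where [p] is small. Subtracting [f_j(x_j) p] for
    every [j] removes the marginal [f_j] in coordinate [j], but also mass [eta]
    in every other coordinate; the marginals [G_i] missing after that are
    restored additively, as in the upper bound. The entropy gained on the part
    [f] is of order [- ln xi], which the cost of the moved mass bounds. *)
Lemma optimal_density_ge p : bmfun p -> optimal_density nu c eps p ->
  {ae mu, forall x, expR (- (M * (1 + m%:R * (m%:R - 1)) / eps)) <= p x}.
Proof.
move=> bp popt; have [pd Ipln _] := popt; have [mp p0 Ip pmarg] := pd.
set K := M * _ / eps; set xi := expR (- K).
have xi0 : 0 < xi by exact: expR_gt0.
pose S := [set x | p x < xi].
have mS : measurable S by exact: measurable_lt_cst.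
pose f : m.-tuple T -> R := \1_S.
have bf : bmfun f by exact: bmfun_indic.
have f0 x : 0 <= f x by rewrite /f indicE.
have f1 x : f x <= 1 by rewrite /f indicE; case: (_ \in _).
set eta := \int[mu]_x f x.
have /andP[eta0 eta1] : 0 <= eta <= 1 by exact: int_indic01.
pose fj j := condexp nu j f.
have bfj j : bmfun (fj j) by exact: bmfun_condexp.
have fj0 j y : 0 <= fj j y by exact: condexp_ge0.
have fj1 j y : fj j y <= 1 by exact: condexp_le1.
have fj_int j : \int[nu j]_y fj j y = eta.
  by rewrite -(marginal_int (marginal_condexp nu j bf)).
pose h j (x : m.-tuple T) := fj j (tnth x j) * p x.
have bh j : bmfun (h j) by rewrite /h; bmfun_tac.
have h0 j x : 0 <= h j x by rewrite mulr_ge0.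
pose gam j i := if j == i then fj j else condexp nu i (h j).
have bgam j i : bmfun (gam j i).
  by rewrite /gam; case: ifP => _ //; exact: bmfun_condexp.
have hmarg j i : marginal nu i (h j) (gam j i).
  rewrite /gam; case: eqP => [<-|_]; last exact: marginal_condexp.
  move=> phi bphi.
  have /(_ (fun y => phi y * fj j y) (bmfunM bphi (bfj j))) := pmarg j.
  under eq_Rintegral do rewrite -mulrA.
  by move=> ->; apply: eq_Rintegral => y _; rewrite mulr1.
have h_int j : \int[mu]_x h j x = eta.
  by rewrite (marginal_int (hmarg j j)) /gam eqxx.
pose G i y := \sum_j gam j i y - fj i y.
have bG i : bmfun (G i) by rewrite /G; bmfun_tac.
have G0 i y : 0 <= G i y.
  rewrite /G (bigD1 i)//= {1}/gam eqxx addrAC subrr add0r.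
  apply: sumr_ge0 => j ji; rewrite /gam (negbTE ji).
  by apply: condexp_ge0 => x; exact: h0.
have G_int i : \int[nu i]_y G i y = (m%:R - 1) * eta.
  rewrite /G intB; [|integ_tac|integ_tac]; rewrite int_sum; last by move=> j; integ_tac.
  rewrite fj_int (eq_bigr (fun=> eta)); last first.
    by move=> j _; rewrite -(marginal_int (hmarg j i)).
  by rewrite big_const card_ord iter_addr_0 -mulr_natl; ring.
pose g x := \sum_j G j (tnth x j).
have bg : bmfun g by rewrite /g; bmfun_tac.
have g_int : \int[mu]_x g x = m%:R * ((m%:R - 1) * eta).
  have := coupling_density_int_sum (coupling_density1 nu) bG.
  rewrite (eq_bigr (fun=> (m%:R - 1) * eta))//.
  rewrite big_const card_ord iter_addr_0 mulr_natl.
  by move=> <-; apply: eq_Rintegral => x _; rewrite mulr1.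
set kap := (m%:R - 1) ^+ 2 * eta.
have kap0 : 0 <= kap by rewrite mulr_ge0// sqr_ge0.
pose a x := \sum_j h j x + kap * p x.
have ba : bmfun a by rewrite /a; bmfun_tac.
have ma : measurable_fun setT a by case: ba.
have g0 x : 0 <= g x by apply: sumr_ge0.
have a0 x : 0 <= a x by rewrite addr_ge0 ?sumr_ge0// mulr_ge0.
pose L := m%:R + kap + 1.
have L0 : 0 < L by rewrite ltr_wpDl// addr_ge0.
have aLp x : a x <= L * p x.
  have : \sum_j h j x <= \sum_(j < m) p x.
    by apply: ler_sum => j _; rewrite ler_piMl.
  rewrite sumr_const card_ord -mulr_natl => sh.
  by rewrite /a /L !mulrDl mul1r -addrA lerD// lerDl.
have amarg i : marginal nu i (fun x => f x + g x - a x) (fun=> 0).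
  pose b x := f x + (-1) * \sum_j h j x.
  have bb : bmfun b by rewrite /b; bmfun_tac.
  have b_int : \int[mu]_x b x = - (m%:R - 1) * eta.
    rewrite /b intD; [|integ_tac|integ_tac]; rewrite intZ; last by integ_tac.
    rewrite int_sum; last by move=> j; integ_tac.
    rewrite (eq_bigr (fun=> eta)) -?/eta//.
    by rewrite big_const card_ord iter_addr_0 -mulr_natl; ring.
  pose beta j y := fj j y + (-1) * \sum_l gam l j y.
  have -> : (fun x => f x + g x - a x) = (fun x => b x
      - \sum_j beta j (tnth x j)
      + (m%:R - 1) * (\int[mu]_z b z) * p x).
    apply/funext => x; rewrite b_int /b /a /kap.
    rewrite (_ : \sum_j beta j _ = - g x); first by ring.
    by rewrite /g -sumrN; apply: eq_bigr => j _; rewrite /G /beta; ring.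
  have bS : bmfun (fun x => \sum_j h j x) by bmfun_tac.
  have bgs j : bmfun (fun y => \sum_l gam l j y) by bmfun_tac.
  have hj := bmfunM (bmfun_cst (-1)) bS.
  have hj' j := bmfunM (bmfun_cst (-1)) (bgs j).
  apply: (@marginal_correction _ _ _ _ nu b p beta) => // [|j|j].
  - exact: bmfun_integ.
  - exact: bmfunD.
  - apply: (marginalD (bmfun_integ _ bf) (bmfun_integ _ hj) (bfj j) (hj' j)).
      exact: marginal_condexp.
    apply: (marginalZ _ (bmfun_integ _ bS) (bgs j)).
    by apply: marginal_sum => // l; integ_tac.
have := optimality bc eps0 m0 popt bf bg (bmfun_cst xi) ma f0 g0 a0 xi0
  (fun=> lexx xi) L0 aLp amarg.
rewrite coupling_density_int_subr1// addr0.
have Ialn : integ mu (fun x => a x * ln (p x)).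
  apply: (integ_le (g := fun x => L * `|p x * ln (p x)|)); last by integ_tac.
    by apply: measurable_funM => //; exact: measurableT_comp (@measurable_ln R) mp.
  by move=> x; rewrite !normrM mulrA ler_wpM2r// (ger0_norm (p0 x)) (ger0_norm (a0 x)).
have aln0 : 0 <= \int[mu]_x (a x * ln (p x)).
  have <- : \int[mu]_x ((\sum_j fj j (tnth x j)) * (p x - 1) + kap * (p x - 1)) = 0.
    rewrite intD; [|integ_tac|integ_tac]; rewrite coupling_density_int_subr1// add0r.
    rewrite intZ; last by integ_tac.
    by rewrite intB; [|integ_tac|integ_tac]; rewrite coupling_density_int// int_cst subrr mulr0.
  apply: int_le => //; first by integ_tac.
  move=> x; rewrite /a /h -mulr_suml -!mulrDl -mulrA.
  apply: ler_wpM2l; last exact: ge_sub1_xlnx.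
  by rewrite addr_ge0// sumr_ge0.
have cle : \int[mu]_x (c x * (f x + g x - a x)) <= M * (1 + m%:R * (m%:R - 1)) * eta.
  have -> : M * (1 + m%:R * (m%:R - 1)) * eta = \int[mu]_x (M * (f x + g x)).
    by rewrite intZ; [|integ_tac]; rewrite intD; [|integ_tac|integ_tac]; rewrite g_int -/eta; ring.
  apply: int_le; [integ_tac|integ_tac|move=> x].
  have := ler_wpM2r (addr_ge0 (f0 x) (g0 x)) (cM x); have := mulr_ge0 (c0 x) (a0 x).
  by rewrite mulrBr; lra.
have -> : \int[mu]_x (f x * (ln xi + (p x - xi) / xi)) =
    - K * eta + xi^-1 * \int[mu]_x (f x * (p x - xi)).
  rewrite -intZ; last by integ_tac.
  rewrite -intZ; last by integ_tac.
  rewrite -intD; [|integ_tac|integ_tac]; apply: eq_Rintegral => x _.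
  by rewrite /xi expRK; ring.
move=> opt.
have fp : 0 <= \int[mu]_x (f x * (p x - xi)).
  rewrite -(pmulr_rge0 _ (_ : 0 < eps * xi^-1)); last by rewrite mulr_gt0// invr_gt0.
  have KE : eps * (- K * eta) = - (M * (1 + m%:R * (m%:R - 1)) * eta).
    by rewrite /K; field; rewrite gt_eqF.
  have : 0 <= eps * \int[mu]_x (a x * ln (p x)) by rewrite mulr_ge0// ltW.
  by move: opt; rewrite mulrDr KE; lra.
have : {ae mu, forall x, f x * (xi - p x) = 0}.
  apply: int_eq0_ae.
  - by integ_tac.
  - move=> x; rewrite /f indicE; case: (boolP (x \in S)) => [|_]; last by rewrite mul0r.
    by rewrite inE /S/= mul1r subr_ge0 => /ltW.
  - rewrite -oppr_ge0 -intN; last by integ_tac.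
    by under eq_Rintegral do rewrite -mulrN opprB.
apply: filterS => x /=; rewrite /f indicE leNgt; case: (boolP (x \in S)).
  by rewrite inE /S/= mul1r => h' /subr0_eq e; rewrite e ltxx in h'.
by move=> /negP xS _; apply/negP => h'; apply: xS; rewrite inE.
Qed.

(** Once [p] is bounded away from zero, every direction with zero marginals is
    admissible in both senses, so that [c + eps ln p] is orthogonal to its own
    residual [a] after projection onto the sums of one-variable functions;
    hence [a] vanishes. *)
Lemma optimal_density_sum p delta : bmfun p -> 0 < delta ->
  (forall x, delta <= p x) -> optimal_density nu c eps p ->
  exists (phi : 'I_m -> T -> R) (kappa : R), (forall j, bmfun (phi j)) /\
    {ae mu, forall x, c x + eps * ln (p x) = \sum_j phi j (tnth x j) + kappa}.
Proof.
move=> bp delta0 dp popt; have [pd Ipln _] := popt; have [mp p0 Ip pmarg] := pd.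
have blnp : bmfun (fun x => ln (p x)) by exact: bmfun_ln delta0 dp bp.
pose psi x := c x + eps * ln (p x).
have bpsi : bmfun psi by rewrite /psi; bmfun_tac.
pose psij j := condexp nu j psi.
have bpsij j : bmfun (psij j) by exact: bmfun_condexp.
set kap := \int[mu]_x psi x.
pose a x := psi x - \sum_j psij j (tnth x j) + (m%:R - 1) * kap * 1.
have ba : bmfun a by rewrite /a; bmfun_tac.
have amarg i : marginal nu i a (fun=> 0).
  apply: (marginal_correction _ _ (coupling_density1 nu)) => //.
    by integ_tac.
  by move=> j; exact: marginal_condexp.
have aint (phi : T -> R) j : bmfun phi -> \int[mu]_x (phi (tnth x j) * a x) = 0.
  move=> bphi; rewrite amarg//.
  by under eq_Rintegral do rewrite mulr0; rewrite int_cst.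
pose ap x := Num.max (a x) 0; pose an x := Num.max (- a x) 0.
have bap : bmfun ap by apply: bmfun_max; bmfun_tac.
have ban : bmfun an by apply: bmfun_max; bmfun_tac.
have anap x : an x + 0 - ap x = - a x.
  by rewrite /an /ap /Num.max; case: ltP => ?; case: ltP => ?; lra.
have [B aB] : exists B, forall x, `|a x| <= B by case: ba.
pose L := (`|B| + 1) / delta.
have L0 : 0 < L by rewrite divr_gt0// ltr_wpDl.
have ap0 x : 0 <= ap x by rewrite le_max lexx orbT.
have an0 x : 0 <= an x by rewrite le_max lexx orbT.
have apL x : ap x <= L * p x.
  apply: (@le_trans _ _ (`|B| + 1)).
    rewrite ge_max; apply/andP; split; last by rewrite addr_ge0.
    rewrite (le_trans (ler_norm _))// (le_trans (aB x))//.
    by rewrite (le_trans (ler_norm _))// lerDl.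
  by rewrite /L mulrAC ler_pdivlMr// ler_wpM2l.
have amarg' i : marginal nu i (fun x => an x + 0 - ap x) (fun=> 0).
  have -> : (fun x => an x + 0 - ap x) = (fun x => (-1) * a x).
    by apply/funext => x; rewrite anap mulN1r.
  move=> phi /(marginalZ (-1) (bmfun_integ _ ba) (bmfun_cst 0) (amarg i)) ->.
  by apply: eq_Rintegral => y _; rewrite !mulr0.
have := optimality bc eps0 m0 popt ban (bmfun_cst 0) bp (bmfun_measurable bap)
  an0 (fun=> lexx 0) ap0 delta0 dp L0 apL amarg'.
under [X in _ <= X + _]eq_Rintegral do rewrite anap.
have -> : \int[mu]_x (an x * (ln (p x) + (p x - p x) / p x)) =
   \int[mu]_x (an x * ln (p x)).
  by apply: eq_Rintegral => x _; rewrite subrr mul0r addr0.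
have -> : \int[mu]_x (0 * (p x - 1)) = 0.
  by under eq_Rintegral do rewrite mul0r; rewrite int_cst.
rewrite addr0 => opt.
have psia : \int[mu]_x (psi x * a x) <= 0.
  have -> : \int[mu]_x (psi x * a x) = \int[mu]_x (eps * (ap x * ln (p x))) -
      \int[mu]_x (c x * - a x) - \int[mu]_x (eps * (an x * ln (p x))).
    rewrite -intB; [|integ_tac|integ_tac]; rewrite -intB; [|integ_tac|integ_tac].
    apply: eq_Rintegral => x _; rewrite /psi.
    by have := anap x; rewrite addr0 => /eqP; rewrite subr_eq => /eqP ->; ring.
  rewrite intZ; last by integ_tac.
  rewrite intZ; last by integ_tac.
  by lra.
exists psij, (- ((m%:R - 1) * kap)); split => //.
have : {ae mu, forall x, a x ^+ 2 = 0}.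
  apply: int_eq0_ae; first by integ_tac.
    by move=> x; exact: sqr_ge0.
  apply: le_trans psia.
  have -> : \int[mu]_x (psi x * a x) = \int[mu]_x (a x ^+ 2) +
     \sum_j \int[mu]_x (psij j (tnth x j) * a x)
     + (- ((m%:R - 1) * kap)) * \int[mu]_x a x.
    rewrite -int_sum; last by move=> j; integ_tac.
    rewrite -intZ; last by integ_tac.
    rewrite -intD; [|integ_tac|integ_tac]; rewrite -intD; [|integ_tac|integ_tac].
    apply: eq_Rintegral => x _; rewrite -mulr_suml.
    have -> : psi x = a x + \sum_j psij j (tnth x j) - (m%:R - 1) * kap.
      by rewrite /a; ring.
    by ring.
  rewrite (marginal_int (amarg (Ordinal m0))) int_cst mulr0 addr0.
  by rewrite big1 ?addr0// => j _; exact: aint.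
apply: filterS => x /= /eqP; rewrite sqrf_eq0 => /eqP; rewrite /a /psi; lra.
Qed.

End optimal_density_structure.

(** * Stability of the optimizer *)

Section relative_entropy_inequalities.
Context {R : realType}.
Implicit Types x y theta : R.

Lemma relent_le_chi2 x y : 0 <= x -> 0 < y ->
  x * ln x - x * ln y - x + y <= (x - y) ^+ 2 / y.
Proof.
rewrite le_eqVlt => /predU1P[<- y0|x0 y0].
  have -> : (0 - y) ^+ 2 / y = y by field; rewrite gt_eqF.
  by rewrite !mul0r; lra.
have := ln_tangent x0 y0; rewrite -(ler_pM2l x0).
have -> : (x - y) ^+ 2 / y = x * ((x - y) / y) - x + y by field; rewrite gt_eqF.
by lra.
Qed.

(** In terms of the square roots [s] and [u] of [x] and [y], this is the tangent
    inequality for [ln u] at [s], multiplied by [2 s^2]. *)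
Lemma hellinger_le_relent x y : 0 <= x -> 0 < y ->
  (Num.sqrt x - Num.sqrt y) ^+ 2 <= x * ln x - x * ln y - x + y.
Proof.
move=> x0 y0; suff key (s u : R) : 0 <= s -> 0 < u ->
    (s - u) ^+ 2 <= s ^+ 2 * ln (s ^+ 2) - s ^+ 2 * ln (u ^+ 2) - s ^+ 2 + u ^+ 2.
  have := key (Num.sqrt x) (Num.sqrt y).
  by rewrite !sqr_sqrtr ?(ltW y0)// sqrtr_ge0 sqrtr_gt0; apply.
rewrite le_eqVlt => /predU1P[<-|s0] u0.
  by rewrite sub0r sqrrN expr0n mulr0n !mul0r; lra.
have := ln_tangent u0 s0; rewrite -(ler_pM2l (mulr_gt0 s0 s0)).
have -> : s * s * (ln s + (u - s) / s) = s ^+ 2 * ln s + s * u - s ^+ 2.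
  by field; rewrite gt_eqF.
by rewrite !lnXn// !mulr2n; lra.
Qed.

(** A form of Pinsker's inequality with a free parameter, obtained from the
    comparison with the Hellinger distance. *)
Lemma norm_sub_le_relent x y theta : 0 <= x -> 0 < y -> 0 < theta ->
  `|x - y| <= (2 * theta)^-1 * (x * ln x - x * ln y - x + y) + theta * (x + y).
Proof.
move=> x0 y0 t0; have := hellinger_le_relent x0 y0.
set D := x * ln x - _ - _ + _ => hD.
have xE := sqr_sqrtr x0; have yE := sqr_sqrtr (ltW y0).
set s := Num.sqrt x in hD xE *; set u := Num.sqrt y in hD yE *.
have s0 : 0 <= s by exact: sqrtr_ge0.
have u0 : 0 <= u by exact: sqrtr_ge0.
have -> : `|x - y| = `|s - u| * (s + u).
  by rewrite -xE -yE subr_sqr normrM (ger0_norm (addr_ge0 s0 u0)).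
have t20 : 0 < 2 * theta by rewrite mulr_gt0.
apply: (@le_trans _ _ ((2 * theta)^-1 * (s - u) ^+ 2 + theta * (x + y))); last first.
  by rewrite lerD2r ler_pM2l ?invr_gt0.
rewrite -(ler_pM2l t20) [leRHS]mulrDr mulVKf ?gt_eqF//.
rewrite -(real_normK (num_real (s - u))) -xE -yE.
have := sqr_ge0 (`|s - u| - theta * (s + u)).
have := mulr_ge0 (sqr_ge0 theta) (sqr_ge0 (s - u)).
set e := `|s - u|; nra.
Qed.

Lemma sqr_sum_le (I : finType) (e : I -> R) :
  (\sum_i e i) ^+ 2 <= #|I|%:R * \sum_i e i ^+ 2.
Proof.
have -> : (\sum_i e i) ^+ 2 = \sum_i \sum_j e i * e j.
  by rewrite expr2 mulr_suml; apply: eq_bigr => i _; rewrite mulr_sumr.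
apply: (@le_trans _ _ (\sum_i \sum_j (e i ^+ 2 + e j ^+ 2) / 2)).
  apply: ler_sum => i _; apply: ler_sum => j _.
  by have := sqr_ge0 (e i - e j); rewrite sqrrB; lra.
rewrite le_eqVlt; apply/orP; left; apply/eqP.
transitivity (\sum_i (#|I|%:R * e i ^+ 2 / 2 + (\sum_j e j ^+ 2) / 2)).
  apply: eq_bigr => i _; rewrite -mulr_suml big_split/= sumr_const mulrDl.
  by rewrite [in RHS]mulr_natl.
rewrite big_split/= sumr_const -mulr_suml -mulr_sumr -[X in _ + X]mulr_natl.
by lra.
Qed.

End relative_entropy_inequalities.

Lemma sqr_int_le d (T : measurableType d) (R : realType) (P : probability T R)
    (f : T -> R) : bmfun f -> (\int[P]_x f x) ^+ 2 <= \int[P]_x (f x ^+ 2).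
Proof.
move=> bf; set e := \int[P]_x f x.
have : 0 <= \int[P]_x ((f x - e) ^+ 2) by apply: int_ge0 => x; exact: sqr_ge0.
have -> : \int[P]_x ((f x - e) ^+ 2) = \int[P]_x (f x ^+ 2 - (2 * e) * f x + e ^+ 2).
  by apply: eq_Rintegral => x _; ring.
rewrite intD; [|integ_tac|integ_tac]; rewrite intB; [|integ_tac|integ_tac]; rewrite intZ; last by integ_tac.
by rewrite int_cst -/e; lra.
Qed.

Section stability.
Context {dT : measure_display} {T : measurableType dT} {R : realType}.
Variables (m : nat) (nu : 'I_m -> probability T R).
Local Notation mu := (prod_prob nu).
Variables (c : m.-tuple T -> R) (eps : R).
Hypothesis bc : bmfun c.
Hypothesis eps0 : 0 < eps.
Hypothesis m0 : (0 < m)%N.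

(** Let [p] have the Gibbs form [c + eps ln p = sum of functions of one
    variable] and nearly the right marginals. The optimal density [q]
    minimizes the relative entropy with respect to [p] among coupling
    densities, since the sums of one-variable functions have the same integral
    against all of them. So it is at least as close to [p] as the coupling
    density obtained from [p] by an additive correction of its marginals, whose
    distance to [p] is controlled by the marginal errors of [p]. *)
Lemma stability p q (delta U theta : R) (phi : 'I_m -> T -> R) (kappa : R) :
  bmfun p -> 0 < delta -> (forall x, delta <= p x) -> (forall x, p x <= U) ->
  (forall j, bmfun (phi j)) ->
  {ae mu, forall x, c x + eps * ln (p x) = \sum_j phi j (tnth x j) + kappa} ->
  {ae mu, forall x, forall j,
     `|condexp nu j p (tnth x j) - 1| <= delta / (2 * m%:R)} ->
  optimal_density nu c eps q -> 0 < theta ->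
  \int[mu]_x `|q x - p x| <= 2 * m%:R ^+ 2 / (delta * theta) *
    (\sum_j \int[mu]_x ((condexp nu j p (tnth x j) - 1) ^+ 2)) + theta * (1 + U).
Proof.
move=> bp delta0 dp pU bphi gibbs small [qd Iqln qopt] theta0.
have [mq q0 Iq qmarg] := qd.
have p0 x : 0 < p x by exact: lt_le_trans (dp x).
have m0R : 0 < m%:R :> R by rewrite ltr0n.
have m1R : 1 <= m%:R :> R by rewrite ler1n.
have blnp : bmfun (fun x => ln (p x)) by exact: bmfun_ln delta0 dp bp.
have bpV : bmfun (fun x => (p x)^-1) by exact: bmfun_inv delta0 dp bp.
pose r j := condexp nu j p.
have br j : bmfun (r j) by exact: bmfun_condexp.
have rmarg j : marginal nu j p (r j) by exact: marginal_condexp.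
set Z := \int[mu]_x p x.
have r_int j : \int[mu]_x (r j (tnth x j) - 1) = Z - 1.
  rewrite intB; [|integ_tac|integ_tac]; rewrite int_cst; congr (_ - _).
  by rewrite int_tnth// -(marginal_int (rmarg j)).
pose V := \sum_j \int[mu]_x ((r j (tnth x j) - 1) ^+ 2).
pose j0 := Ordinal m0.
have Zsmall : `|Z - 1| <= delta / (2 * m%:R).
  rewrite -(r_int j0).
  apply: le_trans (le_normr_Rintegral measurableT _) _; first by integ_tac.
  rewrite -[leRHS](int_cst mu); apply: int_le_ae; [integ_tac|integ_tac|].
  by apply: filterS small => x /= /(_ j0).
have ZV : (Z - 1) ^+ 2 <= V.
  rewrite -(r_int j0); apply: le_trans (sqr_int_le _ _) _; first by bmfun_tac.
  rewrite /V (bigD1 j0)//= lerDl; apply: sumr_ge0 => j _.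
  by apply: int_ge0 => x; exact: sqr_ge0.
pose w (x : m.-tuple T) := \sum_j (1 - r j (tnth x j)) + (m%:R - 1) * (Z - 1).
have bw : bmfun w by rewrite /w; bmfun_tac.
have wV : \int[mu]_x (w x ^+ 2) <= 4 * m%:R ^+ 2 * V.
  have -> : 4 * m%:R ^+ 2 * V = 2 * m%:R ^+ 2 * V + 2 * m%:R ^+ 2 * V by ring.
  apply: (@le_trans _ _ (\int[mu]_x (2 * m%:R *
      \sum_j (r j (tnth x j) - 1) ^+ 2 + 2 * (m%:R - 1) ^+ 2 * (Z - 1) ^+ 2))).
    apply: int_le; [integ_tac|integ_tac|move=> x].
    have := sqr_sum_le (fun j => 1 - r j (tnth x j)); rewrite card_ord.
    have -> : \sum_j (1 - r j (tnth x j)) ^+ 2 = \sum_j (r j (tnth x j) - 1) ^+ 2.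
      by apply: eq_bigr => j _; rewrite -sqrrN opprB.
    rewrite /w; set A := \sum_j _; set B := \sum_j _.
    have := sqr_ge0 (A - (m%:R - 1) * (Z - 1)); nra.
  rewrite intD; [|integ_tac|integ_tac]; rewrite intZ; last by integ_tac.
  rewrite int_cst int_sum; last by move=> j; integ_tac.
  have V0 : 0 <= V by exact: le_trans (sqr_ge0 _) ZV.
  rewrite -/V; apply: lerD.
    by rewrite ler_wpM2r// ler_wpM2l// expr2 ler_peMl// ltW.
  apply: ler_pM => //; [by rewrite mulr_ge0// sqr_ge0|exact: sqr_ge0|].
  by rewrite ler_wpM2l//; nra.
have w_small : {ae mu, forall x, `|w x| <= p x}.
  apply: filterS small => x /= small; apply: le_trans (dp x).
  apply: (le_trans (ler_normD _ _)).
  apply: (@le_trans _ _ (\sum_(j < m) (delta / (2 * m%:R)) +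
      (m%:R - 1) * (delta / (2 * m%:R)))).
    apply: lerD; last first.
      by rewrite normrM ger0_norm ?subr_ge0// ler_wpM2l// subr_ge0.
    apply: (le_trans (ler_norm_sum _ _ _)); apply: ler_sum => j _.
    by rewrite distrC; exact: small.
  rewrite sumr_const card_ord -[X in X + _]mulr_natl -mulrDl.
  rewrite -[leRHS](@divfK _ (2 * m%:R)) ?gt_eqF ?mulr_gt0// [leRHS]mulrC.
  by rewrite ler_wpM2r ?divr_ge0 ?ltW ?mulr_gt0//; lra.
pose q1 x := Num.max (p x + w x) 0.
have bq1 : bmfun q1 by apply: bmfun_max; bmfun_tac.
have q10 x : 0 <= q1 x by rewrite le_max lexx orbT.
have q1E : {ae mu, forall x, p x + w x = q1 x}.
  apply: filterS w_small => x /=; rewrite ler_norml => /andP[h _].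
  by rewrite /q1 max_l//; lra.
have q1d : coupling_density nu q1.
  split => //; [by case: bq1|by integ_tac|move=> i f bf].
  transitivity (\int[mu]_x (f (tnth x i) * (p x + w x))).
    by apply: int_ae; [integ_tac|integ_tac|apply: filterS q1E => x /= ->].
  have corr := marginal_correction (bmfun_integ _ bp) br (coupling_density1 nu) rmarg i.
  have Icorr : integ mu (fun x => p x - \sum_j r j (tnth x j) +
     (m%:R - 1) * \int[mu]_z p z * 1) by integ_tac.
  have [_ _ I1 /(_ i) marg1] := coupling_density1 nu.
  have := marginalD Icorr I1 (bmfun_cst 0) (bmfun_cst 1) corr marg1 bf.
  rewrite -/Z.
  under [X in _ = X -> _]eq_Rintegral do rewrite add0r.
  move=> <-; apply: eq_Rintegral => x _; congr (_ * _).
  by rewrite /w sumrB sumr_const card_ord; ring.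
have blnq1 : integ mu (fun x => q1 x * ln (q1 x)).
  apply: (integ_le (g := fun x => 1 + q1 x ^+ 2)); last by integ_tac.
    apply: measurable_funM; first by case: bq1.
    by apply: measurableT_comp (@measurable_ln R) _; case: bq1.
  move=> x; have := ge_sub1_xlnx (q10 x); have h := q10 x.
  rewrite ler_norml => h1; apply/andP; split; first by nra.
  move: h; rewrite le_eqVlt => /predU1P[<-|h]; first by rewrite !mul0r; lra.
  by have := ln_le_sub1 h; nra.
have gibbs_int g : coupling_density nu g -> integ mu (fun x => g x * ln (g x)) ->
    entropic_cost nu c eps g = \sum_j \int[nu j]_y phi j y + kappa +
      eps * \int[mu]_x (g x * ln (g x) - g x * ln (p x) - g x + p x) + eps * (1 - Z).
  move=> gd Ig; have [mg g0 Igg gmarg] := gd.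
  rewrite intD; [|integ_tac|integ_tac]; rewrite intB; [|integ_tac|integ_tac]; rewrite intB; [|integ_tac|integ_tac].
  rewrite (coupling_density_int gd m0) -/Z /entropic_cost.
  have -> : \int[mu]_x (c x * g x) = \int[mu]_x
      ((\sum_j phi j (tnth x j)) * g x + kappa * g x - eps * (g x * ln (p x))).
    apply: int_ae; [integ_tac|integ_tac|apply: filterS gibbs => x /= e].
    by rewrite -mulrDl -e; ring.
  rewrite intB; [|integ_tac|integ_tac]; rewrite intD; [|integ_tac|integ_tac].
  rewrite (coupling_density_int_sum gd bphi) intZ// (coupling_density_int gd m0).
  by rewrite intZ; [ring|integ_tac].
have ID g : integ mu g -> integ mu (fun x => g x * ln (g x)) ->
    integ mu (fun x => g x * ln (g x) - g x * ln (p x) - g x + p x) by move=> *; integ_tac.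
have Iq1 : integ mu q1 by integ_tac.
have relent : \int[mu]_x (q x * ln (q x) - q x * ln (p x) - q x + p x) <=
    4 * m%:R ^+ 2 * V / delta.
  have := qopt _ q1d blnq1; rewrite !gibbs_int// lerD2r lerD2l ler_pM2l// => h.
  apply: (le_trans h); apply: (@le_trans _ _ (\int[mu]_x (delta^-1 * w x ^+ 2))).
    apply: int_le_ae; [exact: ID|integ_tac|apply: filterS q1E => x /= e].
    apply: (le_trans (relent_le_chi2 (q10 x) (p0 x))).
    rewrite -e addrAC subrr add0r mulrC ler_wpM2r ?sqr_ge0//.
    by rewrite lef_pV2 ?posrE.
  by rewrite intZ; [rewrite mulrC ler_pM2r ?invr_gt0|integ_tac].
apply: (@le_trans _ _ (\int[mu]_x ((2 * theta)^-1 *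
    (q x * ln (q x) - q x * ln (p x) - q x + p x) + theta * (q x + p x)))).
  apply: int_le; [integ_tac|integ_tac|move=> x].
  exact: norm_sub_le_relent.
rewrite intD; [|integ_tac|integ_tac]; rewrite intZ; last by integ_tac.
rewrite intZ; last by integ_tac.
rewrite intD; [|integ_tac|integ_tac]; rewrite (coupling_density_int qd m0).
apply: lerD; last first.
  rewrite ler_pM2l// lerD2l -[leRHS](int_cst mu); apply: int_le => //; integ_tac.
apply: (@le_trans _ _ ((2 * theta)^-1 * (4 * m%:R ^+ 2 * V / delta))).
  by rewrite ler_pM2l// invr_gt0 mulr_gt0.
rewrite le_eqVlt; apply/orP; left; apply/eqP; rewrite -/V.
by field; rewrite !gt_eqF.
Qed.

End stability.

(** * Inequalities for the exponential function *)

Section exponential_inequalities.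
Context {R : realType}.
Implicit Types z a : R.

Lemma expR_le_inv z : z < 1 -> expR z <= (1 - z)^-1.
Proof.
move=> z1; rewrite -[expR z]invrK lef_pV2 ?posrE ?invr_gt0 ?expR_gt0 ?subr_gt0//.
by rewrite -expRN; exact: expR_ge1Dx.
Qed.

(** The linear term integrates to zero against a centered variable, which gives
    Hoeffding's lemma with a worse constant but an elementary proof. *)
Lemma expR_le_subgaussian z : expR z <= z + expR (2 * z ^+ 2).
Proof.
have h2 : 1 + 2 * z ^+ 2 <= expR (2 * z ^+ 2) by exact: expR_ge1Dx.
case: (lerP z 2^-1) => z2; last first.
  apply: (@le_trans _ _ (expR (2 * z ^+ 2))); last by rewrite lerDr; lra.
  by rewrite ler_expR expr2; nra.
have z1 : 0 < 1 - z by lra.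
apply: (@le_trans _ _ (z + (1 + 2 * z ^+ 2))); last by rewrite lerD2l.
apply: (le_trans (expR_le_inv _)); first by lra.
rewrite -[leLHS]mul1r ler_pdivrMr//.
have := mulr_ge0 (sqr_ge0 z) (_ : 0 <= 1 - 2 * z); rewrite subr_ge0.
have -> : 2 * z <= 1 by lra.
by move=> /(_ isT); rewrite !expr2; nra.
Qed.

(** As a function of [y = z ^ 2], [exp (sqrt y)] is convex only for [y >= 1];
    its tangent at [a ^ 2] nevertheless stays below it on the whole half-line
    because [a] is at least 2. *)
Lemma expR_ge_tangent_sqr z a : 0 <= z -> 2 <= a ->
  expR a * (1 + (z ^+ 2 - a ^+ 2) / (2 * a)) <= expR z.
Proof.
move=> z0 a2; have a0 : 0 < a by lra.
rewrite -[z in leRHS](subrK a) expRD mulrC ler_pM2r ?expR_gt0//.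
set w := z - a; have zE : z = a + w by rewrite /w; ring.
have -> : (z ^+ 2 - a ^+ 2) / (2 * a) = w + w ^+ 2 / (2 * a).
  by rewrite zE; field; rewrite gt_eqF.
have a20 : 0 < 2 * a by lra.
case: (lerP 0 w) => w0.
  apply: (@le_trans _ _ ((1 + w / 2) ^+ 2)).
    have : w ^+ 2 / (2 * a) <= w ^+ 2 / 4.
      by rewrite ler_wpM2l ?sqr_ge0// lef_pV2 ?posrE//; lra.
    by rewrite !expr2; lra.
  have -> : expR w = expR (w / 2) ^+ 2 by rewrite -expRM_natl; congr expR; lra.
  rewrite lerXn2r ?nnegrE ?expR_ge0//; first by lra.
  exact: expR_ge1Dx.
set v := - w; have v0 : 0 < v by rewrite oppr_gt0.
have va : v <= a by rewrite /v /w; lra.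
have -> : w = - v by rewrite /v opprK.
rewrite sqrrN.
case: (lerP 2 v) => v2.
  apply: (@le_trans _ _ 0); last exact: expR_ge0.
  have : v ^+ 2 / (2 * a) <= v / 2.
    by rewrite ler_pdivrMr// expr2; nra.
  lra.
apply: (@le_trans _ _ ((1 - v / 2) ^+ 2)).
  have : v ^+ 2 / (2 * a) <= v ^+ 2 / 4.
    by rewrite ler_wpM2l ?sqr_ge0// lef_pV2 ?posrE//; lra.
  by rewrite !expr2; lra.
have -> : expR (- v) = expR (- v / 2) ^+ 2 by rewrite -expRM_natl; congr expR; lra.
rewrite lerXn2r ?nnegrE ?expR_ge0//; first by lra.
by apply: le_trans (expR_ge1Dx _); lra.
Qed.

End exponential_inequalities.

(** * Concentration inequalities *)

Section bounded_differences.
Context {dT : measure_display} {T : measurableType dT} {R : realType}.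

Lemma hoeffding d (S : measurableType d) (P : probability S R) (Z : S -> R)
    (c s : R) : bmfun Z -> (forall x, `|Z x| <= c) -> \int[P]_x Z x = 0 ->
  \int[P]_x expR (s * Z x) <= expR (2 * s ^+ 2 * c ^+ 2).
Proof.
move=> bZ Zc Z0.
have bE : bmfun (fun x => expR (s * Z x)) by apply: bmfun_expR; bmfun_tac.
have bE2 : bmfun (fun x => expR (2 * (s * Z x) ^+ 2)) by apply: bmfun_expR; bmfun_tac.
apply: (@le_trans _ _ (\int[P]_x (s * Z x + expR (2 * (s * Z x) ^+ 2)))).
  by apply: int_le => [||x]; [integ_tac|integ_tac|exact: expR_le_subgaussian].
rewrite intD; [|integ_tac|integ_tac]; rewrite intZ; last by integ_tac.
rewrite Z0 mulr0 add0r -[leRHS](int_cst P); apply: int_le => [||x]; [integ_tac|integ_tac|].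
have : Z x ^+ 2 <= c ^+ 2.
  by have := Zc x; rewrite ler_norml => /andP[]; rewrite !expr2; nra.
by rewrite ler_expR exprMn mulrA; apply: ler_wpM2l; rewrite mulr_ge0// sqr_ge0.
Qed.

Lemma upd_cons n (i : 'I_n) (y z : T) (x : n.-tuple T) :
  [tuple of z :: upd i y x] = upd (lift ord0 i) y [tuple of z :: x].
Proof.
apply: eq_from_tnth => l; rewrite tnth_upd.
case: (unliftP ord0 l) => [k ->|->] /=; last by [].
by rewrite !tnthS tnth_upd (inj_eq (@lift_inj _ ord0)).
Qed.

Lemma upd_cons0 n (y z : T) (x : n.-tuple T) :
  [tuple of y :: x] = upd ord0 y [tuple of z :: x].
Proof.
apply: eq_from_tnth => l; rewrite tnth_upd.
by case: (unliftP ord0 l) => [k ->|->] //=; rewrite !tnthS.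
Qed.

(** McDiarmid's inequality in exponential form, with an unoptimized constant,
    by conditioning on all coordinates but the first. *)
Lemma bounded_differences n (nu : 'I_n -> probability T R)
    (F : n.-tuple T -> R) (c : 'I_n -> R) (s : R) : bmfun F ->
  (forall i x y, `|F x - F (upd i y x)| <= c i) ->
  \int[prod_prob nu]_x expR (s * (F x - \int[prod_prob nu]_z F z)) <=
  expR (2 * s ^+ 2 * \sum_i c i ^+ 2).
Proof.
elim: n nu F c => [|n IH] nu F c bF Fc.
  rewrite big_ord0 mulr0 expR0.
  have FE x : F x = F [tuple] by rewrite tuple0.
  have -> : \int[prod_prob nu]_z F z = F [tuple].
    by rewrite -[RHS](int_cst (prod_prob nu)); apply: eq_Rintegral => x _; exact: FE.
  rewrite -[leRHS](int_cst (prod_prob nu)) le_eqVlt; apply/orP; left; apply/eqP.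
  by apply: eq_Rintegral => x _; rewrite FE subrr mulr0 expR0.
pose nu' (j : 'I_n) := nu (lift ord0 j).
have bF' : bmfun (fun p : T * n.-tuple T => F (cons_pair p)).
  exact: bmfun_comp (@measurable_cons_pair _ _ n) bF.
have bFx (x : n.-tuple T) : bmfun (fun y => F [tuple of y :: x]) by have := bmfun_pair2 x bF'.
pose F1 (x : n.-tuple T) := \int[nu ord0]_y F [tuple of y :: x].
have bF1 : bmfun F1 by exact: (bmfun_int2 (nu ord0) (prod_prob nu') bF').
have F_int : \int[prod_prob nu]_z F z = \int[prod_prob nu']_x F1 x.
  by rewrite prod_prob_cons.
rewrite F_int; set e := \int[_]_x F1 x.
rewrite prod_prob_cons; last by apply: bmfun_expR; bmfun_tac.
have F1c i x y : `|F1 x - F1 (upd i y x)| <= c (lift ord0 i).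
  rewrite /F1 -intB; [|exact/bmfun_integ|exact/bmfun_integ].
  apply: norm_int_le => [|z]; first by apply: bmfunB; exact: bFx.
  by rewrite upd_cons.
have Fdev y (x : n.-tuple T) : `|F [tuple of y :: x] - F1 x| <= c ord0.
  rewrite /F1 -(int_cst (nu ord0) (F [tuple of y :: x])) -intB; last first.
  - exact/bmfun_integ.
  - by apply: bmfun_integ; exact: bmfun_cst.
  apply: norm_int_le => [|z]; first by apply: bmfunB => //; exact: bmfun_cst.
  by rewrite (upd_cons0 z y).
have bE1 : bmfun (fun x => expR (s * (F1 x - e))) by apply: bmfun_expR; bmfun_tac.
have bE0 (x : n.-tuple T) : bmfun (fun y => expR (s * (F [tuple of y :: x] - F1 x))).
  by apply: bmfun_expR; have := bFx x => ?; bmfun_tac.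
have cond (x : n.-tuple T) : \int[nu ord0]_y expR (s * (F [tuple of y :: x] - e)) <=
    expR (2 * s ^+ 2 * c ord0 ^+ 2) * expR (s * (F1 x - e)).
  have -> : \int[nu ord0]_y expR (s * (F [tuple of y :: x] - e)) =
      expR (s * (F1 x - e)) * \int[nu ord0]_y expR (s * (F [tuple of y :: x] - F1 x)).
    rewrite -intZ; last exact/bmfun_integ.
    by apply: eq_Rintegral => y _; rewrite -expRD; congr expR; ring.
  rewrite mulrC ler_wpM2r ?expR_ge0//; apply: hoeffding.
  - by apply: bmfunB; [exact: bFx|exact: bmfun_cst].
  - by move=> y; exact: Fdev.
  - rewrite intB; [|exact/bmfun_integ|by apply: bmfun_integ; exact: bmfun_cst].
    by rewrite int_cst subrr.
rewrite big_ord_recl mulrDr expRD.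
apply: (@le_trans _ _ (\int[prod_prob nu']_x
    (expR (2 * s ^+ 2 * c ord0 ^+ 2) * expR (s * (F1 x - e))))).
  apply: int_le => //; last by integ_tac.
  apply: bmfun_integ; apply: (bmfun_int2 (nu ord0) (prod_prob nu')
     (f := fun p => expR (s * (F (cons_pair p) - e)))).
  by apply: bmfun_expR; bmfun_tac.
rewrite intZ; last exact/bmfun_integ.
by rewrite ler_pM2l ?expR_gt0//; exact: IH.
Qed.

Lemma markov_int d (S : measurableType d) (P : probability S R) (A : set S)
    (G : S -> R) : measurable A -> bmfun G -> (forall x, 0 <= G x) ->
  (forall x, A x -> 1 <= G x) -> (P A <= (\int[P]_x G x)%:E)%E.
Proof.
move=> mA bG G0 AG; rewrite -[leLHS]fineK ?fin_num_measure// lee_fin -int_indic//.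
apply: int_le => [||x]; [integ_tac|integ_tac|rewrite indicE].
by case: (boolP (x \in A)) => [/set_mem /AG|_]; [|exact: G0].
Qed.

(** Boundedness makes the exponential moments finite, so that the inequality
    between real integrals is meaningful. *)
Definition subgaussian d (S : measurableType d) (P : probability S R)
    (v : R) (Z : S -> R) :=
  bmfun Z /\ forall s, \int[P]_x expR (s * Z x) <= expR (v * s ^+ 2).

Section tails.
Context d (S : measurableType d) (P : probability S R) (v : R).
Hypothesis v0 : 0 < v.
Implicit Types Z : S -> R.

Lemma subgaussian_norm Z s : subgaussian P v Z -> 0 <= s ->
  \int[P]_x expR (s * `|Z x|) <= 2 * expR (v * s ^+ 2).
Proof.
move=> [bZ ZE] s0.
have bE t : bmfun (fun x => expR (t * Z x)) by apply: bmfun_expR; bmfun_tac.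
have bE' : bmfun (fun x => expR (s * `|Z x|)) by apply: bmfun_expR; bmfun_tac.
apply: (@le_trans _ _ (\int[P]_x (expR (s * Z x) + expR ((- s) * Z x)))).
  apply: int_le => [||x]; [integ_tac|integ_tac|].
  case: ger0P => _; first by rewrite lerDl expR_ge0.
  by rewrite mulrN mulNr lerDr expR_ge0.
rewrite intD; [|integ_tac|integ_tac]; rewrite mulr_natl mulr2n.
by apply: lerD; [exact: ZE|rewrite -sqrrN; exact: ZE].
Qed.

Lemma subgaussian_tail Z u : subgaussian P v Z -> 0 <= u ->
  (P [set x | (u < `|Z x|)%R] <= (2 * expR (- (u ^+ 2 / (4 * v))))%:E)%E.
Proof.
move=> sg u0; have [bZ _] := sg.
set s := u / (2 * v).
have s0 : 0 <= s by rewrite divr_ge0// mulr_ge0// ltW.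
have bE : bmfun (fun x => expR (s * `|Z x|)) by apply: bmfun_expR; bmfun_tac.
pose G x := expR (- (s * u)) * expR (s * `|Z x|).
apply: (@le_trans _ _ (\int[P]_x G x)%:E).
  apply: markov_int.
  - by apply: measurable_gt_cst; case: (bmfun_norm bZ).
  - by rewrite /G; bmfun_tac.
  - by move=> x; rewrite mulr_ge0 ?expR_ge0.
  - move=> x /= ux; rewrite /G -expRD -[leLHS]expR0 ler_expR.
    by rewrite addrC -mulrBr mulr_ge0// subr_ge0 ltW.
rewrite lee_fin /G intZ; last by integ_tac.
apply: (@le_trans _ _ (expR (- (s * u)) * (2 * expR (v * s ^+ 2)))).
  by rewrite ler_pM2l ?expR_gt0//; exact: subgaussian_norm.
rewrite mulrCA -expRD ler_pM2l// ler_expR le_eqVlt; apply/orP; left; apply/eqP.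
by rewrite /s; field; rewrite gt_eqF.
Qed.

(** By the tangent inequality for [exp] in the variable [z ^ 2], when the
    quadratic mean exceeds [u] the mean of the [exp (s |Z k|)] is at least
    [exp (s u)]. So averaging over [k] costs no factor [N]. *)
Lemma subgaussian_qmean_tail (N : nat) (Z : 'I_N -> S -> R) u : (0 < N)%N ->
  (forall k, subgaussian P v (Z k)) -> 0 < u -> 4 * v <= u ^+ 2 ->
  (P [set x | (u ^+ 2 < N%:R^-1 * \sum_(k < N) (Z k x) ^+ 2)%R] <=
    (2 * expR (- (u ^+ 2 / (4 * v))))%:E)%E.
Proof.
move=> N0 sg u0 u4v.
have bZ k : bmfun (Z k) by case: (sg k).
have NR0 : 0 < N%:R :> R by rewrite ltr0n.
set s := u / (2 * v).
have s0 : 0 < s by rewrite divr_gt0// mulr_gt0.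
have a2 : 2 <= s * u.
  by rewrite /s mulrAC ler_pdivlMr ?mulr_gt0// -expr2; lra.
have bE k : bmfun (fun x => expR (s * `|Z k x|)) by apply: bmfun_expR; bmfun_tac.
pose G x := expR (- (s * u)) * (N%:R^-1 * \sum_(k < N) expR (s * `|Z k x|)).
apply: (@le_trans _ _ (\int[P]_x G x)%:E).
  apply: markov_int.
  - by apply: measurable_gt_cst; apply: bmfun_measurable; bmfun_tac.
  - apply: bmfunM; first exact: bmfun_cst.
    apply: bmfunM; first exact: bmfun_cst.
    by apply: bmfun_sum => k; exact: bE.
  - move=> x; rewrite mulr_ge0 ?expR_ge0// mulr_ge0 ?invr_ge0//.
    by apply: sumr_ge0 => k _; exact: expR_ge0.
  - move=> x /= ux.
    have : \sum_(k < N) expR (s * u) *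
       (1 + ((s * `|Z k x|) ^+ 2 - (s * u) ^+ 2) / (2 * (s * u))) <=
       \sum_(k < N) expR (s * `|Z k x|).
      apply: ler_sum => k _; apply: expR_ge_tangent_sqr => //.
      by rewrite mulr_ge0// ltW.
    rewrite -mulr_sumr big_split/= sumr_const card_ord -mulr_suml sumrB.
    rewrite sumr_const card_ord.
    have -> : \sum_(k < N) (s * `|Z k x|) ^+ 2 = s ^+ 2 * \sum_(k < N) (Z k x) ^+ 2.
      rewrite mulr_sumr; apply: eq_bigr => k _.
      by rewrite exprMn real_normK// num_real.
    have NuQ : N%:R * u ^+ 2 <= \sum_(k < N) (Z k x) ^+ 2.
      by rewrite -ler_pdivlMl// ltW.
    move=> h; have {}h : expR (s * u) * N%:R <= \sum_(k < N) expR (s * `|Z k x|).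
      apply: le_trans h; rewrite ler_pM2l ?expR_gt0// lerDl divr_ge0//; last first.
        by rewrite mulr_ge0// mulr_ge0// ltW.
      by rewrite subr_ge0 exprMn -[leLHS]mulr_natl mulrCA ler_pM2l// exprn_gt0.
    have -> : 1 = expR (- (s * u)) * (N%:R^-1 * (expR (s * u) * N%:R)) :> R.
      by rewrite expRN; field; rewrite !gt_eqF ?expR_gt0.
    by rewrite /G ler_pM2l ?expR_gt0// ler_pM2l// invr_gt0.
have IS : integ P (fun x => \sum_(k < N) expR (s * `|Z k x|)).
  by apply: integ_sum => k; exact: bmfun_integ.
rewrite lee_fin /G intZ; last exact: integZ.
rewrite intZ//.
rewrite int_sum; last by move=> k; exact: bmfun_integ.
apply: (@le_trans _ _ (expR (- (s * u)) * (2 * expR (v * s ^+ 2)))).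
  rewrite ler_pM2l ?expR_gt0// ler_pdivrMl//.
  apply: (@le_trans _ _ (\sum_(k < N) 2 * expR (v * s ^+ 2))).
    by apply: ler_sum => k _; apply: subgaussian_norm => //; exact: ltW.
  by rewrite sumr_const card_ord -[leLHS]mulr_natl.
rewrite mulrCA -expRD ler_pM2l// ler_expR le_eqVlt; apply/orP; left; apply/eqP.
by rewrite /s; field; rewrite gt_eqF.
Qed.

End tails.

End bounded_differences.

(** * Integrals against empirical measures *)

Section empirical_integral.
Context {dT : measure_display} {T : measurableType dT} {R : realType}.

Lemma empiricalE N (N0 : (0 < N)%N) (x : 'I_N -> T) (A : set T) :
  empirical x N0 A = (N%:R^-1 * \sum_(k < N) (\1_A (x k) : R))%:E.
Proof.
by rewrite /empirical EFinM -sumEFin.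
Qed.

Lemma int_empirical N (N0 : (0 < N)%N) (x : 'I_N -> T) (f : T -> R) : bmfun f ->
  \int[empirical x N0]_y f y = N%:R^-1 * \sum_(k < N) f (x k).
Proof.
move=> bf; have [mf [B fB]] := bf.
have NR0 : 0 < N%:R :> R by rewrite ltr0n.
have r0 : (0 : R) <= N%:R^-1 by rewrite invr_ge0 ltW.
suff key (g : T -> R) : bmfun g -> (forall y, 0 <= g y) ->
    \int[empirical x N0]_y g y = N%:R^-1 * \sum_(k < N) g (x k).
  have fB0 y : 0 <= f y + B.
    by have := fB y; rewrite ler_norml => /andP[]; lra.
  have bB : bmfun (fun _ : T => B) by exact: bmfun_cst.
  have := key (fun y => f y + B) (bmfunD bf bB) fB0.
  rewrite intD; [|exact: bmfun_integ|exact: bmfun_integ].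
  rewrite int_cst big_split/= sumr_const card_ord.
  rewrite mulrDr -[X in _ + _ * X]mulr_natl mulrA mulVf ?gt_eqF// mul1r.
  exact: addIr.
move=> [mg _] g0.
pose nu' : {measure set T -> \bar R} := mscale (NngNum r0)
    (msum (fun k => \d_(x (insubd (Ordinal N0) k))) N).
have insE k : insubd (Ordinal N0) (k : 'I_N) = k.
  by apply: val_inj; rewrite val_insubd ltn_ord.
rewrite /Rintegral (eq_measure_integral nu'); last first.
  move=> A mA _; rewrite /nu' /mscale/= /msum /empirical; congr (_ * _)%E.
  by apply: eq_bigr => k _; rewrite insE.
rewrite ge0_integral_mscale//; last by move=> y _; rewrite lee_fin.
rewrite ge0_integral_measure_sum//; last 2 first.
- by move=> y _; rewrite lee_fin.
- exact/measurable_EFinP.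
  rewrite (eq_bigr (fun k : 'I_N => (g (x k))%:E)); last first.
    move=> k _; rewrite integral_dirac//; last exact/measurable_EFinP.
    by rewrite diracT mul1e insE.
  by rewrite sumEFin.
exact/measurable_EFinP.
Qed.

End empirical_integral.

Section empirical_product.
Context {dT : measure_display} {T : measurableType dT} {R : realType}.
Variables (m N : nat) (N0 : (0 < N)%N) (X : 'I_m -> 'I_N -> T).

Let ffun_gt0 : (0 < #|{ffun 'I_m -> 'I_N}|)%N.
Proof. by rewrite card_ffun !card_ord expn_gt0 N0. Qed.

(** The product of the empirical measures agrees on rectangles with the
    empirical measure of the tuples formed with one observation of each
    sample. *)
Lemma int_prod_empirical (f : m.-tuple T -> R) : bmfun f ->
  \int[prod_prob (fun j => empirical (X j) N0)]_x f x =
  (N%:R ^+ m)^-1 *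
    \sum_(kap : {ffun 'I_m -> 'I_N}) f [tuple X j (kap j) | j < m].
Proof.
move=> bf.
pose Y (a : 'I_#|{ffun 'I_m -> 'I_N}|) := [tuple X j (enum_val a j) | j < m].
pose P : probability (m.-tuple T) R := empirical Y ffun_gt0.
have cardE : #|{ffun 'I_m -> 'I_N}|%:R = N%:R ^+ m :> R.
  by rewrite card_ffun !card_ord natrX.
transitivity (\int[P]_x f x).
  congr fine; apply: eq_measure_integral => A mA _; apply/esym.
  apply: (eq_prod_prob (P := P)) => // B mB.
  transitivity (#|{ffun 'I_m -> 'I_N}|%:R^-1 *
      \sum_a (\1_(rect B) (Y a) : R))%:E; first exact: (empiricalE ffun_gt0 Y).
  transitivity (\prod_(j < m) (N%:R^-1 * \sum_(k < N) (\1_(B j) (X j k) : R)))%:E.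
    congr EFin; rewrite big_split/= bigA_distr_bigA/= prodr_const card_ord exprVn.
    rewrite cardE; congr (_ * _).
    rewrite [RHS](reindex _ (onW_bij _ (@enum_val_bij _))).
    apply: eq_bigr => a _; rewrite indicE.
    case: (boolP (Y a \in _)) => [|/negP Ya].
      rewrite inE => h; rewrite big1// => j _.
      by rewrite indicE mem_set//; have := h j; rewrite tnth_mktuple.
    have [j nj] : exists j, ~ B j (X j (enum_val a j)).
      apply: contrapT => h; apply: Ya; rewrite inE => j; rewrite tnth_mktuple.
      by apply: contrapT => nB; apply: h; exists j.
    by apply/esym; rewrite (bigD1 j)//= indicE memNset// mul0r.
  rewrite (big_morph EFin EFinM erefl).
  by apply: eq_bigr => j _; rewrite -empiricalE.
rewrite int_empirical// cardE; congr (_ * _).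
by rewrite [RHS](reindex _ (onW_bij _ (@enum_val_bij _))).
Qed.

End empirical_product.

(** * V-statistics of independent samples *)

Section sampling.
Context {dT : measure_display} {T : measurableType dT} {R : realType}.
Variables (m N : nat) (N0 : (0 < N)%N) (nu : 'I_m -> probability T R).
Local Notation mu := (prod_prob nu).
Local Notation n := #|{: 'I_m * 'I_N}|.

Definition obs (j : 'I_m) (k : 'I_N) : 'I_n := enum_rank (j, k).

Definition sample_law (l : 'I_n) : probability T R := nu (enum_val l).1.
Local Notation S := (prod_prob sample_law).

Definition draw (kap : {ffun 'I_m -> 'I_N}) (x : n.-tuple T) : m.-tuple T :=
  [tuple tnth x (obs j (kap j)) | j < m].

(** The generalized V-statistic of kernel [g]: the integral of [g] against the
    product of the empirical measures. *)
Definition vstat (g : m.-tuple T -> R) (x : n.-tuple T) : R :=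
  (N%:R ^+ m)^-1 * \sum_(kap : {ffun 'I_m -> 'I_N}) g (draw kap x).

Definition emp_marginal (x : n.-tuple T) (j : 'I_m) : probability T R :=
  empirical (fun k => tnth x (obs j k)) N0.

Lemma int_emp_prod (g : m.-tuple T -> R) x : bmfun g ->
  \int[prod_prob (emp_marginal x)]_z g z = vstat g x.
Proof. by move=> bg; rewrite int_prod_empirical. Qed.

Lemma obs_neq j k j' k' : (j, k) != (j', k') -> obs j k != obs j' k'.
Proof. by rewrite (inj_eq enum_rank_inj). Qed.

Lemma measurable_draw kap : measurable_fun setT (draw kap).
Proof.
apply/measurable_fun_tnthP => i.
have -> : (tnth (T:=T))^~ i \o draw kap = (fun x => tnth x (obs i (kap i))).
  by apply/funext => x /=; rewrite tnth_mktuple.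
exact: measurable_tnth.
Qed.

Lemma bmfun_vstat g : bmfun g -> bmfun (vstat g).
Proof.
move=> bg; apply: bmfunM; first exact: bmfun_cst.
apply: bmfun_sum => kap.
exact: bmfun_comp (measurable_draw kap) bg.
Qed.

Let NR0 : 0 < N%:R :> R. Proof. by rewrite ltr0n. Qed.

Lemma vstat_mean g : bmfun g -> \int[S]_x vstat g x = \int[mu]_x g x.
Proof.
move=> bg.
have bgk kap : bmfun (fun x => g (draw kap x)).
  exact: bmfun_comp (measurable_draw kap) bg.
rewrite /vstat intZ; last by apply: integ_sum => kap; exact: bmfun_integ.
rewrite int_sum; last by move=> kap; exact: bmfun_integ.
rewrite (eq_bigr (fun=> \int[mu]_x g x)) => [|kap _]; last first.
  rewrite (@prod_prob_sub _ _ _ n m sample_law (fun j => obs j (kap j)) g)//.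
    have -> // : (fun i => sample_law (obs i (kap i))) = nu.
    by apply/funext => i; rewrite /sample_law /obs enum_rankK.
  by move=> i i' /enum_rank_inj [].
rewrite sumr_const -[X in _ * X]mulr_natl mulrA card_ffun !card_ord natrX mulVf ?mul1r//.
by rewrite expf_neq0// gt_eqF.
Qed.

Lemma vstat_count (i : 'I_m) (k : 'I_N) :
  (N%:R ^+ m)^-1 * \sum_(kap : {ffun 'I_m -> 'I_N}) (kap i == k)%:R = N%:R^-1 :> R.
Proof.
pose F (l : 'I_m) (k' : 'I_N) : R := N%:R^-1 * (if l == i then (k' == k)%:R else 1).
have <- : \prod_l \sum_k' F l k' = N%:R^-1.
  rewrite (bigD1 i)//= [X in _ * X]big1 ?mulr1 => [|l li].
    rewrite /F -mulr_sumr eqxx (bigD1 k)//= eqxx big1 ?addr0 ?mulr1// => k' kk'.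
    by rewrite (negbTE kk').
  rewrite /F -mulr_sumr (negbTE li) sumr_const card_ord mulVf//.
  by rewrite gt_eqF.
rewrite bigA_distr_bigA/= mulr_sumr; apply: eq_bigr => f _.
rewrite /F big_split/= prodr_const card_ord exprVn; congr (_ * _).
by rewrite (bigD1 i)//= eqxx big1 ?mulr1// => l /negbTE ->.
Qed.

(** One observation enters in a fraction [1 / N] of the tuples. *)
Lemma vstat_diff g B x l y : (forall z, `|g z| <= B) ->
  `|vstat g x - vstat g (upd l y x)| <= 2 * B / N%:R.
Proof.
move=> gB; have B0 : 0 <= B.
  by apply: le_trans (gB (draw [ffun=> Ordinal N0] x)).
pose i := (enum_val l).1; pose k := (enum_val l).2.
have lE : obs i k = l by rewrite /obs -surjective_pairing enum_valK.
rewrite /vstat -mulrBr -sumrB normrM ger0_norm ?invr_ge0 ?exprn_ge0//.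
rewrite -(vstat_count i k) mulrCA ler_wpM2l ?invr_ge0 ?exprn_ge0// mulr_sumr.
apply: (le_trans (ler_norm_sum _ _ _)); apply: ler_sum => kap _.
case: eqP => [_|/eqP kk].
  rewrite mulr1 (le_trans (ler_normB _ _))// mulr_natl mulr2n lerD//.
rewrite mulr0; have -> : draw kap (upd l y x) = draw kap x.
  apply: eq_from_tnth => j; rewrite [LHS]tnth_mktuple [RHS]tnth_mktuple tnth_upd_neq//.
  rewrite -lE; apply: obs_neq; apply: contraNneq kk => -[<- <-] //.
by rewrite subrr normr0.
Qed.

Lemma vstat_dev g B : bmfun g -> (forall z, `|g z| <= B) ->
  forall s, \int[S]_x expR (s * (vstat g x - \int[mu]_z g z)) <=
    expR (8 * m%:R * B ^+ 2 / N%:R * s ^+ 2).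
Proof.
move=> bg gB s; rewrite -(vstat_mean bg).
apply: le_trans (bounded_differences _ (c := fun=> 2 * B / N%:R) _ (bmfun_vstat bg) _) _.
  by move=> l x y; exact: vstat_diff.
rewrite ler_expR sumr_const card_prod !card_ord -[X in _ * X <= _]mulr_natl natrM.
by rewrite le_eqVlt; apply/orP; left; apply/eqP; field; rewrite gt_eqF.
Qed.

Lemma vstat_subgaussian g B : bmfun g -> (forall z, `|g z| <= B) ->
  subgaussian S (8 * m%:R * B ^+ 2 / N%:R) (fun x => vstat g x - \int[mu]_z g z).
Proof.
move=> bg gB; split; last exact: vstat_dev.
by apply: bmfunB; [exact: bmfun_vstat|exact: bmfun_cst].
Qed.

(** When [p] is a coupling density the second term is 1 at almost every
    observation; keeping it centers the error at each fixed value of the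
    observation. *)
Definition marginal_error (p : m.-tuple T -> R) j k (x : n.-tuple T) :=
  condexp (emp_marginal x) j p (tnth x (obs j k)) - condexp nu j p (tnth x (obs j k)).

Lemma condexp_emp p j y x : bmfun p ->
  condexp (emp_marginal x) j p y = vstat (fun z => p (upd j y z)) x.
Proof. by move=> bp; rewrite /condexp int_emp_prod//; exact: bmfun_updr. Qed.

(** The observation at which the error is tested is independent of the
    others, and its own contribution to the empirical measure is discarded by
    [upd j]; so the deviation inequality applies conditionally on it. *)
Lemma marginal_error_subgaussian p B j k : bmfun p -> (forall z, `|p z| <= B) ->
  subgaussian S (8 * m%:R * B ^+ 2 / N%:R) (marginal_error p j k).
Proof.
move=> bp pB.
have bW : bmfun (marginal_error p j k).
  have -> : marginal_error p j k = fun x => (N%:R ^+ m)^-1 *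
      (\sum_(kap : {ffun 'I_m -> 'I_N}) p (upd j (tnth x (obs j k)) (draw kap x)))
      - condexp nu j p (tnth x (obs j k)).
    by apply/funext => x; rewrite /marginal_error condexp_emp.
  apply: bmfunB; last by apply: bmfun_tnth; exact: bmfun_condexp.
  apply: bmfunM; first exact: bmfun_cst.
  apply: bmfun_sum => kap.
  have mF : measurable_fun setT (fun x : n.-tuple T => (tnth x (obs j k), draw kap x)).
    by apply: measurable_fun_pair; [exact: measurable_tnth|exact: measurable_draw].
  exact: bmfun_comp mF (bmfun_upd j bp).
split => // s.
rewrite (resample _ (obs j k)); last by apply: bmfun_expR; apply: bmfunM => //; exact: bmfun_cst.
set C := expR _.
have Wupd y x : marginal_error p j k (upd (obs j k) y x) =
    vstat (fun z => p (upd j y z)) x - condexp nu j p y.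
  rewrite /marginal_error tnth_upd_id condexp_emp//; congr (_ - _).
  rewrite /vstat; congr (_ * _); apply: eq_bigr => kap _; congr p.
  apply: eq_from_tnth => i; rewrite !tnth_upd; case: ifPn => // ij.
  rewrite [LHS]tnth_mktuple [RHS]tnth_mktuple tnth_upd_neq//; apply: obs_neq.
  by apply: contraNneq ij => -[->].
have bE : bmfun (fun x => expR (s * marginal_error p j k x)).
  by apply: bmfun_expR; apply: bmfunM => //; exact: bmfun_cst.
rewrite -[leRHS](int_cst (sample_law (obs j k))).
apply: int_le => [||y].
- by apply: bmfun_integ; exact: (bmfun_int1 (sample_law (obs j k)) S (bmfun_upd (obs j k) bE)).
- by apply: bmfun_integ; exact: bmfun_cst.
- under eq_Rintegral do rewrite Wupd.
  by apply: vstat_dev => //; exact: bmfun_updr.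
Qed.

Lemma sqr_marginal_error p j x : bmfun p ->
  (forall k, condexp nu j p (tnth x (obs j k)) = 1) ->
  \int[prod_prob (emp_marginal x)]_z ((condexp (emp_marginal x) j p (tnth z j) - 1) ^+ 2)
  = N%:R^-1 * \sum_k (marginal_error p j k x) ^+ 2.
Proof.
move=> bp p1; have bc := bmfun_condexp (emp_marginal x) j bp.
rewrite (int_tnth _ j (f := fun y => (condexp (emp_marginal x) j p y - 1) ^+ 2)); last first.
  by apply: bmfunX; apply: bmfunB => //; exact: bmfun_cst.
rewrite int_empirical; last by apply: bmfunX; apply: bmfunB => //; exact: bmfun_cst.
by congr (_ * _); apply: eq_bigr => k _; rewrite /marginal_error p1.
Qed.

(** The V-statistic of the indicator of [B] is nonnegative with mean [mu B];
    hence almost surely no tuple of observations lies in [B]. *)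
Lemma vstat_null (B : set (m.-tuple T)) : measurable B -> mu B = 0%E ->
  S [set x | 0 < vstat \1_B x] = 0%E.
Proof.
move=> mB muB; have bB : bmfun (\1_B : _ -> R) by exact: bmfun_indic.
have bv := bmfun_vstat bB.
have v0 x : 0 <= vstat \1_B x.
  rewrite mulr_ge0// ?invr_ge0 ?exprn_ge0//; apply: sumr_ge0 => kap _.
  by rewrite indicE.
have : {ae S, forall x, vstat \1_B x = 0}.
  apply: int_eq0_ae => //; first exact: bmfun_integ.
  by rewrite vstat_mean// int_indic// (muB : _ = 0%E).
have mA : measurable [set x | 0 < vstat \1_B x].
  exact: measurable_gt_cst (bmfun_measurable bv).
move=> vae; apply: measure_negligible => //.
apply: negligibleS vae => x /= xv /esym; move: xv; rewrite lt_neqAle => /andP[/eqP h _] /h.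
exact.
Qed.

Section law_of_samples.
Context {dO : measure_display} {Omega : measurableType dO}.
Variables (P : probability Omega R) (X : 'I_m -> 'I_N -> {RV P >-> T}).
Hypothesis Xiid : iid_samples nu X.

Definition sample_tuple (w : Omega) : n.-tuple T :=
  [tuple X (enum_val l).1 (enum_val l).2 w | l < n].

Lemma tnth_sample_tuple w j k : tnth (sample_tuple w) (obs j k) = X j k w.
Proof. by rewrite tnth_mktuple enum_rankK. Qed.

Lemma measurable_sample_tuple : measurable_fun setT sample_tuple.
Proof.
apply/measurable_fun_tnthP => l.
have -> : (tnth (T:=T))^~ l \o sample_tuple = X (enum_val l).1 (enum_val l).2.
  by apply/funext => x /=; rewrite tnth_mktuple.
by [].
Qed.

Lemma sample_tuple_law A : measurable A -> P (sample_tuple @^-1` A) = S A.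
Proof.
apply: prod_prob_preimage => [|B mB]; first exact: measurable_sample_tuple.
have [Xlaw Xind] := Xiid.
have := Xind (finset.setTfor ('I_m * 'I_N)%type) (fun jk => B (enum_rank jk)) (fun jk => mB _).
rewrite (_ : \bigcap_(i in _) _ = sample_tuple @^-1` rect B); last first.
  apply/seteqP; split => w /= h.
    move=> l; rewrite tnth_mktuple.
    by have := h (enum_val l); rewrite /= inE enum_valK => /(_ isT).
  move=> jk _; have := h (enum_rank jk).
  by rewrite tnth_mktuple enum_rankK.
move=> ->; rewrite [RHS](reindex _ (onW_bij _ (@enum_rank_bij _)))/=.
apply: eq_big => [jk|jk _]; first by rewrite inE.
by rewrite /sample_law enum_rankK -(Xlaw jk.1 jk.2).
Qed.

End law_of_samples.

End sampling.

(** * Minimizers and their densities *)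

Section schrodinger_density.
Context {R : realType} {m d : nat}.
Local Notation T := (borel_rV R d).
Variables (alpha : 'I_m -> R) (eps : R).
Hypothesis alpha_ge0 : forall j, 0 <= alpha j.
Hypothesis eps0 : 0 < eps.
Hypothesis m0 : (0 < m)%N.

Definition cube (x : m.-tuple T) :=
  forall j k, -1 <= (tnth x j : 'rV[R]_d) 0 k <= 1.

Definition cost_bound : R :=
  \sum_(i < m) \sum_(j < m | (i < j)%N) \sum_(k < d) (alpha i + alpha j) ^+ 2.

Lemma cost_bound_ge0 : 0 <= cost_bound.
Proof.
by do 3 (apply: sumr_ge0 => ? _); exact: sqr_ge0.
Qed.

Lemma cost_ge0 (x : m.-tuple T) : 0 <= cost alpha x.
Proof. by do 3 (apply: sumr_ge0 => ? _); exact: sqr_ge0. Qed.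

Lemma cost_le x : cube x -> cost alpha x <= cost_bound.
Proof.
move=> xc; apply: ler_sum => i _; apply: ler_sum => j _; apply: ler_sum => k _.
rewrite !mxE; have /andP[i1 i2] := xc i k; have /andP[j1 j2] := xc j k.
have ai := alpha_ge0 i; have aj := alpha_ge0 j.
move: i1 i2 j1 j2; set u := (tnth x i : 'rV[R]_d) 0 k; set v := (tnth x j : 'rV[R]_d) 0 k.
move=> i1 i2 j1 j2.
have h1 : alpha i * u - alpha j * v <= alpha i + alpha j by nra.
have h2 : - (alpha i + alpha j) <= alpha i * u - alpha j * v by nra.
by rewrite !expr2; nra.
Qed.

Lemma measurable_cost : measurable_fun setT (@cost R m d alpha).
Proof.
have -> : @cost R m d alpha = fun x => \sum_(i < m) \sum_(j < m)
    (if (i < j)%N then \sum_(k < d) (alpha i * (tnth x i : 'rV[R]_d) 0 k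
      - alpha j * (tnth x j : 'rV[R]_d) 0 k) ^+ 2 else 0).
  apply/funext => x; apply: eq_bigr => i _; rewrite big_mkcond/=.
  apply: eq_bigr => j _; case: ifP => // _.
  by apply: eq_bigr => k _; rewrite !mxE.
apply: measurable_sum => i; apply: measurable_sum => j.
case: (i < j)%N; last exact: measurable_cst.
apply: measurable_sum => k; apply: measurable_funX.
have mt l : measurable_fun setT (fun x : m.-tuple T => (tnth x l : 'rV[R]_d) 0 k).
  apply: (measurableT_comp (measurable_coord k)).
  exact: measurable_tnth.
by apply: measurable_funB; apply: measurable_funM.
Qed.

(** The cost, truncated so as to be bounded everywhere and not only on the
    cube that carries all couplings. *)
Definition tcost (x : m.-tuple T) := Num.min (cost alpha x) cost_bound.

Lemma bmfun_tcost : bmfun tcost.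
Proof.
apply: (@bmfunW _ _ _ _ 0 cost_bound).
  by apply: measurable_minr => //; exact: measurable_cost.
by move=> x; rewrite le_min cost_ge0 cost_bound_ge0 ge_min lexx orbT.
Qed.

Lemma tcost_ge0 x : 0 <= tcost x.
Proof. by rewrite le_min cost_ge0 cost_bound_ge0. Qed.

Lemma tcost_le x : tcost x <= cost_bound.
Proof. by rewrite ge_min lexx orbT. Qed.

Lemma tcostE x : cube x -> tcost x = cost alpha x.
Proof. by move=> /cost_le h; rewrite /tcost min_l. Qed.

Section minimizer.
Variables (nu : 'I_m -> probability T R) (X : 'I_m -> set T).
Local Notation mu := (prod_prob nu).
Hypothesis mX : forall j, measurable (X j).
Hypothesis nuX : forall j, nu j (X j) = 1%E.
Hypothesis Xcube : forall j x k, X j x -> -1 <= (x : 'rV[R]_d) 0 k <= 1.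

Lemma coupling_cube pi : coupling nu pi -> {ae pi, forall x, cube x}.
Proof.
move=> cpi; have : forall j, {ae pi, forall x, X j (tnth x j)}.
  move=> j; exists (tnth (T:=T) ^~ j @^-1` (~` X j)); split.
  - rewrite -[X in measurable X]setTI; apply: measurable_tnth => //.
    exact: measurableC.
  - apply: etrans (cpi j _ (measurableC (mX j))) _.
    apply: etrans (probability_setC (nu j) (mX j)) _.
    by rewrite nuX subee.
  - by move=> x /= h; exact: h.
move=> /filter_forall; apply: filterS => x /= Xx j k.
exact: Xcube (Xx j).
Qed.

Lemma coupling_int pi j (f : T -> R) : coupling nu pi -> bmfun f ->
  \int[pi]_x f (tnth x j) = \int[nu j]_y f y.
Proof.
move=> cpi bf; congr fine.
transitivity (\int[pushforward pi (fun x => tnth x j)]_y (f y)%:E)%E.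
  rewrite integral_pushforward//.
  - exact: measurable_tnth.
  - by apply/measurable_EFinP; case: bf.
  - exact: (bmfun_integ pi (bmfun_tnth j bf)).
apply: eq_measure_integral => [|mt A mA _]; first exact: measurable_tnth.
exact: (cpi j A mA).
Qed.

Lemma coupling_density_coupling q pi : density mu q pi -> integ mu q ->
  coupling nu pi <-> coupling_density nu q.
Proof.
move=> qpi Iq; have [mq q0 qE] := qpi; split => [cpi|[_ _ _ qmarg] j A mA].
  split => // j phi bphi.
  have bt := bmfun_tnth j bphi.
  rewrite -(int_density qpi); [|by case: bt|by integ_tac].
  rewrite coupling_int//.
  by apply: eq_Rintegral => y _; rewrite mulr1.
have mtA : measurable ((tnth (T:=T) ^~ j) @^-1` A : set (m.-tuple T)).
  by rewrite -[X in measurable X]setTI; exact: measurable_tnth.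
transitivity (\int[pi]_x (\1_A (tnth x j) : R))%:E.
  rewrite /pushforward (_ : (fun x => \1_A (tnth x j)) =
     \1_((tnth (T:=T) ^~ j) @^-1` A : set (m.-tuple T))); last by apply/funext.
  by rewrite int_indic// fineK// fin_num_measure.
have bA : bmfun (\1_A : T -> R) by exact: bmfun_indic.
have bt := bmfun_tnth j bA.
rewrite (int_density qpi); [|by case: bt|by integ_tac].
rewrite qmarg//; under eq_Rintegral do rewrite mulr1.
by rewrite int_indic// fineK// fin_num_measure.
Qed.

Lemma int_cost pi : coupling nu pi ->
  (\int[pi]_x (cost alpha x)%:E = (\int[pi]_x tcost x)%:E)%E.
Proof.
move=> cpi; rewrite EFin_int; last by apply: bmfun_integ; exact: bmfun_tcost.
apply: ae_eq_integral => //.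
- by apply/measurable_EFinP; exact: measurable_cost.
- by apply/measurable_EFinP; case: bmfun_tcost.
- by apply: filterS (coupling_cube cpi) => x /= /tcostE -> _.
Qed.

Lemma objectiveE q pi : density mu q pi -> coupling nu pi ->
  integ mu (fun x => q x * ln (q x)) ->
  objective alpha eps nu pi = (entropic_cost nu tcost eps q)%:E.
Proof.
move=> qpi cpi Iqln; have Iq := density_integ qpi.
rewrite /objective int_cost// (KL_density qpi)// -EFinM -EFinD.
rewrite (int_density qpi)//; first by case: bmfun_tcost.
by have := bmfun_tcost => ?; integ_tac.
Qed.

Lemma prod_density : density mu (fun=> 1) mu.
Proof.
split => // A mA; rewrite integral_cst// mul1e.
by [].
Qed.

Lemma coupling_prod_prob : coupling nu mu.
Proof.
apply/(coupling_density_coupling prod_density); last exact: coupling_density1.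
by apply: bmfun_integ; exact: bmfun_cst.
Qed.

(** Minimality among measures is minimality among densities: the product
    coupling has finite objective, so a minimizer has finite entropy. *)
Lemma minimizer_density pi : schrodinger_minimizer alpha eps nu pi ->
  exists p, density mu p pi /\ optimal_density nu tcost eps p.
Proof.
move=> [cpi piopt].
have piP pi' : coupling nu pi' ->
    (objective alpha eps nu pi <= objective alpha eps nu pi')%E.
  by move=> cpi'; rewrite piopt; apply: ereal_inf_lbound; exists pi'.
have I1ln : integ mu (fun=> 1 * ln 1) by apply: bmfun_integ; exact: bmfun_cst.
have cmu := coupling_prod_prob.
have KLy : (KL pi mu < +oo)%E.
  have := piP _ cmu; rewrite (objectiveE prod_density cmu I1ln).
  rewrite /objective int_cost//; case: (KL pi mu) => [r| |]//; rewrite ?ltry//.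
  by rewrite gt0_muley ?lte_fin// addey.
have [p [ppi Ipln]] := KL_lty_density KLy.
have Ip := density_integ ppi.
exists p; split => //; split => //.
  exact/(coupling_density_coupling ppi Ip).
move=> q qd Iqln; have [mq q0 Iq _] := qd.
have [pi' qpi'] := density_exists mq q0 Iq (coupling_density_int qd m0).
have cpi' : coupling nu pi' by apply/(coupling_density_coupling qpi' Iq).
by have := piP _ cpi'; rewrite (objectiveE ppi)// (objectiveE qpi')// lee_fin.
Qed.

End minimizer.

Definition cutoff (h : T -> R) (H : R) (y : T) : R :=
  h y * \1_[set y | `|h y| <= H] y.

Lemma cutoff_le h H y : 0 <= H -> `|cutoff h H y| <= H.
Proof.
move=> H0; rewrite /cutoff indicE; case: (boolP (y \in _)) => [|_].
  by rewrite inE mulr1.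
by rewrite mulr0 normr0.
Qed.

Lemma bmfun_cutoff_wmean h H : 0 <= H -> measurable_fun setT h ->
  bmfun (fun x => cutoff h H (wmean alpha x)).
Proof.
move=> H0 mh; apply: (bmfun_comp (measurable_wmean alpha)).
split; last by exists H => y; exact: cutoff_le.
by apply: measurable_funM => //; apply: measurable_indic; exact: measurable_norm_le_cst.
Qed.

Lemma int_barycenter (pi : probability (m.-tuple T) R) (h : T -> R) (H : R) :
  0 <= H -> measurable_fun setT h ->
  pi [set x | (H < `|h (wmean alpha x)|)%R] = 0%E ->
  \int[barycenter alpha pi]_y h y = \int[pi]_x cutoff h H (wmean alpha x).
Proof.
move=> H0 mh hH; have bw := bmfun_cutoff_wmean H0 mh.
have mcut : measurable_fun setT (cutoff h H).
  by apply: measurable_funM => //; apply: measurable_indic; exact: measurable_norm_le_cst.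
transitivity (\int[barycenter alpha pi]_y cutoff h H y).
  congr fine; apply: ae_eq_integral => //; [exact/measurable_EFinP..|].
  exists [set y | (H < `|h y|)%R]; split.
  - exact: measurable_gt_cst (measurableT_comp (@normr_measurable R setT) mh).
  - exact: hH.
  - move=> y /= hy; rewrite ltNge; apply/negP => yH; apply: hy => _.
    by rewrite /cutoff indicE mem_set// mulr1.
congr fine; rewrite integral_distribution//; first exact/measurable_EFinP.
exact: (bmfun_integ pi bw).
Qed.

End schrodinger_density.

(** * Comparison of the two barycenters *)

Section gibbs_density.
Context {dT : measure_display} {T : measurableType dT} {R : realType}.
Variables (m : nat) (nu : 'I_m -> probability T R).
Local Notation mu := (prod_prob nu).

Lemma density_ae (pi : probability (m.-tuple T) R) (q q' : m.-tuple T -> R) : measurable_fun setT q' ->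
  (forall x, 0 <= q' x) -> {ae mu, forall x, q x = q' x} ->
  density mu q pi -> density mu q' pi.
Proof.
move=> mq' q'0 qq' [mq q0 qE]; split => // A mA; rewrite qE//.
apply: ae_eq_integral => //; do 1? exact/measurable_funTS/measurable_EFinP.
by apply: filterS qq' => x /= -> _.
Qed.

Lemma coupling_density_condexp p : bmfun p -> coupling_density nu p ->
  {ae mu, forall x, forall j, condexp nu j p (tnth x j) = 1}.
Proof.
move=> bp [_ _ _ pmarg]; apply: filter_forall => j.
have br : bmfun (condexp nu j p) by exact: bmfun_condexp.
have bphi : bmfun (fun y => condexp nu j p y - 1) by bmfun_tac.
have : {ae mu, forall x, (condexp nu j p (tnth x j) - 1) ^+ 2 = 0}.
  apply: int_eq0_ae; first by integ_tac.
    by move=> x; exact: sqr_ge0.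
  rewrite (int_tnth nu j (f := fun y => (condexp nu j p y - 1) ^+ 2)); last by bmfun_tac.
  have -> : \int[nu j]_y ((condexp nu j p y - 1) ^+ 2) =
    \int[nu j]_y ((condexp nu j p y - 1) * condexp nu j p y) -
    \int[nu j]_y ((condexp nu j p y - 1) * 1).
    by rewrite -intB; [|integ_tac|integ_tac]; apply: eq_Rintegral => y _; ring.
  have /= e1 := marginal_condexp nu j bp bphi; have /= e2 := pmarg j _ bphi.
  by rewrite -e1 e2 subrr.
by apply: filterS => x /= /eqP; rewrite sqrf_eq0 subr_eq0 => /eqP.
Qed.

Definition density_lower (M eps : R) := expR (- (M * (1 + m%:R * (m%:R - 1)) / eps)).
Definition density_upper (M eps : R) := expR (m%:R * M / eps).

(** The density is modified on a null set so that its bounds hold everywhere: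
    it will be integrated against empirical measures, which are singular with
    respect to [nu] in general. *)
Lemma optimal_density_gibbs (c : m.-tuple T -> R) (M eps : R) p0 : bmfun c ->
  (forall x, 0 <= c x) -> (forall x, c x <= M) -> 0 < eps -> 0 <= M ->
  (0 < m)%N -> optimal_density nu c eps p0 ->
  exists p (phi : 'I_m -> T -> R) kappa,
   [/\ {ae mu, forall x, p0 x = p x}, bmfun p,
       forall x, density_lower M eps <= p x <= density_upper M eps &
       coupling_density nu p] /\
   (forall j, bmfun (phi j)) /\
   {ae mu, forall x, c x + eps * ln (p x) = \sum_j phi j (tnth x j) + kappa}.
Proof.
move=> bc c0 cM eps0 M0 m0 opt0; set delta := density_lower _ _.
set U := density_upper _ _.
have [[mp0 p00 _ _] _ _] := opt0.
have delta0 : 0 < delta by exact: expR_gt0.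
have U1 : 1 <= U.
  by rewrite -[leLHS]expR0 ler_expR divr_ge0 ?mulr_ge0// ltW.
have d1 : delta <= 1.
  rewrite -[leRHS]expR0 ler_expR oppr_le0 divr_ge0 ?(ltW eps0)//.
  by rewrite mulr_ge0// addr_ge0// mulr_ge0// subr_ge0 ler1n.
pose p1 x := Num.min (p0 x) U.
have bp1 : bmfun p1.
  apply: (@bmfunW _ _ _ _ 0 U); first exact: measurable_minr.
  by move=> x; rewrite le_min p00 (le_trans ler01)//= ge_min lexx orbT.
have p01 : {ae mu, forall x, p0 x = p1 x}.
  by apply: filterS (optimal_density_le bc c0 cM eps0 M0 m0 opt0) => x /= h; rewrite /p1 min_l.
have p10 x : 0 <= p1 x by rewrite le_min p00 (le_trans ler01).
have opt1 := optimal_density_ae bc (bmfun_measurable bp1) p10 p01 opt0.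
pose p x := Num.max (p1 x) delta.
have bp : bmfun p by apply: bmfun_max => //; exact: bmfun_cst.
have p1p : {ae mu, forall x, p1 x = p x}.
  by apply: filterS (optimal_density_ge bc c0 cM eps0 m0 bp1 opt1) => x /= h; rewrite /p max_l.
have dp x : delta <= p x by rewrite le_max lexx orbT.
have pge0 x : 0 <= p x by rewrite (le_trans (ltW delta0)).
have opt := optimal_density_ae bc (bmfun_measurable bp) pge0 p1p opt1.
have [phi [kappa [bphi gibbs]]] := optimal_density_sum bc eps0 m0 bp delta0 dp opt.
exists p, phi, kappa; split; last by split.
split => //; last by case: opt.
  by apply: filterS2 p01 p1p => x /= -> ->.
move=> x; rewrite dp/= /p ge_max (le_trans d1 U1) andbT.
by rewrite ge_min lexx orbT.
Qed.

End gibbs_density.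

Section comparison.
Context {R : realType} {m d N : nat}.
Local Notation T := (borel_rV R d).
Variables (N0 : (0 < N)%N) (alpha : 'I_m -> R) (eps : R).
Hypothesis alpha_ge0 : forall j, 0 <= alpha j.
Hypothesis eps0 : 0 < eps.
Hypothesis m0 : (0 < m)%N.
Variables (nu : 'I_m -> probability T R) (piopt : probability (m.-tuple T) R).
Local Notation mu := (prod_prob nu).
Variables (p : m.-tuple T -> R) (phi : 'I_m -> T -> R) (kappa delta U : R).
Hypothesis bp : bmfun p.
Hypothesis delta0 : 0 < delta.
Hypothesis dp : forall z, delta <= p z.
Hypothesis pU : forall z, p z <= U.
Hypothesis ppi : density mu p piopt.
Hypothesis bphi : forall j, bmfun (phi j).
Variables (h : T -> R) (H : R).
Hypothesis mh : measurable_fun setT h.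
Hypothesis H0 : 0 <= H.

(** What holds at almost every tuple for the product of the [nu j]. Since almost
    surely all tuples of observations avoid a given null set, these properties
    pass to the product of the empirical measures. *)
Definition regular_point (z : m.-tuple T) :=
  [/\ tcost alpha z + eps * ln (p z) = \sum_j phi j (tnth z j) + kappa,
      `|h (wmean alpha z)| <= H, cube z &
      forall j, condexp nu j p (tnth z j) = 1].

Variable B : set (m.-tuple T).
Hypothesis mB : measurable B.
Hypothesis muB : mu B = 0%E.
Hypothesis BP : forall z, ~ B z -> regular_point z.

(** Normalizing by the bound [H] scales it out of all the estimates; when [H] is
    zero, so is the cut-off function, and [H * test] is still that function. *)
Definition test (z : m.-tuple T) : R :=
  H^-1 * cutoff h H (wmean alpha z).

Lemma test_le1 z : `|test z| <= 1.
Proof.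
rewrite normrM ger0_norm ?invr_ge0//; have [->|Hn0] := eqVneq H 0.
  by rewrite invr0 mul0r.
rewrite ler_pdivrMl ?mulr1; first exact: cutoff_le.
by rewrite lt_neqAle eq_sym Hn0.
Qed.

Lemma testE z : H * test z = cutoff h H (wmean alpha z).
Proof.
have [Hz|Hn0] := eqVneq H 0; last by rewrite /test mulVKf.
have := cutoff_le h (wmean alpha z) H0; rewrite Hz normr_le0 => /eqP ->.
by rewrite mul0r.
Qed.

Lemma bmfun_test : bmfun test.
Proof.
by apply: bmfunM; [exact: bmfun_cst|exact: bmfun_cutoff_wmean].
Qed.

Lemma int_barycenter_test (nu' : 'I_m -> probability T R) pi q :
  prod_prob nu' B = 0%E -> density (prod_prob nu') q pi ->
  \int[barycenter alpha pi]_y h y = H * \int[prod_prob nu']_z (test z * q z).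
Proof.
move=> nuB qpi; have Iq := density_integ qpi; have bt := bmfun_test.
rewrite (int_barycenter (H := H))//; last first.
  have mA : measurable [set z | (H < `|h (wmean alpha z)|)%R].
    exact: measurable_gt_cst (measurableT_comp (@normr_measurable R setT)
      (measurableT_comp mh (measurable_wmean alpha))).
  have /null_content_dominatesP dom := density_dominates qpi.
  apply: dom => //; apply: (subset_measure0 _ mB) => //.
  move=> z /= Hz; apply: contrapT => /BP [_ + _ _].
  by rewrite leNgt Hz.
under eq_Rintegral do rewrite -testE.
rewrite intZ; last by integ_tac.
by rewrite (int_density qpi)//; [case: bt|integ_tac].
Qed.

Let Bae (nu' : 'I_m -> probability T R) : prod_prob nu' B = 0%E ->
  {ae (prod_prob nu'), forall z, regular_point z}.
Proof.
by move=> nuB; exists B; split => // z /= hz; apply: contrapT => /BP.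
Qed.

Section sample.
Variables (x : #|{: 'I_m * 'I_N}|.-tuple T) (pihat : probability (m.-tuple T) R).
Local Notation nuhat := (emp_marginal (R := R) N0 x).
Local Notation muhat := (prod_prob nuhat).
Hypothesis pihat_opt : schrodinger_minimizer alpha eps nuhat pihat.
Hypothesis xB : vstat (\1_B : _ -> R) x <= 0.

Let muhatB : muhat B = 0%E.
Proof.
have bB : bmfun (\1_B : _ -> R) by exact: bmfun_indic.
rewrite -[LHS]fineK ?fin_num_measure// -int_indic// int_emp_prod//.
congr EFin; apply/eqP; rewrite eq_le xB/=.
rewrite mulr_ge0// ?invr_ge0 ?exprn_ge0//; apply: sumr_ge0 => kap _.
by rewrite indicE.
Qed.

Let draw_regular kap : regular_point (draw kap x).
Proof.
apply: BP => Bk.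
have NR0 : 0 < N%:R :> R by rewrite ltr0n.
have : 0 < vstat (\1_B : _ -> R) x.
  rewrite /vstat mulr_gt0 ?invr_gt0 ?exprn_gt0// (bigD1 kap)//=.
  rewrite indicE mem_set//= ltr_wpDr//.
  by apply: sumr_ge0 => kap' _; rewrite indicE.
by rewrite ltNge xB.
Qed.

Let obs_cube j k l : -1 <= (tnth x (obs j k) : 'rV[R]_d) 0 l <= 1.
Proof.
have [_ _ + _] := draw_regular [ffun=> k].
by move=> /(_ j l); rewrite tnth_mktuple ffunE.
Qed.

Let obs_condexp j k : condexp nu j p (tnth x (obs j k)) = 1.
Proof.
have [_ _ _ +] := draw_regular [ffun=> k].
by move=> /(_ j); rewrite tnth_mktuple ffunE.
Qed.

Let Q : set T := [set y | forall l, -1 <= (y : 'rV[R]_d) 0 l <= 1].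

Lemma measurable_unit_cube : measurable Q.
Proof.
rewrite (_ : Q = \bigcap_(l in setT)
   ((fun y : T => (y : 'rV[R]_d) 0 l) @^-1` `[-1, 1]%classic)).
  apply: fin_bigcap_measurable; first exact: finite_finset.
  move=> l _; rewrite -[X in measurable X]setTI.
  exact: measurable_coord.
apply/seteqP; split => y /= hy l; first by move=> _; exact: hy.
exact: (hy l I).
Qed.

Let nuhatQ j : nuhat j Q = 1%E.
Proof.
apply: etrans (empiricalE _ _ _) _; congr EFin.
rewrite (eq_bigr (fun=> 1)) => [|k _]; last first.
  by rewrite indicE mem_set// => l; exact: obs_cube.
by rewrite sumr_const card_ord mulVf// pnatr_eq0 -lt0n.
Qed.

Lemma empirical_density : exists q, density muhat q pihat /\
  optimal_density nuhat (tcost alpha) eps q.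
Proof.
exact: (minimizer_density alpha_ge0 eps0 m0 (fun=> measurable_unit_cube) nuhatQ).
Qed.

Lemma comparison_trivial :
  `|\int[barycenter alpha piopt]_y h y - \int[barycenter alpha pihat]_y h y|
  <= H * 2.
Proof.
have [q [qpi [qd _ _]]] := empirical_density.
have one (nu' : 'I_m -> probability T R) pi q' : density (prod_prob nu') q' pi ->
    `|\int[prod_prob nu']_z (test z * q' z)| <= 1.
  move=> q'pi; have [_ q'0 _] := q'pi; have Iq := density_integ q'pi.
  have bt := bmfun_test.
  apply: le_trans (le_normr_Rintegral measurableT _) _; first by integ_tac.
  rewrite -(density_int1 q'pi); apply: int_le => [||z]; [integ_tac|by []|].
  by rewrite normrM (ger0_norm (q'0 z)) ler_piMl// test_le1.
rewrite (int_barycenter_test muB ppi) (int_barycenter_test muhatB qpi) -mulrBr.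
rewrite normrM (ger0_norm H0) ler_wpM2l// (le_trans (ler_normB _ _))//.
rewrite -[2]/(1 + 1)%R; apply: lerD; first exact: one ppi.
exact: one qpi.
Qed.

(** The difference of the barycenters splits into the fluctuation of the
    V-statistic of kernel [test * p], and the distance between [p] and the
    empirical optimizer [q] in the mean under the product of the empirical
    measures. The latter is a case of the stability estimate, in which the
    marginal errors of [p] are averages over the observations. *)
Lemma comparison_main (u theta : R) : 0 < theta ->
  `|vstat (fun z => test z * p z) x - \int[mu]_z (test z * p z)| <= u ->
  (forall j, N%:R^-1 * \sum_k (marginal_error N0 nu p j k x) ^+ 2 <= u ^+ 2) ->
  (forall j k, `|marginal_error N0 nu p j k x| <= delta / (2 * m%:R)) ->
  `|\int[barycenter alpha piopt]_y h y - \int[barycenter alpha pihat]_y h y|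
  <= H * (u + (2 * m%:R ^+ 3 / (delta * theta) * u ^+ 2 + theta * (1 + U))).
Proof.
move=> theta0 xu xW xsmall.
have [q [qpi qopt]] := empirical_density.
have [[mq q0 Iq _] _ _] := qopt.
have bt := bmfun_test.
rewrite (int_barycenter_test muB ppi) (int_barycenter_test muhatB qpi) -mulrBr.
rewrite normrM (ger0_norm H0) ler_wpM2l//.
have -> : \int[mu]_z (test z * p z) - \int[muhat]_z (test z * q z) =
  - (vstat (fun z => test z * p z) x - \int[mu]_z (test z * p z)) +
  \int[muhat]_z (test z * (p z - q z)).
  rewrite -(int_emp_prod N0); last by bmfun_tac.
  under [X in _ = _ + X]eq_Rintegral do rewrite mulrBr.
  by rewrite intB; [ring|integ_tac|integ_tac].
apply: (le_trans (ler_normD _ _)); rewrite normrN; apply: lerD => //.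
apply: (@le_trans _ _ (\int[muhat]_z `|q z - p z|)).
  apply: le_trans (le_normr_Rintegral measurableT _) _; first by integ_tac.
  apply: int_le => [||z]; [integ_tac|integ_tac|].
  by rewrite normrM distrC ler_piMl// test_le1.
have gibbs : {ae muhat, forall z,
    tcost alpha z + eps * ln (p z) = \sum_j phi j (tnth z j) + kappa}.
  by apply: filterS (Bae muhatB) => z [].
have small : {ae muhat, forall z, forall j,
    `|condexp nuhat j p (tnth z j) - 1| <= delta / (2 * m%:R)}.
  apply: filter_forall => j.
  pose bad : set T := [set y | delta / (2 * m%:R) < `|condexp nuhat j p y - 1|].
  have br : bmfun (condexp nuhat j p) by exact: bmfun_condexp.
  have mbad : measurable bad.
    by apply: measurable_gt_cst; apply: bmfun_measurable; bmfun_tac.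
  have bb : bmfun (\1_bad : T -> R) by exact: bmfun_indic.
  have : {ae muhat, forall z, \1_bad (tnth z j) = 0 :> R}.
    apply: int_eq0_ae; first by integ_tac.
      by move=> z; rewrite indicE.
    rewrite int_tnth// int_empirical// big1 ?mulr0// => k _.
    rewrite indicE memNset//; apply/negP; rewrite -leNgt.
    by have := xsmall j k; rewrite /marginal_error obs_condexp.
  apply: filterS => z /= /eqP; rewrite indicE leNgt.
  case: (boolP (_ \in bad)); first by rewrite oner_eq0.
  by move=> /negP zb _; apply/negP => hz; apply: zb; rewrite inE.
have := stability (bmfun_tcost alpha) eps0 m0 bp delta0 dp pU bphi gibbs small qopt theta0.
move=> /le_trans; apply; rewrite lerD2r.
have -> : 2 * m%:R ^+ 3 / (delta * theta) * u ^+ 2 =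
    2 * m%:R ^+ 2 / (delta * theta) * (m%:R * u ^+ 2).
  by rewrite exprS; ring.
apply: ler_wpM2l.
  by rewrite divr_ge0 ?mulr_ge0 ?exprn_ge0// ltW.
apply: (@le_trans _ _ (\sum_(j < m) u ^+ 2)).
  apply: ler_sum => j _; rewrite (@sqr_marginal_error _ _ _ m N N0 nu p j x bp (obs_condexp j)); exact: xW.
by rewrite sumr_const card_ord -[leLHS]mulr_natl.
Qed.

End sample.
End comparison.

(** * Probability of the good event and conclusion *)

Lemma union_bound d (S : measurableType d) (R : realType) (P : probability S R)
    (I : finType) (A : I -> set S) (e : I -> R) :
  (forall i, measurable (A i)) -> (forall i, (P (A i) <= (e i)%:E)%E) ->
  exists E, [/\ measurable E, forall x, E x -> forall i, ~ A i x &
    ((1 - \sum_i e i)%:E <= P E)%E].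
Proof.
move=> mA Ae; pose count x : R := \sum_i \1_(A i) x.
have bA i : bmfun (\1_(A i) : S -> R) by exact: bmfun_indic.
have bcount : bmfun count by rewrite /count; bmfun_tac.
have mE : measurable [set x | (count x < 1)%R].
  exact: measurable_lt_cst (bmfun_measurable bcount).
have bE : bmfun (\1_[set x | (count x < 1)%R] : S -> R) by exact: bmfun_indic.
have A0 i x : 0 <= \1_(A i) x :> R by rewrite indicE.
exists [set x | (count x < 1)%R]; split => //.
  move=> x /= + i Aix; rewrite ltNge => /negP; apply.
  by rewrite /count (bigD1 i)//= indicE mem_set//= lerDl sumr_ge0.
rewrite -[leRHS]fineK ?fin_num_measure// lee_fin -int_indic//.
apply: (@le_trans _ _ (\int[P]_x (1 - count x))).
  rewrite intB; [|integ_tac|integ_tac]; rewrite int_cst lerD2l lerN2 /count int_sum; last by move=> i; integ_tac.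
  apply: ler_sum => i _; rewrite int_indic//.
  by rewrite -lee_fin fineK ?fin_num_measure//; exact: Ae.
apply: int_le => [||x]; [integ_tac|integ_tac|rewrite indicE].
case: (boolP (x \in _)) => [_|/negP xE].
  by rewrite lerBlDr lerDl sumr_ge0.
rewrite subr_le0 leNgt; apply/negP => h; apply: xE; by rewrite inE.
Qed.

Section tail_arithmetic.
Context {R : realType}.
Implicit Types t x beta : R.

Lemma expR1_ge2 : 2 <= expR 1 :> R.
Proof. by apply: le_trans (expR_ge1Dx 1); lra. Qed.

Lemma expR1_le6 : expR 1 <= 6 :> R.
Proof.
have -> : expR 1 = expR (2^-1 : R) ^+ 2 by rewrite -expRM_natl; congr expR; lra.
have h : expR (2^-1 : R) <= 2.
  have := @expR_le_inv R 2^-1; rewrite (_ : 1 - 2^-1 = 2^-1); last by lra.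
  rewrite invrK; apply; lra.
by have h0 := expR_ge0 (2^-1 : R); rewrite expr2; nra.
Qed.

Lemma double_expRN t : 1 <= t -> 2 * expR (- (2 * t)) <= expR (- t).
Proof.
move=> t1; have -> : - (2 * t) = - t + - t by ring.
rewrite expRD mulrA ler_piMl ?expR_ge0// expRN.
rewrite ler_pdivrMr ?expR_gt0// mul1r (le_trans expR1_ge2)// ler_expR.
exact: t1.
Qed.

(** A union bound over [O(N)] events of probability [exp (- beta N)] still
    gives [exp (- t)] in the range [1 <= t <= c N] for a small constant [c]:
    the factor [N] is absorbed by a fraction of the exponent, and the constant
    by another one because [N >= 1 / c]. *)
Lemma linear_union_tail (m : nat) (NR beta t : R) : (0 < m)%N -> 0 < beta ->
  0 < NR -> 1 <= t -> t <= beta ^+ 2 / (32 * m%:R + 2 * beta) * NR ->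
  m%:R * NR * (2 * expR (- (beta * NR))) <= expR (- t).
Proof.
move=> m0 beta0 N0 t1 tN; have mR : 1 <= m%:R :> R by rewrite ler1n.
have D0 : 0 < 32 * m%:R + 2 * beta by lra.
have tN' : t * (32 * m%:R + 2 * beta) <= beta ^+ 2 * NR.
  by move: tN; rewrite mulrAC ler_pdivlMr.
have bN0 : 0 < beta * NR by rewrite mulr_gt0.
have h1 : 8 * m%:R / beta <= beta * NR / 4.
  rewrite ler_pdivrMr//.
  have : 32 * m%:R <= beta ^+ 2 * NR by nra.
  by rewrite expr2; lra.
have h2 : t <= beta * NR / 2.
  rewrite -(ler_pM2l beta0); move: tN'; rewrite expr2 mulrDr => tN'.
  have : 0 <= t * (32 * m%:R) by rewrite mulr_ge0//; lra.
  lra.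
have h3 : NR <= 4 / beta * expR (beta * NR / 4).
  have h := expR_ge1Dx (beta * NR / 4).
  apply: (@le_trans _ _ (4 / beta * (beta * NR / 4))).
    by rewrite le_eqVlt; apply/orP; left; apply/eqP; field; rewrite gt_eqF.
  by rewrite ler_pM2l ?divr_gt0//; lra.
have h4 : 8 * m%:R / beta <= expR (beta * NR / 4).
  by apply: le_trans h1 _; have := expR_ge1Dx (beta * NR / 4); lra.
apply: (@le_trans _ _ (8 * m%:R / beta * expR (beta * NR / 4) * expR (- (beta * NR)))).
  rewrite mulrA ler_pM2r ?expR_gt0//.
  have -> : 8 * m%:R / beta * expR (beta * NR / 4) =
    m%:R * (4 / beta * expR (beta * NR / 4)) * 2 by ring.
  by rewrite ler_pM2r// ler_wpM2l.
apply: (@le_trans _ _ (expR (beta * NR / 4) * expR (beta * NR / 4) * expR (- (beta * NR)))).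
  by rewrite ler_pM2r ?expR_gt0// ler_pM2r ?expR_gt0.
by rewrite -!expRD ler_expR; lra.
Qed.

End tail_arithmetic.

Section good_event.
Context {dT : measure_display} {T : measurableType dT} {R : realType}.
Variables (m N : nat) (N0 : (0 < N)%N) (nu : 'I_m -> probability T R).
Local Notation S := (prod_prob (sample_law (N := N) nu)).
Hypothesis m0 : (0 < m)%N.

(** With the variance parameter [sigma / N], the level [u] gives tails
    [2 exp (- 2 t)], at most [exp (- t)] as [t >= 1]; the fixed level [eta]
    gives [2 exp (- beta N)] for each of the [m N] observations. *)
Lemma good_event (G p : m.-tuple T -> R) (B : set (m.-tuple T))
    (U eta t : R) :
  let sigma := 8 * m%:R * U ^+ 2 in
  let beta := eta ^+ 2 / (4 * sigma) in
  let u := Num.sqrt (8 * sigma) * Num.sqrt (t / N%:R) in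
  0 < U -> 0 < eta -> 1 <= t ->
  t <= beta ^+ 2 / (32 * m%:R + 2 * beta) * N%:R ->
  bmfun G -> (forall z, `|G z| <= U) -> bmfun p -> (forall z, `|p z| <= U) ->
  measurable B -> prod_prob nu B = 0%E ->
  exists E, [/\ measurable E,
    forall y, E y -> [/\ vstat (\1_B : _ -> R) y <= 0,
      `|vstat G y - \int[prod_prob nu]_z G z| <= u,
      forall j, N%:R^-1 * \sum_k (marginal_error N0 nu p j k y) ^+ 2 <= u ^+ 2 &
      forall j k, `|marginal_error N0 nu p j k y| <= eta] &
    ((1 - (m%:R + 2) * expR (- t))%:E <= S E)%E].
Proof.
move=> sigma beta u U0 eta0 t1 tN bG GU bp pU mB muB.
have NR0 : 0 < N%:R :> R by rewrite ltr0n.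
have t0 : 0 < t by exact: lt_le_trans t1.
have sigma0 : 0 < sigma by rewrite !mulr_gt0 ?ltr0n// exprn_gt0.
have beta0 : 0 < beta by rewrite divr_gt0 ?exprn_gt0// mulr_gt0.
have u0 : 0 < u by rewrite mulr_gt0// sqrtr_gt0 ?divr_gt0// mulr_gt0.
pose v := sigma / N%:R.
have v0 : 0 < v by rewrite divr_gt0.
have uE : u ^+ 2 / (4 * v) = 2 * t.
  rewrite /u exprMn !sqr_sqrtr ?divr_ge0 ?(ltW t0)//; last by rewrite mulr_ge0// ltW.
  by rewrite /v; field; rewrite !gt_eqF.
have etaE : eta ^+ 2 / (4 * v) = beta * N%:R.
  by rewrite /v /beta; field; rewrite !gt_eqF.
have u4v : 4 * v <= u ^+ 2.
  have -> : u ^+ 2 = 2 * t * (4 * v) by rewrite -uE; field; rewrite gt_eqF.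
  apply: ler_peMl; first by rewrite mulr_ge0// ltW.
  by rewrite (le_trans t1)// ler_peMl ?(ltW t0)// ler1n.
have bB : bmfun (\1_B : _ -> R) by exact: bmfun_indic.
have sgG : subgaussian S v (fun y => vstat G y - \int[prod_prob nu]_z G z).
  exact: vstat_subgaussian.
have sgW j k : subgaussian S v (marginal_error N0 nu p j k).
  exact: marginal_error_subgaussian.
pose W j k := marginal_error N0 nu p j k.
pose I := (bool + ('I_m + 'I_m * 'I_N))%type.
pose A (i : I) : set _ := match i with
  | inl true => [set y | (0 < vstat (N := N) (\1_B : _ -> R) y)%R]
  | inl false => [set y | (u < `|vstat (N := N) G y - \int[prod_prob nu]_z G z|)%R]
  | inr (inl j) => [set y | (u ^+ 2 < N%:R^-1 * \sum_k W j k y ^+ 2)%R]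
  | inr (inr jk) => [set y | (eta < `|W jk.1 jk.2 y|)%R]
  end.
pose e (i : I) : R := match i with
  | inl true => 0
  | inl false => 2 * expR (- (2 * t))
  | inr (inl j) => 2 * expR (- (2 * t))
  | inr (inr jk) => 2 * expR (- (beta * N%:R))
  end.
have bW j k : bmfun (W j k) by case: (sgW j k).
have mA i : measurable (A i).
  case: i => [[]|[j|jk]] /=; apply: measurable_gt_cst; apply: bmfun_measurable.
  - exact: bmfun_vstat.
  - by apply: bmfun_norm; case: sgG.
  - apply: bmfunM; first exact: bmfun_cst.
    by apply: bmfun_sum => k; exact: bmfunX.
  - exact: bmfun_norm.
have Ae i : (S (A i) <= (e i)%:E)%E.
  case: i => [[]|[j|jk]] /=.
  - by rewrite (vstat_null N0 mB muB : _ = 0%E).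
  - by rewrite -uE; exact: (subgaussian_tail v0 sgG (ltW u0)).
  - by rewrite -uE; exact: (subgaussian_qmean_tail v0 N0 (sgW j) u0).
  - by rewrite -etaE; exact: (subgaussian_tail v0 (sgW jk.1 jk.2) (ltW eta0)).
have [E [mE EA SE]] := union_bound mA Ae.
exists E; split => // [y Ey|].
  have yA := EA _ Ey; split => [||j|j k]; rewrite leNgt; apply/negP.
  - exact: (yA (inl true)).
  - exact: (yA (inl false)).
  - exact: (yA (inr (inl j))).
  - exact: (yA (inr (inr (j, k)))).
apply: le_trans SE; rewrite lee_fin lerD2l lerN2.
rewrite big_sumType/= big_bool/= add0r big_sumType/= !sumr_const.
rewrite card_prod !card_ord -!(mulr_natl (_ * _)) natrM.
have h1 := double_expRN t1.
have -> : (m%:R + 2) * expR (- t) = expR (- t) + (m%:R * expR (- t) + expR (- t)).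
  by ring.
apply: lerD => //; apply: lerD; first by rewrite ler_wpM2l.
exact: linear_union_tail.
Qed.

End good_event.

Lemma Lfun_infty_bound d (S : measurableType d) (R : realType)
    (P : probability S R) (h : S -> R) : h \in Lfun P +oo%E ->
  [/\ measurable_fun setT h, 0 <= fine ('N[P]_+oo[EFin \o h])%E &
    {ae P, forall y, `|h y| <= fine ('N[P]_+oo[EFin \o h])%E}].
Proof.
move=> hL; have [mh hfin] : measurable_fun setT h /\ finite_norm P +oo%E h.
  by move: hL; rewrite inE => /andP[/set_mem ? /set_mem ?].
have PT : P setT = 1%E by exact: probability_setT.
have normE : 'N[P]_+oo[EFin \o h]%E = ess_sup P (abse \o (EFin \o h)).
  by rewrite unlock/= PT lte01.
split => //; first by rewrite fine_ge0// Lnorm_ge0.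
have : (ess_sup P (abse \o (EFin \o h)) <= (fine ('N[P]_+oo[EFin \o h]))%:E)%E.
  by rewrite fineK ?normE// -normE ge0_fin_numE ?Lnorm_ge0//; exact: hfin.
by move=> /ess_supP; apply: filterS => y /=; rewrite lee_fin.
Qed.

Theorem corollary5p4 (R : realType) (m d : nat) (eps : R) (alpha : 'I_m -> R)
    (m_ge2 : (2 <= m)%N) (d_ge1 : (1 <= d)%N) (eps_gt0 : 0 < eps)
    (alpha_ge0 : forall j, 0 <= alpha j)
    (alpha_sum1 : \sum_(j < m) alpha j = 1) :
  exists C : R, 0 < C /\
  forall (X : 'I_m -> set 'rV[R]_d)
    (nu : 'I_m -> probability (borel_rV R d) R)
    (piopt : probability (m.-tuple (borel_rV R d)) R)
    (dO : measure_display) (Omega : measurableType dO)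
    (P : probability Omega R)
    (N : nat) (N_gt0 : (0 < N)%N)
    (sample : 'I_m -> 'I_N -> {RV P >-> borel_rV R d})
    (pihat : Omega -> probability (m.-tuple (borel_rV R d)) R),
    (forall j, compact (X j)) ->
    (forall j, (X j)° !=set0) ->
    (forall j x k, X j x -> -1 <= x 0 k <= 1) ->
    (forall j, nu j (X j) = 1%E) ->
    schrodinger_minimizer alpha eps nu piopt ->
    iid_samples nu sample ->
    (forall w, schrodinger_minimizer alpha eps
       (fun j => empirical (fun k => sample j k w) N_gt0) (pihat w)) ->
    forall (h : borel_rV R d -> R) (t : R),
      h \in Lfun (barycenter alpha piopt) +oo%E ->
      0 < t ->
      with_probability_at_least P
        (1 - (2 * m%:R ^+ 2 - 2 * m%:R + 2) * expR (- t))
        [set w | `| \int[barycenter alpha piopt]_x h x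
                    - \int[barycenter alpha (pihat w)]_x h x |
                 <= C * fine ('N[barycenter alpha piopt]_+oo[EFin \o h])
                    * Num.sqrt (t / N%:R) ].
Proof.
have m0 : (0 < m)%N by exact: ltnW.
have mR2 : 2 <= m%:R :> R by rewrite ler_nat.
have mR0 : 0 < m%:R :> R by rewrite ltr0n.
pose M := @cost_bound R m d alpha.
have M0 : 0 <= M by exact: cost_bound_ge0.
set delta := density_lower m M eps; set U := density_upper m M eps.
have delta0 : 0 < delta by exact: expR_gt0.
have U0 : 0 < U by exact: expR_gt0.
pose eta := delta / (2 * m%:R).
have eta0 : 0 < eta by rewrite divr_gt0// mulr_gt0.
pose sigma := 8 * m%:R * U ^+ 2.
have sigma0 : 0 < sigma by rewrite !mulr_gt0// exprn_gt0.
(* [b * sqrt (t / N)] is the level of deviation in the good event. *)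
pose b := Num.sqrt (8 * sigma).
have b0 : 0 < b by rewrite sqrtr_gt0 mulr_gt0.
pose beta := eta ^+ 2 / (4 * sigma).
have beta0 : 0 < beta by rewrite divr_gt0 ?exprn_gt0// mulr_gt0.
pose c := beta ^+ 2 / (32 * m%:R + 2 * beta).
have c0 : 0 < c by rewrite divr_gt0 ?exprn_gt0// addr_gt0// mulr_gt0.
(* The bound of the comparison at that level with [theta = sqrt (t / N)],
   divided by [sqrt (t / N)]. *)
pose C1 := b + (2 * m%:R ^+ 3 / delta * b ^+ 2 + (1 + U)).
have C10 : 0 < C1.
  rewrite addr_gt0// addr_gt0 ?addr_gt0// !mulr_gt0 ?exprn_gt0//.
  by rewrite invr_gt0.
exists (C1 + 2 / Num.sqrt c); split.
  by rewrite addr_gt0// divr_gt0// sqrtr_gt0.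
move=> X nu piopt dO Omega P N N0 sample pihat Xcompact _ Xcube nuX piopt_min
  iid pihat_min h t hL t0.
have NR0 : 0 < N%:R :> R by rewrite ltr0n.
have [mh H0 baryH] := Lfun_infty_bound hL.
set H := fine _ in H0 baryH *; set s := Num.sqrt (t / N%:R).
have s0 : 0 < s by rewrite sqrtr_gt0 divr_gt0.
set Q := [set w | _].
pose pr : R := 2 * m%:R ^+ 2 - 2 * m%:R + 2.
have pr_ge : m%:R + 2 <= pr by rewrite /pr; nra.
have pr6 : 6 <= pr by rewrite /pr; nra.
(* The asserted probability is not positive, because [exp 1 <= 6]. *)
case: (ltP t 1) => t1.
  exists set0; split => //; rewrite measure0 lee_fin subr_le0.
  apply: (@le_trans _ _ (6 * expR (- t))); last by rewrite ler_pM2r ?expR_gt0.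
  rewrite expRN ler_pdivlMr ?expR_gt0// mul1r.
  by apply: le_trans expR1_le6; rewrite ler_expR ltW.
have Xclosed j : closed (X j).
  by apply: compact_closed => //; exact: norm_hausdorff.
have mX j : measurable (X j : set (borel_rV R d)).
  rewrite -[X j]setCK; apply: measurableC; apply: sub_sigma_algebra.
  exact: closed_openC.
have [p0 [p0pi popt]] := minimizer_density alpha_ge0 eps_gt0 m0 mX nuX Xcube piopt_min.
have [p [phi [kappa [[p0p bp pbound pd] [bphi gibbs]]]]] :=
  optimal_density_gibbs (bmfun_tcost alpha) (tcost_ge0 alpha) (tcost_le alpha)
    eps_gt0 M0 m0 popt.
have dp z : delta <= p z by have /andP[] := pbound z.
have pU z : p z <= U by have /andP[] := pbound z.
have pge0 z : 0 <= p z by rewrite (le_trans (ltW delta0)).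
have pB z : `|p z| <= U by rewrite ger0_norm.
have ppi := density_ae (bmfun_measurable bp) pge0 p0p p0pi.
have [B [mB muB BP]] : {ae (prod_prob nu), forall z,
    regular_point alpha eps nu p phi kappa h H z}.
  have gH : {ae (prod_prob nu), forall z, `|h (wmean alpha z)| <= H}.
    have [Nb [mNb bNb Nbsub]] := baryH.
    have mwNb : measurable (wmean alpha @^-1` Nb).
      by rewrite -[X in measurable X]setTI; exact: measurable_wmean.
    exists (wmean alpha @^-1` Nb); split => //.
      exact: (density_ge_null ppi delta0 dp mwNb bNb).
    by move=> z /= hz; apply: Nbsub.
  have cz : {ae (prod_prob nu), forall z, cube z}.
    apply: (coupling_cube mX nuX Xcube); exact: coupling_prod_prob.
  apply: filterS2 (filterI gibbs gH) (filterI cz (coupling_density_condexp bp pd)).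
  by move=> z [? ?] [? ?]; split.
have {}BP z : ~ B z -> regular_point alpha eps nu p phi kappa h H z.
  by move=> Bz; apply: contrapT => hz; apply: Bz; exact: BP.
set S := prod_prob (sample_law (N := N) nu).
pose x w := sample_tuple sample w.
have mx : measurable_fun setT x by exact: measurable_sample_tuple.
have xlaw A : measurable A -> P (x @^-1` A) = S A by exact: sample_tuple_law.
have pihat_opt w : schrodinger_minimizer alpha eps (emp_marginal N0 (x w)) (pihat w).
  have -> : emp_marginal (R := R) N0 (x w) =
      (fun j => empirical (fun k => sample j k w) N0 : probability _ R).
    apply/funext => j; rewrite /emp_marginal.
    have -> // : (fun k => tnth (x w) (obs j k)) = (fun k => sample j k w).
    by apply/funext => k; rewrite tnth_sample_tuple.
  exact: pihat_min.
pose G z := test alpha h H z * p z.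
have bG : bmfun G by apply: bmfunM => //; exact: bmfun_test.
have GU z : `|G z| <= U.
  rewrite normrM (ger0_norm (pge0 z)) (le_trans _ (pU z))// ler_piMl//.
  exact: test_le1.
have [tN|tN] := ltP (c * N%:R) t.
  (* The error is at most twice the norm, and [t / N] is bounded below. *)
  have bB : bmfun (\1_B : _ -> R) by exact: bmfun_indic.
  pose A0 := [set y | (0 < vstat (N := N) (\1_B : _ -> R) y)%R].
  have mA0 : measurable A0.
    by apply: measurable_gt_cst; apply: bmfun_measurable; exact: bmfun_vstat.
  exists (x @^-1` (~` A0)); split.
  - by rewrite -[X in measurable X]setTI; apply: mx => //; exact: measurableC.
  - move=> w /= /negP; rewrite -leNgt => wB.
    have := comparison_trivial alpha_ge0 eps_gt0 m0 ppi mh H0 mB muB BP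
      (pihat_opt w) wB.
    move=> /le_trans; apply.
    rewrite [leRHS]mulrAC [leRHS]mulrC ler_wpM2l//.
    have cs : Num.sqrt c <= s by apply: ler_wsqrtr; rewrite ler_pdivlMr// ltW.
    apply: (@le_trans _ _ (2 / Num.sqrt c * s)).
      by rewrite mulrAC ler_pdivlMr ?sqrtr_gt0// ler_pM2l.
    by rewrite ler_pM2r// lerDr ltW.
  - rewrite xlaw; last exact: measurableC.
    have -> : S (~` A0) = 1%E.
      apply: etrans (probability_setC S mA0) _.
      by rewrite (vstat_null N0 mB muB : _ = 0%E) sube0.
    by rewrite lee_fin lerBlDr lerDl mulr_ge0 ?expR_ge0// (le_trans _ pr6).
have [E [mE Egood SE]] := good_event N0 m0 U0 eta0 t1 tN bG GU bp pB mB muB.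
exists (x @^-1` E); split.
- by rewrite -[X in measurable X]setTI; exact: mx.
- move=> w /= /Egood [wB wG wW wsmall].
  have := comparison_main alpha_ge0 eps_gt0 m0 bp delta0 dp pU ppi bphi mh H0
    mB muB BP (pihat_opt w) wB s0 wG wW wsmall.
  move=> /le_trans; apply.
  rewrite [leRHS]mulrAC [leRHS]mulrC ler_wpM2l//.
  apply: (@le_trans _ _ (C1 * s)); last first.
    by rewrite ler_pM2r// lerDl divr_ge0// sqrtr_ge0.
  rewrite le_eqVlt; apply/orP; left; apply/eqP.
  rewrite -/sigma -/b -/s /C1.
  by field; rewrite !gt_eqF.
- rewrite xlaw//; apply: le_trans SE; rewrite lee_fin lerD2l lerN2.
  by rewrite ler_pM2r ?expR_gt0.
Qed.
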